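(* Let $K$ be given and let $s\in(0,\tfrac14)$. There exist $a_0=a_0(s,K)>0$ and a constant $C(s,K)<\infty$, depending only on $s$ and $K$, such that the following holds. Let $G=(V,E)$ be a connected graph with all degrees bounded by $K$, let $v_0\in V$, let $a\in(0,a_0)$, let $X$ be the linearly edge reinforced random walk on $G$ started from $v_0$ with all initial weights equal to $a$, let $\mathbf W=(W_e)_{e\in E}$ be its random environment normalized by $W_{v_0}=1$, and let $e_1$ be the first edge crossed by $X$. Then for every edge $e\in E$, $$\mathbb E\big[W_e^{\,s}\big]\;\le\;\mathbb E\left[\left(\frac{W_e}{W_{e_1}}\right)^{s}\right]\;\le\;2K\Big(C(s,K)\sqrt a\Big)^{\operatorname{dist}(e,v_0)}.$$
   Context: Graphs are undirected, possibly infinite. The linearly edge reinforced random walk (LRRW) $X_0,X_1,\dots$ on $G=(V,E)$ with starting vertex $v_0$ and constant initial weight $a>0$ is defined by $X_0=v_0$ and $$\mathbb P(X_{k+1}=w\mid X_0,\dots,X_k)=\frac{a+N_k(\langle v,w\rangle)}{d_v a+N_k(v)}\,\mathbf 1\{v\sim w\}\qquad\text{on } X_k=v,$$ where $d_v$ is the degree of $v$, $N_k(e)=|\{j<k: e=\langle X_j,X_{j+1}\rangle\}|$ is the number of traversals (in either direction) of the undirected edge $e$ up to time $k$, and $N_k(v)=\sum_{e\ni v}N_k(e)$. It is known that the LRRW is a mixture of reversible Markov chains: there is a probability measure $\mu$ (the mixing measure) on edge weight functions $\mathbf W=(W_e)_{e\in E}\in[0,\infty)^E$ such that the law of $X$ is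 $\int\mathbb P^{\mathbf W}\,d\mu(\mathbf W)$, where $\mathbb P^{\mathbf W}$ is the law of the Markov chain on $V$ started at $v_0$ with transition probabilities $W_{\langle v,w\rangle}/W_v$, $W_v=\sum_{e\ni v}W_e$. The LRRW is recurrent if it returns to every vertex infinitely many times a.s.; in the recurrent case the weights are uniquely determined by the walk after the normalization $W_{v_0}=1$. For every $K$ there is $a_1(K)>0$ such that the LRRW is recurrent on every connected graph with degrees at most $K$ whenever $a<a_1(K)$; $a_0(s,K)$ is understood to be at most $a_1(K)$, so that $\mathbf W$ is well defined. Expectations are with respect to the joint law of $(\mathbf W,X)$, i.e. $\mathbf W\sim\mu$ and, given $\mathbf W$, $X\sim\mathbb P^{\mathbf W}$. $\operatorname{dist}(e,v_0)$ is the minimal number of edges in any path from $v_0$ to either endpoint of $e$ (the minimum of the graph distances from $v_0$ to the two endpoints of $e$). *)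

(* Defs.v *)
From HB Require Import structures.
From mathcomp Require Import all_boot all_order all_algebra.
From mathcomp Require Import finmap.
From mathcomp Require Import all_classical all_reals all_analysis.

Set Implicit Arguments.
Unset Strict Implicit.
Unset Printing Implicit Defensive.

Import Order.TTheory GRing.Theory Num.Theory.

Local Open Scope classical_set_scope.
Local Open Scope ring_scope.

(* The vertex set may be infinite.  An edge <x, y> is given by a pair of
   adjacent vertices, and a function on edges by a function of two vertices
   that is symmetric on adjacent pairs; its values on non-adjacent pairs are
   never used. *)
Record graph (V : Type) := Graph {
  adj : rel V;
  adj_sym : symmetric adj;
  adj_irr : irreflexive adj }.

Section Graphs.
Variables (V : choiceType) (G : graph V).

Definition connected_graph : Prop :=
  forall x y : V, exists p : seq V, path (adj G) x p /\ last x p = y.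

(* [fset_set] is the empty set on infinite sets, hence the finiteness
   requirement in [degrees_le]. *)
Definition nbrs (v : V) : {fset V} := fset_set [set w | adj G v w].

Definition degree (v : V) : nat := #|` nbrs v|.

Definition degrees_le (K : nat) : Prop :=
  forall v, finite_set [set w | adj G v w] /\ (degree v <= K)%N.

Definition walk_of_length (x y : V) (n : nat) : Prop :=
  exists p : seq V, [/\ path (adj G) x p, last x p = y & size p = n].

(* Set to 0 when no walk joins x and y. *)
Definition gdist (x y : V) : nat :=
  match pselect (exists n, `[< walk_of_length x y n >]) with
  | left ex => ex_minn ex
  | right _ => 0%N
  end.

Definition edge_dist (x y v0 : V) : nat := minn (gdist v0 x) (gdist v0 y).

(* Here x : nat -> V is a trajectory, of which only x 0, ..., x k matter. *)
Definition edge_count (x : nat -> V) (k : nat) (v w : V) : nat :=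
  (\sum_(j < k) (((x j == v) && (x j.+1 == w)) ||
                 ((x j == w) && (x j.+1 == v))))%N.

Definition vertex_count (x : nat -> V) (k : nat) (v : V) : nat :=
  (\sum_(w <- nbrs v) edge_count x k v w)%N.

Variable R : realType.

(* P(X_{k+1} = w | X_0 = x 0, ..., X_k = x k) for the reinforced walk. *)
Definition lrrw_step (a : R) (x : nat -> V) (k : nat) (w : V) : R :=
  if adj G (x k) w
  then (a + (edge_count x k (x k) w)%:R) /
       ((degree (x k))%:R * a + (vertex_count x k (x k))%:R)
  else 0.

Definition vertex_weight (w : V -> V -> R) (v : V) : R :=
  \sum_(u <- nbrs v) w v u.

Definition chain_step (w : V -> V -> R) (v u : V) : R :=
  if adj G v u then w v u / vertex_weight w v else 0.

(* P^w(X_0 = x 0, ..., X_n = x n) for the chain started at v0. *)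
Definition chain_prob (v0 : V) (w : V -> V -> R) (x : nat -> V) (n : nat) : R :=
  (x 0%N == v0)%:R * \prod_(i < n) chain_step w (x i) (x i.+1).

Variables (d : measure_display) (T : measurableType d) (P : probability T R).

Definition cylinder (X : nat -> T -> V) (x : nat -> V) (n : nat) : set T :=
  [set t | forall i, (i <= n)%N -> X i t = x i].

(* The product form of the conditional law also covers the histories of
   probability zero, on which it says nothing. *)
Definition is_lrrw (v0 : V) (a : R) (X : nat -> T -> V) : Prop :=
  [/\ forall k v, measurable (X k @^-1` [set v]),
      {ae P, forall t, X 0%N t = v0}
    & forall (x : nat -> V) (n : nat),
        P (cylinder X x n.+1) =
        (P (cylinder X x n) * (lrrw_step a x n (x n.+1))%:E)%E].

Definition env_sigma (W : T -> V -> V -> R) : set (set T) :=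
  <<s [set A | exists x y (B : set R),
         [/\ adj G x y, measurable B & A = (fun t => W t x y) @^-1` B]] >>.

(* (W, X) has the joint law of the mixture: W is a random point of [0, oo)^E
   with W_{v0} = 1, X is the reinforced walk, and conditionally on W, X is the
   Markov chain started at v0 with transition probabilities W_<v,u> / W_v. *)
Definition is_random_environment (v0 : V) (a : R) (X : nat -> T -> V)
    (W : T -> V -> V -> R) : Prop :=
  [/\ is_lrrw v0 a X,
      forall x y, adj G x y ->
        [/\ measurable_fun setT (fun t => W t x y),
            forall t, 0 <= W t x y
          & forall t, W t x y = W t y x],
      {ae P, forall t, vertex_weight (W t) v0 = 1}
    & forall (A : set T) (x : nat -> V) (n : nat), env_sigma W A ->
        P (A `&` cylinder X x n) =
        (\int[P]_(t in A) (chain_prob v0 (W t) x n)%:E)%E].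

End Graphs.

(* Main.v *)
(** Let [g] be the path of first entrances from [v0] to the endpoint from which
    the edge e is first crossed, followed by e itself.  The ratio W_e / W_{e_1}
    is a product of the ratios of consecutive weights along [g].  At each inner
    vertex of [g], the departures to its two neighbours on [g] form an urn, and
    for the reversible chain (W_e / W_{e_1})^(2s) is dominated by a product U L,
    where L is a function of the urns only.  In a fixed environment U is bounded
    by a supermartingale and has mean at most K 7^m, where m + 1 is the length
    of [g].  Under the reinforced walk L is bounded by a supermartingale and has
    mean at most (c a)^m, because the first step from an inner vertex onwards
    along [g] has to be taken against reinforcement.  By the AM-GM inequality
    with weight a^(m/2), each [g] contributes at most K (c' sqrt a)^m, and the
    number of paths of length m + 1 is at most K^(m+1).

    That e is crossed almost surely is proved in the same way.  A walk that
    leaves a large ball with few departures from [v0] also follows a path of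
    first entrances, and the powers of ratios of weights lost by stopping at the
    exit are recovered from the reversibility of the chain, which bounds the
    number of visits to a vertex between two returns to another. *)

Require Import Defs.
From HB Require Import structures.
From mathcomp Require Import all_boot all_order all_algebra.
From mathcomp Require Import finmap.
From mathcomp Require Import all_classical all_reals all_analysis.
From mathcomp Require Import measurable_realfun.
From mathcomp Require Import ring lra zify.

Set Implicit Arguments.
Unset Strict Implicit.
Unset Printing Implicit Defensive.

Import Order.TTheory GRing.Theory Num.Theory.

Local Open Scope classical_set_scope.
Local Open Scope ring_scope.

(** * Power inequalities *)

(** The obstacle is that neither description of the law is enough alone. In a fixed environment the
    departures from a vertex are independent but nothing bounds the ratios of weights; under
    reinforcement the urns are explicit but the weights are invisible. So the ratio is split into
    two factors, each integrated under the law that controls it, and what passes from one law to the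
    other is an inequality between finite sums over walks of length [N], valid in every environment
    with the right normalization.

    The restriction s < 1/4 comes from the AM-GM inequality, which doubles the exponent. After t
    departures from a vertex the edge back towards [v0] is taken with probability at least 1/(2t),
    up to a shift of t, so the first return along it has a tail of order t^(-1/2). Its moment of
    order 2s is controlled only for 2s < 1/2.

    In the recurrence argument this return may not have happened when the walk leaves the ball. The
    ratio at such a vertex is then replaced by t^3, where t is the number of departures so far. *)

Section PowerInequalities.
Variable R : realType.
Implicit Types th u x y z r p : R.

Lemma powR_bernoulli th u : 0 <= th -> th <= 1 -> 0 <= u ->
  u `^ th <= 1 + th * (u - 1).
Proof.
move=> th0 th1 u0.
have [->|thN0] := eqVneq th 0; first by rewrite powRr0 mul0r addr0.
have [->|thN1] := eqVneq th 1; first by rewrite powRr1 //; lra.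
have thp : 0 < th by rewrite lt_neqAle eq_sym thN0.
have thq : 0 < 1 - th by rewrite subr_gt0 lt_neqAle thN1.
(* Young's inequality for the [th]-th power of [u] and 1, with exponents [1 / th] and
   [1 / (1 - th)]. *)
have := @conjugate_powR R (u `^ th) 1 th^-1 (1 - th)^-1 (powR_ge0 _ _) ler01.
rewrite !invr_gt0 !invrK => /(_ thp thq ltac:(lra)).
by rewrite mulr1 -powRrM mulfV // powRr1 // powR1; lra.
Qed.

Lemma powR_tangent th y z : 0 <= th -> th <= 1 -> 0 <= y -> 0 < z ->
  y `^ th <= z `^ th * (1 + th * (y / z - 1)).
Proof.
move=> th0 th1 y0 z0; have z0' := ltW z0.
have -> : y = z * (y / z) by rewrite mulrC divfK // gt_eqF.
rewrite powRM // ?divr_ge0 // ler_wpM2l ?powR_ge0 //.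
have -> : z * (y / z) / z = y / z by field; rewrite gt_eqF.
by apply: powR_bernoulli => //; rewrite divr_ge0.
Qed.

Lemma powR_succ th u : 0 <= th -> th <= 1 -> 1 <= u ->
  (u + 1) `^ th <= u `^ th * (1 + th / u).
Proof.
move=> th0 th1 u1; have u0 : 0 < u by lra.
apply: le_trans (@powR_tangent _ (u + 1) u th0 th1 _ u0) _; first by lra.
by rewrite ler_wpM2l ?powR_ge0 //; have : (u + 1) / u - 1 = u^-1;
  [field; rewrite gt_eqF | move=> ->].
Qed.

(** Concavity for two points with unnormalised weights [r] and 1. This is how an urn of a fixed
    environment moves: a step up is [r] times as likely as a step down. *)
Lemma powR_jensen th r x y z : 0 <= th -> th <= 1 -> 0 <= r -> 0 <= x ->
  0 <= y -> 0 < z -> r * x + y = (1 + r) * z ->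
  r * x `^ th + y `^ th <= (1 + r) * z `^ th.
Proof.
move=> th0 th1 r0 x0 y0 z0 E.
have hx := @powR_tangent th x z th0 th1 x0 z0.
have hy := @powR_tangent th y z th0 th1 y0 z0.
apply: le_trans (lerD (ler_wpM2l r0 hx) hy) _.
rewrite le_eqVlt; apply/orP; left; apply/eqP.
have -> : y = (1 + r) * z - r * x by lra.
by field; rewrite gt_eqF.
Qed.

Lemma powR_inv_succ th u : 0 <= th -> th <= 1 -> 1 <= u ->
  ((u + 1) `^ th)^-1 <= (u `^ th)^-1 * (1 - th / (2 * u)).
Proof.
move=> th0 th1 u1; have u0 : 0 < u by lra.
have := @powR_tangent th u (u + 1) th0 th1 (ltW u0) ltac:(lra).
have a0 : 0 < u `^ th by apply: powR_gt0.
have b0 : 0 < (u + 1) `^ th by apply: powR_gt0; lra.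
have h : u / (u + 1) - 1 <= - (2 * u)^-1.
  have -> : u / (u + 1) - 1 = - (u + 1)^-1 by field; lra.
  by rewrite lerN2 lef_pV2 ?posrE; lra.
move: (u `^ th) ((u + 1) `^ th) a0 b0 => A B A0 B0 H.
rewrite -(ler_pM2l B0) mulfV ?gt_eqF // -(ler_pM2r A0) mul1r.
apply: le_trans H _.
have -> : B * (A^-1 * (1 - th / (2 * u))) * A = B * (1 - th / (2 * u)).
  by field; rewrite gt_eqF //= gt_eqF.
rewrite ler_pM2l //.
have := ler_wpM2l th0 h; lra.
Qed.

(* Bounds [E[(p (t + G))^-th]] for G geometric with success probability p. *)
Definition geom_bound th p (t : R) : R :=
  1 + 4 * Num.max 0 (1 - (p * t) `^ (1 - th)).

Lemma geom_bound_ge1 th p t : 1 <= geom_bound th p t.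
Proof.
by rewrite /geom_bound lerDl mulr_ge0 // le_max lexx.
Qed.

Lemma geom_bound_le5 th p t : geom_bound th p t <= 5.
Proof.
suff : Num.max 0 (1 - (p * t) `^ (1 - th)) <= 1 by rewrite /geom_bound; lra.
by rewrite ge_max ler01 /= lerBlDr lerDl powR_ge0.
Qed.

(** With u = p t, a failure moves u by p, and the success term p u^(-th) is one term of a Riemann
    sum for the integral of v^(-th) over [u, 1], which is (1 - u^(1-th)) / (1 - th). The factor 4
    covers 1 / (1 - th) <= 2 and the discretization; beyond u = 1 the constant 1 is enough. *)
Lemma geom_bound_step th p t : 0 <= th -> th <= 2^-1 -> 0 < p -> p <= 1 ->
  1 <= t ->
  p * ((p * t) `^ th)^-1 + (1 - p) * geom_bound th p (t + 1)
    <= geom_bound th p t.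
Proof.
move=> th0 th1 p0 p1 t1; rewrite /geom_bound [p * (t + 1)]mulrDr mulr1.
have u0 : 0 < p * t by rewrite mulr_gt0 //; lra.
have pu : p <= p * t by rewrite ler_peMr // ltW.
move: (p * t) u0 pu => u u0 pu {t t1}.
set m1 := Num.max 0 (1 - u `^ _); set m2 := Num.max 0 _.
have m2_0 : 0 <= m2 by rewrite le_max lexx.
have m1_0 : 0 <= m1 by rewrite le_max lexx.
have A0 : 0 < u `^ th by apply: powR_gt0.
have m21 : m2 <= m1.
  rewrite le_max2 ?lexx ?lerD2l ?lerN2 ?ge0_ler_powR ?nnegrE; lra.
case: (lerP 1 u) => u1.
  have H : (u `^ th)^-1 <= 1.
    rewrite invf_le1 //; have := @ge0_ler_powR R th th0 1 u.
    by rewrite powR1 !nnegrE; apply => //; lra.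
  have := ler_wpM2l (ltW p0) H; have := ler_wpM2l (ltW p0) m2_0.
  rewrite -/m2; lra.
suff K : p * (u `^ th)^-1 <= p + 4 * (m1 - m2).
  have := mulr_ge0 (ltW p0) m2_0; lra.
have AE : u `^ (1 - th) = u * (u `^ th)^-1.
  by rewrite powRB ?powRr1 ?(ltW u0) //; apply/implyP => _; rewrite gt_eqF.
have m1E : m1 = 1 - u `^ (1 - th).
  rewrite /m1 max_r // subr_ge0.
  have := @ge0_ler_powR R (1 - th) ltac:(lra) u 1.
  by rewrite powR1 !nnegrE; apply; lra.
have B0 : 0 < (u `^ th)^-1 by rewrite invr_gt0.
case: (lerP (u + p) 1) => up.
  have m2E : m2 = 1 - (u + p) `^ (1 - th).
    rewrite /m2 max_r ?subr_ge0 //.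
    have := @ge0_ler_powR R (1 - th) ltac:(lra) (u + p) 1.
    by rewrite powR1 !nnegrE; apply; lra.
  suff : p * (u `^ th)^-1 <= 4 * ((u + p) `^ (1 - th) - u `^ (1 - th)).
    rewrite m1E m2E; lra.
  have C0 : 0 < (u + p) `^ (1 - th) by apply: powR_gt0; lra.
  have := @powR_tangent (1 - th) u (u + p) ltac:(lra) ltac:(lra) (ltW u0)
            ltac:(lra).
  (* Since [t >= 1], [p <= u]: one step at most doubles [u]. *)
  have h : u / (u + p) - 1 <= - (p / (2 * u)).
    have -> : u / (u + p) - 1 = - (p / (u + p)) by field; lra.
    rewrite lerN2 ler_wpM2l ?(ltW p0) // lef_pV2 ?posrE; lra.
  rewrite AE; move: ((u + p) `^ _) ((u `^ th)^-1) C0 B0 => C B C0 B0 H.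
  set q := p / (2 * u) in h.
  have q0 : 0 < q by rewrite divr_gt0 //; lra.
  have qE : p = 2 * u * q by rewrite /q; field; rewrite gt_eqF.
  have q1 : q <= 2^-1 by nra.
  have k : 1 + (1 - th) * (u / (u + p) - 1) <= 1 - q / 2.
    have : 0 <= (1 - th - 2^-1) * q by apply: mulr_ge0; lra.
    have := @ler_wpM2l R (1 - th) ltac:(lra) _ _ h; lra.
  have H2 : u * B <= C * (1 - q / 2).
    by apply: le_trans H _; rewrite ler_pM2l.
  have : u * B * (1 + q / 2) <= C.
    apply: le_trans (ler_wpM2r _ H2) _; first by lra.
    rewrite -mulrA ler_piMr ?(ltW C0) //; nra.
  rewrite qE; lra.
(* The step across 1: [p <= u < 1 < u + p] forces [u >= 1/2], so [u^(-th)] is at most 2. *)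
have m2E : m2 = 0.
  rewrite /m2 max_l // subr_le0.
  have := @ge0_ler_powR R (1 - th) ltac:(lra) 1 (u + p).
  by rewrite powR1 !nnegrE; apply; lra.
rewrite m2E subr0 m1E AE.
have uh : 2^-1 <= u by lra.
have uB : u * (u `^ th)^-1 <= u `^ th.
  rewrite -AE; apply: (ger_powR (a := u)); lra.
have B2 : (u `^ th)^-1 <= 2.
  have : (u `^ th)^-1 <= u^-1.
    rewrite lef_pV2 ?posrE //.
    have := @ger_powR R u ltac:(lra) th 1; rewrite powRr1 ?(ltW u0) //.
    by apply; lra.
  move/le_trans; apply; rewrite -[leRHS]invrK lef_pV2 ?posrE //; lra.
have A1 : u `^ th <= 1.
  have := @ge0_ler_powR R th th0 u 1.
  by rewrite powR1 !nnegrE; apply; lra.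
have BA : (u `^ th)^-1 * (u `^ th) = 1 by rewrite mulVf // gt_eqF.
move: uB B2 B0 A0 A1 BA; move: ((u `^ th)^-1) => B; move: (u `^ th) => A uB B2 B0 A0 A1 BA.
have : p * B * (1 - A) <= 2 * (1 - A).
  apply: ler_wpM2r; first by lra.
  by apply: le_trans _ B2; rewrite ler_piMl // ltW.
have -> : p * B * (1 - A) = p * B - p by rewrite mulrBr mulr1 -mulrA BA mulr1.
lra.
Qed.
End PowerInequalities.

(** * Sums over walks *)

Section Histories.
Variables (V : choiceType) (G : graph V) (v0 : V).
Implicit Types (x y : nat -> V) (k N : nat).

Fixpoint walks N : seq (seq V) :=
  if N is n.+1 then [seq rcons w u | w <- walks n, u <- nbrs G (last v0 w)]
  else [:: [:: v0]].

Definition agree k x y := forall i, (i <= k)%N -> x i = y i.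

Lemma agreeW j k x y : (j <= k)%N -> agree k x y -> agree j x y.
Proof. by move=> jk h i ij; apply: h; apply: leq_trans ij jk. Qed.

(** Adaptedness. Trajectories are total functions, so that a list of any length can be read through
    [nth v0]; only the values up to time [k] may matter. *)
Definition local (A : Type) (f : (nat -> V) -> nat -> A) :=
  forall k x y, agree k x y -> f x k = f y k.

Definition upd x k u := fun i => if (i <= k)%N then x i else u.

Lemma agree_upd x k u : agree k (upd x k u) x.
Proof. by move=> i ik; rewrite /upd ik. Qed.

Lemma upd_le x k u i : (i <= k)%N -> upd x k u i = x i.
Proof. by rewrite /upd => ->. Qed.

Lemma upd_new x k u : upd x k u k.+1 = u.
Proof. by rewrite /upd ltnn. Qed.

Definition is_walk x k := x 0%N = v0 /\ forall i, (i < k)%N -> adj G (x i) (x i.+1).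

Lemma is_walkW x j k : (j <= k)%N -> is_walk x k -> is_walk x j.
Proof.
by move=> jk [h0 h]; split=> // i ij; apply: h; apply: leq_trans ij jk.
Qed.

Lemma big_walksS (R : Type) (idx : R) (op : Monoid.law idx) N (F : seq V -> R) :
  \big[op/idx]_(w <- walks N.+1) F w =
  \big[op/idx]_(w <- walks N)
    \big[op/idx]_(u <- nbrs G (last v0 w)) F (rcons w u).
Proof. by rewrite /= big_allpairs_dep. Qed.

Hypothesis fin : forall v, finite_set [set w | adj G v w].

Lemma mem_nbrs v u : (u \in nbrs G v) = adj G v u.
Proof. by rewrite /nbrs in_fset_set //; apply/idP/idP; rewrite inE. Qed.

Lemma walksP N w : w \in walks N <-> size w = N.+1 /\ is_walk (nth v0 w) N.
Proof.
elim: N w => [|N IH] w.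
  rewrite inE; split=> [/eqP -> //|[]].
  by case: w => [|u []] //= _ [/= -> _].
rewrite /=; split.
  move=> /allpairsPdep[w' [u [/IH[sw [w0 hw]] uin ->]]].
  rewrite size_rcons sw; split=> //; split.
    by rewrite nth_rcons sw.
  move=> i; rewrite ltnS => iN; rewrite !nth_rcons sw ltnS iN.
  move: (iN); rewrite leq_eqVlt => /orP[/eqP ->|lt].
    rewrite ltnn eqxx -mem_nbrs; move: uin.
    by rewrite -nth_last sw.
  by rewrite ltnS lt; apply: hw.
case: (lastP w) => [[]//|w' u]; rewrite size_rcons => -[[sw] [w0 hw]].
apply/allpairsPdep; exists w', u; split=> //.
  apply/IH; split=> //; split.
    by move: w0; rewrite nth_rcons sw.
  move=> i iN; move: (hw i (ltnW iN)); rewrite !nth_rcons sw ltnS (ltnW iN).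
  by rewrite ltnS iN.
have := hw N (ltnSn _); rewrite !nth_rcons sw ltnSn ltnn eqxx mem_nbrs.
by rewrite -nth_last sw.
Qed.

Lemma nth_rcons_upd N w u : size w = N.+1 ->
  agree N.+1 (nth v0 (rcons w u)) (upd (nth v0 w) N u).
Proof.
move=> sw i iN; rewrite nth_rcons sw /upd ltnS.
by case: leqP => // Ni; rewrite ifT // eqn_leq iN Ni.
Qed.

Lemma size_walks K N : (forall v, (degree G v <= K)%N) ->
  (size (walks N) <= K ^ N)%N.
Proof.
move=> dK; elim: N => [//|N IH].
have -> : size (walks N.+1) = (\sum_(w <- walks N.+1) 1)%N by rewrite sum1_size.
rewrite big_walksS; apply: (@leq_trans (\sum_(w <- walks N) K)%N).
  by apply: leq_sum => w _; rewrite sum1_size dK.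
rewrite big_const_seq count_predT iter_addn_0 expnS leq_mul2l IH.
by rewrite orbT.
Qed.

Section Kernels.
Variable R : realType.
Implicit Types (p : (nat -> V) -> nat -> V -> R) (F : (nat -> V) -> nat -> R).

Definition path_weight p x k : R := \prod_(i < k) p x i (x i.+1).

Lemma path_weightS p x k :
  path_weight p x k.+1 = path_weight p x k * p x k (x k.+1).
Proof. by rewrite /path_weight big_ord_recr. Qed.

Lemma path_weight_local p : local p -> local (path_weight p).
Proof.
move=> lp k x y xy; apply: eq_bigr => i _; rewrite xy //.
by rewrite (lp i x y) //; apply: agreeW xy; rewrite ltnW.
Qed.

Lemma path_weight_ge0 p x k :
  (forall i u, (i < k)%N -> 0 <= p x i u) -> 0 <= path_weight p x k.
Proof. by move=> h; apply: prodr_ge0 => i _; apply: h. Qed.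

(** The expectation of [F] at time [N] as a finite sum. With the kernel as a parameter, one
    functional can be evaluated both under the reinforced walk and under a chain, and mixing over
    environments becomes linearity. *)
Definition kernel_sum p N F : R :=
  \sum_(w <- walks N) path_weight p (nth v0 w) N * F (nth v0 w) N.

Lemma kernel_sumS p N F : local p -> local F ->
  kernel_sum p N.+1 F =
  kernel_sum p N (fun x k => \sum_(u <- nbrs G (x k)) p x k u * F (upd x k u) k.+1).
Proof.
move=> lp lF; rewrite /kernel_sum big_walksS big_seq [RHS]big_seq.
apply: eq_bigr => w /walksP[sw _].
have -> : last v0 w = nth v0 w N by rewrite -nth_last sw.
rewrite mulr_sumr; apply: eq_bigr => u _.
have ag := @nth_rcons_upd N w u sw.
rewrite (lF _ _ _ ag) (path_weight_local lp ag) path_weightS.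
rewrite (path_weight_local lp (@agree_upd _ _ _)) upd_new.
by rewrite (lp _ _ _ (@agree_upd _ _ _)) mulrA.
Qed.

Lemma ler_kernel_sum p N F F' :
  (forall x, is_walk x N -> 0 <= path_weight p x N) ->
  (forall x, is_walk x N -> path_weight p x N != 0 -> F x N <= F' x N) ->
  kernel_sum p N F <= kernel_sum p N F'.
Proof.
move=> p0 h; rewrite /kernel_sum big_seq [leRHS]big_seq; apply: ler_sum => w.
move=> /walksP[_ hw].
have [->|nz] := eqVneq (path_weight p (nth v0 w) N) 0; first by rewrite !mul0r.
by rewrite ler_wpM2l ?p0 ?h.
Qed.

Lemma kernel_sum_super p N F : local p -> local F ->
  (forall x k u, is_walk x k -> 0 <= p x k u) ->
  (forall x k, is_walk x k ->
     \sum_(u <- nbrs G (x k)) p x k u * F (upd x k u) k.+1 <= F x k) ->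
  kernel_sum p N F <= F (fun=> v0) 0%N.
Proof.
move=> lp lF p0 h; elim: N => [|N IH].
  rewrite /kernel_sum /= big_seq1 /path_weight big_ord0 mul1r.
  by rewrite (lF 0%N _ (fun=> v0)) // => i; rewrite leqn0 => /eqP ->.
rewrite kernel_sumS //; apply: le_trans IH; apply: ler_kernel_sum => x wx.
  by apply: path_weight_ge0 => i u iN; apply: p0; apply: is_walkW wx; rewrite ltnW.
by move=> _; apply: h.
Qed.

End Kernels.

Section Stopping.
Variables (R : realType) (B : pred V).

(* The first [j < k] with [x j] outside [B], or [k] when there is none. *)
Fixpoint exit_time x k : nat :=
  if k is j.+1 then
    if (exit_time x j == j) && B (x j) then j.+1 else exit_time x j
  else 0%N.

Lemma exit_time_le x k : (exit_time x k <= k)%N.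
Proof.
elim: k => [//|k IH] /=; case: ifP => // _; exact: leq_trans IH (leqnSn _).
Qed.

Lemma exit_time_local : local exit_time.
Proof.
elim=> [//|k IH] x y xy /=; rewrite (IH x y) ?xy //.
exact: agreeW xy.
Qed.

Lemma exit_time_in x k j : (j < exit_time x k)%N -> B (x j).
Proof.
elim: k => [//|k IH] /=; case: ifP => [/andP[/eqP e Bk]|_]; last exact: IH.
by rewrite ltnS leq_eqVlt => /orP[/eqP ->//|jk]; apply: IH; rewrite e.
Qed.

Lemma exit_time_out x k : (exit_time x k < k)%N -> ~~ B (x (exit_time x k)).
Proof.
elim: k => [//|k IH] /=; case: ifP => [|/negbT]; first by rewrite ltnn.
rewrite negb_and ltnS leq_eqVlt => /orP[ne|Bk] /orP[/eqP e|lt].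
- by rewrite e eqxx in ne.
- exact: IH.
- by rewrite e.
- exact: IH.
Qed.

(** Optional stopping for a nonnegative supermartingale. Masses are bounded by 1 rather than equal
    to 1 because at a vertex of total weight 0 all chain steps are 0. *)
Lemma kernel_sum_stopped (p : (nat -> V) -> nat -> V -> R) N F :
  local p -> local F ->
  (forall x k u, is_walk x k -> 0 <= p x k u) ->
  (forall x k, is_walk x k -> \sum_(u <- nbrs G (x k)) p x k u <= 1) ->
  (forall x k, 0 <= F x k) ->
  (forall x k, is_walk x k ->
     \sum_(u <- nbrs G (x k)) p x k u * F (upd x k u) k.+1 <= F x k) ->
  kernel_sum p N (fun x k => F x (exit_time x k)) <= F (fun=> v0) 0%N.
Proof.
move=> lp lF p0 p1 F0 h.
have lE : local (fun x k => F x (exit_time x k)).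
  move=> k x y xy; rewrite (exit_time_local xy); apply: lF.
  exact: agreeW (exit_time_le _ _) xy.
apply: le_trans (kernel_sum_super N lp lE p0 _) _ => // x k wx.
have eE u : exit_time (upd x k u) k = exit_time x k.
  by apply: exit_time_local; apply: agree_upd.
case E : ((exit_time x k == k) && B (x k)).
  case/andP: (E) => /eqP e _; rewrite e; apply: le_trans (h x k wx).
  apply: ler_sum => u _; rewrite /= eE upd_le // E //.
apply: (@le_trans _ _ (\sum_(u <- nbrs G (x k)) p x k u * F x (exit_time x k))).
  apply: ler_sum => u _; rewrite /= eE upd_le // E.
  rewrite (lF (exit_time x k) _ x) //.
  exact: agreeW (exit_time_le _ _) (@agree_upd _ _ _).
by rewrite -mulr_suml ler_piMl // p1.
Qed.

End Stopping.
End Histories.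

(** * Departures seen as urns *)

Section Counts.
Variables (V : choiceType).
Implicit Types (x : nat -> V) (k : nat) (v w : V).

Definition departures x k v : nat := (\sum_(j < k) (x j == v))%N.

Definition crossings x k v w : nat :=
  (\sum_(j < k) ((x j == v) && (x j.+1 == w)))%N.

Lemma departuresS x k v : departures x k.+1 v = (departures x k v + (x k == v))%N.
Proof. by rewrite /departures big_ord_recr. Qed.

Lemma departures0 x v : departures x 0 v = 0%N.
Proof. by rewrite /departures big_ord0. Qed.

Lemma crossingsS x k v w : crossings x k.+1 v w =
  (crossings x k v w + ((x k == v) && (x k.+1 == w)))%N.
Proof. by rewrite /crossings big_ord_recr. Qed.

Lemma crossings0 x v w : crossings x 0 v w = 0%N.
Proof. by rewrite /crossings big_ord0. Qed.

Lemma departures_local v : local (fun x k => departures x k v).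
Proof. by move=> k x y xy; apply: eq_bigr => i _; rewrite xy // ltnW. Qed.

Lemma crossings_local v w : local (fun x k => crossings x k v w).
Proof. by move=> k x y xy; apply: eq_bigr => i _; rewrite !xy // ltnW. Qed.

Lemma edge_count_local v w : local (fun x k => edge_count x k v w).
Proof. by move=> k x y xy; apply: eq_bigr => i _; rewrite !xy // ltnW. Qed.

Lemma leq_departures x v j k : (j <= k)%N -> (departures x j v <= departures x k v)%N.
Proof.
move=> /subnKC <-; elim: (k - j)%N => [|n IH]; first by rewrite addn0.
by rewrite addnS departuresS; apply: leq_trans IH (leq_addr _ _).
Qed.

Lemma leq_crossings x v w j k : (j <= k)%N ->
  (crossings x j v w <= crossings x k v w)%N.
Proof.
move=> /subnKC <-; elim: (k - j)%N => [|n IH]; first by rewrite addn0.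
by rewrite addnS crossingsS; apply: leq_trans IH (leq_addr _ _).
Qed.

Lemma crossings_gt0 x v w j k : (j < k)%N -> x j = v -> x j.+1 = w ->
  (0 < crossings x k v w)%N.
Proof.
move=> jk xj xj1; apply: leq_trans (leq_crossings x v w jk).
by rewrite crossingsS xj xj1 !eqxx addn1.
Qed.

Lemma crossings_gt0P x v w k : (0 < crossings x k v w)%N ->
  exists2 j, (j < k)%N & x j = v /\ x j.+1 = w.
Proof.
elim: k => [|k IH]; first by rewrite crossings0.
rewrite crossingsS; case E: ((x k == v) && (x k.+1 == w)).
  by move=> _; exists k => //; case/andP: E => /eqP -> /eqP ->.
by rewrite addn0 => /IH[j jk e]; exists j => //; apply: ltnW.
Qed.

Lemma edge_countE x k v w : v != w ->
  edge_count x k v w = (crossings x k v w + crossings x k w v)%N.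
Proof.
move=> vw; elim: k => [|k IH].
  by rewrite /edge_count !crossings0 big_ord0.
rewrite !crossingsS /edge_count big_ord_recr /= -/(edge_count _ _ _ _) IH.
rewrite addnACA; congr (_ + _)%N.
case: eqP => [->|_] /=; last by case: eqP.
by rewrite (negbTE vw) /= orbF addn0.
Qed.

Variables (G : graph V) (v0 : V).
Hypothesis fin : forall v, finite_set [set w | adj G v w].

Lemma sum_nbrs_eq v u : adj G v u -> (\sum_(w <- nbrs G v) (u == w))%N = 1%N.
Proof.
move=> a; rewrite (bigD1_seq u) /= ?mem_nbrs ?fset_uniq // eqxx.
by rewrite big1 // => i; rewrite eq_sym => /negbTE ->.
Qed.

(** [vertex_count] counts arrivals and departures together, and along a walk these alternate; the
    two corrections account for the start at [v0] and for the present position. *)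
Lemma vertex_countE x k v : is_walk G v0 x k ->
  (vertex_count G x k v + (v0 == v) = (departures x k v).*2 + (x k == v))%N.
Proof.
elim: k => [|k IH] wx.
  rewrite departures0 wx.1 /vertex_count big1 // => w _.
  by rewrite /edge_count big_ord0.
have {}IH := IH (is_walkW (leqnSn k) wx).
have a := wx.2 k (ltnSn k).
have -> : vertex_count G x k.+1 v =
    (vertex_count G x k v + ((x k == v) + (x k.+1 == v)))%N.
  rewrite /vertex_count.
  under eq_bigr => w _ do rewrite /edge_count big_ord_recr /= -/(edge_count x k v w).
  rewrite big_split /=; congr (_ + _)%N.
  have [xkv|xkv] := eqVneq (x k) v.
    have -> : (x k.+1 == v) = false.
      by apply/negbTE; apply/eqP => e; move: a; rewrite xkv e adj_irr.
    rewrite addn0 -[RHS](@sum_nbrs_eq v (x k.+1)) -?xkv //.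
    by apply: eq_bigr => w _; rewrite andbF orbF.
  have [xkv1|xkv1] := eqVneq (x k.+1) v; last first.
    by rewrite big1 // => w _; rewrite andbF.
  rewrite -[RHS](@sum_nbrs_eq v (x k)) -?xkv1 //; last by rewrite adj_sym.
  by apply: eq_bigr => w _; rewrite andbT.
rewrite departuresS; move: IH; lia.
Qed.

End Counts.

(* The departures from a vertex [c] seen through two neighbours [mi] and [pl]:
   no step to either yet ([Idle]), the first such step went to [mi] ([Down]) or
   to [pl] ([Up]), and [DownEnd], [UpEnd] once both have been used.  The
   argument counts the departures to [mi] in [Down] and [DownEnd] and all
   departures in the other cases; it is frozen in the two end states. *)
Inductive urn_state :=
  Idle of nat | Down of nat | DownEnd of nat | Up of nat | UpEnd of nat.

Definition urn_step (to_mi to_pl : bool) (s : urn_state) : urn_state :=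
  match s with
  | Idle t => if to_mi then Down 1 else if to_pl then Up t.+1 else Idle t.+1
  | Down n => if to_mi then Down n.+1 else if to_pl then DownEnd n else Down n
  | Up t => if to_mi then UpEnd t.+1 else Up t.+1
  | s => s
  end.

Section Urn.
Variables (V : choiceType) (mi c pl : V).
Implicit Types (x : nat -> V) (k : nat).

Fixpoint urn x k : urn_state :=
  if k is j.+1 then
    if x j == c then urn_step (x j.+1 == mi) (x j.+1 == pl) (urn x j)
    else urn x j
  else Idle 0.

(* Two consequences of [mi], [c], [pl] being consecutive on a path of first
   entrances: [c] is first entered from [mi], and the edge between [c] and [pl]
   is first crossed from [c]. *)
Fixpoint first_entry_ok x k : bool :=
  if k is j.+1 then
    [&& first_entry_ok x j,
        ~~ [&& x j.+1 == c, x j != mi & crossings x j mi c == 0%N]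
      & ~~ [&& x j == pl, x j.+1 == c & crossings x j c pl == 0%N]]
  else true.

Lemma urn_local : local urn.
Proof.
elim=> [//|k IH] x y xy /=; rewrite !xy // (IH x y) //.
exact: agreeW xy.
Qed.

Lemma first_entry_ok_local : local first_entry_ok.
Proof.
elim=> [//|k IH] x y xy /=; rewrite !xy //.
have xy' := agreeW (leqnSn k) xy.
by rewrite (IH _ _ xy') (crossings_local mi c xy') (crossings_local c pl xy').
Qed.

Lemma urn_inv x k : mi != pl ->
  match urn x k with
  | Idle t => [/\ departures x k c = t, crossings x k c mi = 0%N
                & crossings x k c pl = 0%N]
  | Down n => crossings x k c mi = n /\ crossings x k c pl = 0%N
  | DownEnd _ => True
  | Up t => [/\ departures x k c = t, crossings x k c mi = 0%N & (0 < t)%N]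
  | UpEnd t => (0 < t)%N
  end.
Proof.
move=> mp; elim: k => [|k IH]; first by rewrite /= departures0 !crossings0.
rewrite /= departuresS !crossingsS; case: eqP => xkc /=; last first.
  by rewrite !addn0.
case: (urn x k) IH => [t [-> -> ->]|n [-> ->]|//|t [-> -> t0]|//] /=.
- have [->|_] /= := eqVneq (x k.+1) mi; first by rewrite (negbTE mp) !add0n.
  by case: (x k.+1 == pl) => //=; rewrite addn1.
- have [->|_] /= := eqVneq (x k.+1) mi; first by rewrite (negbTE mp) addn1.
  by case: (x k.+1 == pl) => //=; rewrite addn0.
- by case: (x k.+1 == mi) => //=; rewrite addn1.
Qed.

Lemma urn_end x k : mi != pl -> (0 < crossings x k c mi)%N ->
  (0 < crossings x k c pl)%N ->
  match urn x k with DownEnd _ | UpEnd _ => True | _ => False end.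
Proof.
move=> mp h1 h2; have := urn_inv x k mp.
case: (urn x k) => [t [_ e _]|n [_ e]|//|t [_ e _]|//].
- by rewrite e in h1.
- by rewrite e in h2.
- by rewrite e in h1.
Qed.

Lemma urn_exited x k : mi != pl -> (0 < crossings x k c pl)%N ->
  match urn x k with DownEnd _ | UpEnd _ | Up _ => True | _ => False end.
Proof.
move=> mp h; have := urn_inv x k mp.
by case: (urn x k) => [t [_ _ e]|n [_ e]|//|//|//]; rewrite e in h.
Qed.

(** What reinforcement knows at [c]: the edge to [mi] has been crossed at least once, so its weight
    exceeds 1, while the edge to [pl] keeps its initial weight until it is crossed from [c]. *)
Lemma first_entry_okP x k : x 0%N != c -> first_entry_ok x k ->
  (x k = c -> (0 < crossings x k mi c)%N) /\
  (crossings x k c pl = 0%N -> crossings x k pl c = 0%N).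
Proof.
move=> x0; elim: k => [|k IH].
  by rewrite !crossings0 => _; split=> // e; rewrite e eqxx in x0.
rewrite /= => /and3P[/IH[h1 h2] a b]; split.
  move=> e; rewrite crossingsS; move: a; rewrite e eqxx /= andbT.
  rewrite negb_and negbK lt0n => /orP[/eqP ->|n0]; first by rewrite eqxx addn1.
  by rewrite addn_eq0 negb_and n0.
rewrite !crossingsS => /eqP; rewrite addn_eq0 => /andP[/eqP e _].
rewrite h2 // add0n; move: b; rewrite e eqxx andbT.
by move/negbTE => ->.
Qed.

End Urn.

Section UrnProduct.
Variables (V : choiceType) (G : graph V) (R : realType).
Variables (g : nat -> V) (m : nat) (val : nat -> urn_state -> R).
Implicit Types (x : nat -> V) (k : nat) (q : V -> R).

Definition path_ok x k : bool :=
  [forall i : 'I_m, first_entry_ok (g i) (g i.+1) (g i.+2) x k].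

(** The indicators sit inside the product so that it is a supermartingale without conditioning: once
    the order of first entrances is violated, the product stays 0. *)
Definition urn_product x k : R :=
  \prod_(i < m) ((first_entry_ok (g i) (g i.+1) (g i.+2) x k)%:R
                 * val i (urn (g i) (g i.+1) (g i.+2) x k)).

Lemma urn_productE x k : path_ok x k ->
  urn_product x k = \prod_(i < m) val i (urn (g i) (g i.+1) (g i.+2) x k).
Proof. by move=> /forallP h; apply: eq_bigr => i _; rewrite h mul1r. Qed.

Lemma path_ok_local : local path_ok.
Proof.
move=> k x y xy; apply: eq_forallb => i; exact: first_entry_ok_local.
Qed.

Lemma urn_product_local : local urn_product.
Proof.
move=> k x y xy; apply: eq_bigr => i _.
by rewrite (first_entry_ok_local _ _ _ xy) (urn_local _ _ _ xy).
Qed.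

Hypothesis val_ge0 : forall i s, 0 <= val i s.

Lemma urn_product_ge0 x k : 0 <= urn_product x k.
Proof. by apply: prodr_ge0 => i _; rewrite mulr_ge0. Qed.

Lemma first_entry_ok_upd mi c pl x k u :
  first_entry_ok mi c pl (upd x k u) k.+1 -> first_entry_ok mi c pl x k.
Proof.
by move=> /= /and3P[]; rewrite (first_entry_ok_local _ _ _ (@agree_upd _ x k u)).
Qed.

Lemma ler_sum_two q (nb : {fset V}) v w :
  (forall u, u \in nb -> 0 <= q u) -> v \in nb -> w \in nb -> v != w ->
  q v + q w <= \sum_(u <- nb) q u.
Proof.
move=> q0 vn wn vw; rewrite (bigD1_seq v) //= ?fset_uniq // lerD2l.
rewrite big_mkcond (bigD1_seq w) //= ?fset_uniq // eq_sym vw lerDl.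
by rewrite big_seq_cond sumr_ge0 // => u /andP[un _]; case: ifP => // _; apply: q0.
Qed.

Lemma sum_two_points q (nb : {fset V}) v w (f : bool -> bool -> R) :
  (forall b c, 0 <= f b c) -> (forall u, u \in nb -> 0 <= q u) ->
  v \in nb -> w \in nb -> v != w ->
  \sum_(u <- nb) q u <= 1 ->
  \sum_(u <- nb) q u * f (u == v) (u == w)
    <= q v * f true false + q w * f false true + (1 - q v - q w) * f false false.
Proof.
move=> f0 q0 vn wn vw q1.
have sp F : \sum_(u <- nb) F u =
    F v + (F w + \sum_(u <- nb | (u != v) && (u != w)) F u) :> R.
  rewrite (bigD1_seq v) //= ?fset_uniq //; congr (_ + _).
  rewrite big_mkcond (bigD1_seq w) //= ?fset_uniq // eq_sym vw.
  by rewrite -big_mkcondr; congr (_ + _); apply: eq_bigl => u; rewrite andbC.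
rewrite sp in q1; rewrite sp !eqxx (negbTE vw) eq_sym (negbTE vw).
rewrite -addrA; do 2 apply: lerD => //.
rewrite (eq_bigr (fun u => q u * f false false)).
  by rewrite -mulr_suml ler_wpM2r //; lra.
by move=> u /andP[/negbTE -> /negbTE ->].
Qed.

Hypothesis centers_inj : forall i j, (i < m)%N -> (j < m)%N ->
  g i.+1 = g j.+1 -> i = j.

(** The urns are not independent, but a step of the walk moves at most the urn at the present
    vertex, since the centers are distinct. Supermartingales for single urns can therefore be
    multiplied. *)
Lemma urn_product_step x k q :
  (forall u, u \in nbrs G (x k) -> 0 <= q u) ->
  \sum_(u <- nbrs G (x k)) q u <= 1 ->
  (forall i, (i < m)%N -> x k = g i.+1 ->
     [/\ g i \in nbrs G (x k), g i.+2 \in nbrs G (x k) & g i != g i.+2]) ->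
  (forall i, (i < m)%N -> x k = g i.+1 ->
     first_entry_ok (g i) (g i.+1) (g i.+2) x k ->
     forall s, s = urn (g i) (g i.+1) (g i.+2) x k ->
     q (g i) * val i (urn_step true false s) +
     q (g i.+2) * val i (urn_step false true s) +
     (1 - q (g i) - q (g i.+2)) * val i (urn_step false false s) <= val i s) ->
  \sum_(u <- nbrs G (x k)) q u * urn_product (upd x k u) k.+1
    <= urn_product x k.
Proof.
move=> q0 q1 nb h.
have okle i u : (first_entry_ok (g i) (g i.+1) (g i.+2) (upd x k u) k.+1)%:R <=
    (first_entry_ok (g i) (g i.+1) (g i.+2) x k)%:R :> R.
  by rewrite ler_nat; case E: first_entry_ok => //; rewrite (first_entry_ok_upd E).
have urnE i u : urn (g i) (g i.+1) (g i.+2) (upd x k u) k.+1 =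
    if x k == g i.+1 then
      urn_step (u == g i) (u == g i.+2) (urn (g i) (g i.+1) (g i.+2) x k)
    else urn (g i) (g i.+1) (g i.+2) x k.
  by rewrite /= upd_new upd_le // (urn_local _ _ _ (@agree_upd _ x k u)).
case: (boolP [exists i : 'I_m, x k == g i.+1]); last first.
  move=> /existsPn nc.
  apply: (@le_trans _ _ (\sum_(u <- nbrs G (x k)) q u * urn_product x k)).
    rewrite big_seq [leRHS]big_seq; apply: ler_sum => u un.
    rewrite ler_wpM2l ?q0 //; apply: ler_prod => i _.
    rewrite mulr_ge0 // urnE (negbTE (nc i)) /=.
    by rewrite ler_wpM2r // okle.
  by rewrite -mulr_suml ler_piMl // urn_product_ge0.
case/existsP => i0 /eqP xi0.
have [n1 n2 n12] := nb i0 (ltn_ord i0) xi0.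
set s := urn (g i0) (g i0.+1) (g i0.+2) x k.
set A := \prod_(i < m | i != i0) ((first_entry_ok (g i) (g i.+1) (g i.+2) x k)%:R
                 * val i (urn (g i) (g i.+1) (g i.+2) x k)).
have A0 : 0 <= A by apply: prodr_ge0 => i _; rewrite mulr_ge0.
set o : R := (first_entry_ok (g i0) (g i0.+1) (g i0.+2) x k)%:R.
have E : urn_product x k = A * (o * val i0 s).
  by rewrite /urn_product (bigD1 i0) //= mulrC.
have step u : urn_product (upd x k u) k.+1 <=
    A * (o * val i0 (urn_step (u == g i0) (u == g i0.+2) s)).
  rewrite /urn_product (bigD1 i0) // [leLHS]mulrC urnE xi0 eqxx -/s.
  apply: ler_pM.
  - by apply: prodr_ge0 => i _; rewrite mulr_ge0.
  - by rewrite mulr_ge0.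
  - apply: ler_prod => i ii0; rewrite mulr_ge0 // urnE.
    case: eqP => [xi|_].
      by move: ii0; rewrite -val_eqE /= (centers_inj (ltn_ord i) (ltn_ord i0)) ?eqxx // -xi0.
    by rewrite ler_wpM2r // okle.
  - by rewrite ler_wpM2r // okle.
rewrite E; apply: (@le_trans _ _ (\sum_(u <- nbrs G (x k))
    A * (o * (q u * val i0 (urn_step (u == g i0) (u == g i0.+2) s))))).
  rewrite big_seq [leRHS]big_seq; apply: ler_sum => u un.
  rewrite (mulrCA o) (mulrCA A).
  by apply: ler_wpM2l; [exact: q0 | exact: step].
rewrite -mulr_sumr -mulr_sumr; apply: ler_wpM2l => //.
rewrite /o; case: (boolP (first_entry_ok _ _ _ _ _)) => [ok|_]; last by rewrite !mul0r.
rewrite !mul1r.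
have := @sum_two_points q (nbrs G (x k)) (g i0) (g i0.+2)
  (fun b c => val i0 (urn_step b c s)) (fun b c => val_ge0 _ _) q0 n1 n2 n12 q1.
by move/le_trans; apply; exact: h.
Qed.

End UrnProduct.

(** * The urns of the reinforced walk *)

Section ReinforcedUrn.
Variables (R : realType) (tA tB a : R).
Hypotheses (tA_gt0 : 0 < tA) (tA_le1 : tA <= 1).
Hypotheses (tB_ge0 : 0 <= tB) (tB_lt : tB < 2^-1) (a_gt0 : 0 < a).
Implicit Types (s : urn_state).

Let e : R := 2^-1 - tB.

Definition lrrw_reward s : R :=
  match s with
  | Down n | DownEnd n => (n.+1%:R `^ tA)^-1
  | Idle t | Up t | UpEnd t => t%:R `^ tB
  end.

(** Origin of the two terms. In [Down n] a step up is at most [a / (n+1)] times as likely as a step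
    down, and the sum of n^(-1-tA) is of order [1 / tA]. On the other side, avoiding [mi] from visit
    t to visit u has probability at most of order (t/u)^(1/2), so the jump to [Up] and the wait
    there each bring an integral of order [1 / e]. *)
Definition lrrw_const : R := 2 / tA + e^-1 ^+ 2.

(* The initial value is of order [a] because the step to [pl] that ends [Down n]
   has probability at most [a / n] relative to a further step to [mi], and the
   one that leaves [Idle t] at most [a / t]. *)
Definition lrrw_value s : R :=
  match s with
  | Idle t => 2 / tA * a + e^-1 ^+ 2 * a * t.+1%:R `^ tB
  | Down n => 2 / tA * a * (n.+1%:R `^ tA)^-1
  | Up t => (2 * e)^-1 * t.+1%:R `^ tB
  | s => lrrw_reward s
  end.

Let e_gt0 : 0 < e. Proof. by rewrite /e subr_gt0. Qed.

Lemma lrrw_const_gt0 : 0 < lrrw_const.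
Proof.
by apply: addr_gt0; rewrite ?exprn_gt0 ?invr_gt0 ?e_gt0 // divr_gt0.
Qed.

Lemma lrrw_value_ge0 s : 0 <= lrrw_value s.
Proof.
have c1 : 0 <= 2 / tA * a by rewrite mulr_ge0 ?ltW // divr_gt0.
have c2 : 0 <= e^-1 ^+ 2 * a by rewrite mulr_ge0 ?ltW // exprn_gt0 // invr_gt0 e_gt0.
have c3 : 0 <= (2 * e)^-1 by rewrite invr_ge0 mulr_ge0 ?ltW // e_gt0.
have c4 (x y : R) : 0 <= x -> 0 <= x * y `^ tB by move=> x0; rewrite mulr_ge0 ?powR_ge0.
case: s => n /=; rewrite ?invr_ge0 ?powR_ge0 ?c4 //.
- by rewrite addr_ge0 ?c4.
- by rewrite mulr_ge0 ?invr_ge0 ?powR_ge0.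
Qed.

Lemma lrrw_value_start : lrrw_value (Idle 0) = lrrw_const * a.
Proof. by rewrite /lrrw_const /= powR1 mulr1 -mulrDl. Qed.

(** Restricted to the states after a first step up: before it, the value carries a factor [a] and
    the reward does not. In [Up] the factor [1 / (2 e)] is at least 1 because [e <= 1/2]. *)
Lemma lrrw_reward_le_value s :
  match s with DownEnd _ | Up _ | UpEnd _ => True | _ => False end ->
  lrrw_reward s <= lrrw_value s.
Proof.
case: s => //= t _; apply: (@le_trans _ _ (t.+1%:R `^ tB)).
  by rewrite ge0_ler_powR ?nnegrE // ler_nat.
rewrite ler_peMl ?powR_ge0 // invf_ge1 ?mulr_gt0 ?e_gt0 //.
have := tB_ge0; rewrite /e; lra.
Qed.

Lemma lrrw_value_step (pm pp : R) s : 0 <= pm -> 0 <= pp -> pm + pp <= 1 ->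
  match s with
  | Idle t => pp <= a / t.+1%:R /\ (2 * t.+1%:R)^-1 <= pm
  | Down n => pp <= pm * (a / n.+1%:R)
  | Up t => (2 * t.+1%:R)^-1 <= pm
  | _ => True
  end ->
  pm * lrrw_value (urn_step true false s) +
  pp * lrrw_value (urn_step false true s) +
  (1 - pm - pp) * lrrw_value (urn_step false false s) <= lrrw_value s.
Proof.
move=> pm0 pp0 p1; have e0 := e_gt0; have tA1 := tA_le1; have tB0 := tB_ge0; have tB1 := tB_lt.
have a0 := a_gt0.
have growth t : t.+2%:R `^ tB <= t.+1%:R `^ tB * (1 + tB / t.+1%:R).
  rewrite -[X in X%:R `^ _]addn1 natrD; apply: powR_succ => //; first by lra.
  by rewrite ler1n.
have tp t : 0 < t.+1%:R :> R by rewrite ltr0n.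
have eB : tB = 2^-1 - e by rewrite /e; lra.
case: s => [t|n|n|t|t] /=.
- case=> h1 h2.
  have := growth t; rewrite eB; move: (tp t) (h1) (h2); set u := t.+1%:R.
  have u1 : 1 <= u by rewrite ler1n.
  set w := u `^ _; set w' := _ `^ _ => u0 k1 k2 g.
  have w0 : 0 < w by apply: powR_gt0.
  set i := u^-1; have i0 : 0 < i by rewrite invr_gt0.
  have iu : i * u = 1 by rewrite mulVf // gt_eqF.
  have i1 : i <= 1 by rewrite invf_le1.
  have h2' : i / 2 <= pm by move: k2; rewrite invfM [_^-1 / _]mulrC.
  have g' : w' <= w * (1 + (2^-1 - e) * i) by [].
  have w'0 : 0 <= w' by apply: powR_ge0.
  set c := 2 / tA * a; have c0 : 0 < c by rewrite mulr_gt0 // divr_gt0.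
  have y1 : (2%:R `^ tA)^-1 <= 1 :> R.
    rewrite invf_le1 ?powR_gt0 //.
    have := @ge0_ler_powR R tA (ltW tA_gt0) 1 2%:R.
    by rewrite powR1 !nnegrE; apply; lra.
  set y := (2%:R `^ tA)^-1 in y1 *.
  set E := e^-1; have E0 : 0 < E by rewrite invr_gt0.
  have Ee : E * e = 1 by rewrite mulVf // gt_eqF.
  have -> : (2 * e)^-1 = E / 2 by rewrite invfM mulrC.
  have k1' : pp <= a * i by [].
  have hw : w' <= 2 * w.
    apply: le_trans g' _; rewrite mulrC ler_pM2r //.
    have : (2^-1 - e) * i <= 1 * 1 by apply: ler_pM => //; rewrite -?eB; lra.
    lra.
  (* the gain [(1 - i/2)(1 + (1/2 - e) i) <= 1 - e i] pays for the jump to [Up] *)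
  have h3 : pp * (E / 2 * w') <= a * i * (E * w).
    apply: ler_pM => //; first by rewrite mulr_ge0 // divr_ge0 // ltW.
    have : E / 2 * w' <= E / 2 * (2 * w) by rewrite ler_wpM2l // divr_ge0 // ltW.
    lra.
  have h4 : (1 - pm - pp) * w' <= w * (1 - e * i).
    apply: (@le_trans _ _ ((1 - i / 2) * (w * (1 + (2^-1 - e) * i)))).
      by apply: ler_pM => //; lra.
    rewrite mulrCA ler_pM2l //.
    have : 0 <= (2^-1 - e) * (i * i) by apply: mulr_ge0; [rewrite -eB | apply: mulr_ge0; apply: ltW].
    by lra.
  have h5 : (1 - pm - pp) * (E ^+ 2 * a * w') <= E ^+ 2 * a * (w * (1 - e * i)).
    rewrite mulrCA; apply: ler_wpM2l => //.
    by rewrite mulr_ge0 ?exprn_ge0 ?ltW.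
  have h6 : E ^+ 2 * a * (w * (1 - e * i)) = E ^+ 2 * a * w - a * i * (E * w).
    have -> : E ^+ 2 * a * (w * (1 - e * i)) =
      E ^+ 2 * a * w - (E * e) * (a * i * (E * w)) by ring.
    by rewrite Ee mul1r.
  have h7 : pm * (c * y) <= pm * c.
    by apply: ler_wpM2l => //; rewrite ler_piMr // ltW.
  have h8 : 0 <= pp * c by rewrite mulr_ge0 // ltW.
  lra.
(* A step to [mi] lowers the value by at least the fraction [tA / (2 (n+1))]; multiplied by
   [2 a / tA], this pays for the reward collected at a step to [pl]. *)
- move=> h.
  have := @powR_inv_succ R tA n.+1%:R (ltW tA_gt0) tA1 ltac:(by rewrite ler1n).
  rewrite -[in X in X -> _](natrD _ n.+1 1) addn1.
  move: (tp n) h; set u := n.+1%:R => u0 h.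
  set y := (u `^ tA)^-1; set y' := (_ `^ tA)^-1 => g.
  have y0 : 0 < y by rewrite invr_gt0 powR_gt0.
  have k : pp * y <= pm * (a / u) * y by rewrite ler_pM2r.
  have k' : pm * (2 / tA * a * y') <= pm * (2 / tA * a * (y * (1 - tA / (2 * u)))).
    apply: ler_wpM2l => //; apply: ler_wpM2l => //.
    by rewrite mulr_ge0 ?ltW // divr_gt0.
  have E : pm * (2 / tA * a * (y * (1 - tA / (2 * u)))) =
      pm * (2 / tA * a * y) - pm * (a / u) * y.
    by field; rewrite !gt_eqF.
  have : 0 <= pp * (2 / tA * a * y).
    by rewrite mulr_ge0 // mulr_ge0 ?ltW // mulr_gt0 // divr_gt0.
  rewrite E in k'; move: k k'.
  move: (2 / tA * a * y) (2 / tA * a * y') (pm * (a / u) * y) => Z Z' D.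
  lra.
- by move=> _; rewrite le_eqVlt; apply/orP; left; apply/eqP; ring.
- move=> h.
  have := growth t; rewrite eB; move: (tp t) (h); set u := t.+1%:R.
  have u1 : 1 <= u by rewrite ler1n.
  set w := u `^ _; set w' := _ `^ _ => u0 k2 g.
  have w0 : 0 < w by apply: powR_gt0.
  set i := u^-1; have i0 : 0 < i by rewrite invr_gt0.
  have i1 : i <= 1 by rewrite invf_le1.
  have h2' : i / 2 <= pm by move: k2; rewrite invfM [_^-1 / _]mulrC.
  have g' : w' <= w * (1 + (2^-1 - e) * i) by [].
  have w'0 : 0 <= w' by apply: powR_ge0.
  have ww : w <= w' by rewrite ge0_ler_powR ?nnegrE ?ler_nat -?eB.
  set E := e^-1; have E0 : 0 < E by rewrite invr_gt0.
  have Ee : E * e = 1 by rewrite mulVf // gt_eqF.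
  have -> : (2 * e)^-1 = E / 2 by rewrite invfM mulrC.
  have E2 : 2 <= E by rewrite -[2]invrK lef_pV2 ?posrE //; lra.
  have k : (1 - pm) * (E / 2 * w' - w) <= (1 - i / 2) * (E / 2 * w' - w).
    apply: ler_wpM2r; last by lra.
    rewrite subr_ge0; apply: le_trans ww _; rewrite ler_peMl //; lra.
  (* The relative drift [- e / u] times the factor [1 / (2 e)] is exactly the closing reward
     weighted by its minimal probability [1 / (2 u)]. *)
  have k3 : E / 2 * ((1 - i / 2) * w') <= E / 2 * (w * (1 - e * i)).
    apply: ler_wpM2l; first by rewrite divr_ge0 ?ltW.
    apply: (@le_trans _ _ ((1 - i / 2) * (w * (1 + (2^-1 - e) * i)))).
      by apply: ler_wpM2l => //; lra.
    rewrite mulrCA ler_pM2l //.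
    have : 0 <= (2^-1 - e) * (i * i) by apply: mulr_ge0; [rewrite -eB | apply: mulr_ge0; apply: ltW].
    by lra.
  have k4 : E / 2 * (w * (1 - e * i)) = E / 2 * w - i / 2 * w.
    have -> : E / 2 * (w * (1 - e * i)) = E / 2 * w - (E * e) * (i / 2 * w) by ring.
    by rewrite Ee mul1r.
  lra.
- by move=> _; rewrite le_eqVlt; apply/orP; left; apply/eqP; ring.
Qed.
End ReinforcedUrn.

Section Guide.
Variables (V : choiceType) (G : graph V) (v0 : V).

(** Only the first [m + 1] vertices are distinct: the last edge may return to the path, but not to
    [g m.-1]. The last clause says this for [i = m.-1]. *)
Definition guide (g : nat -> V) (m : nat) : Prop :=
  [/\ g 0%N = v0, forall i, (i <= m)%N -> adj G (g i) (g i.+1),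
      forall i j, (i <= m)%N -> (j <= m)%N -> g i = g j -> i = j
    & forall i, (i < m)%N -> g i != g i.+2].

Variables (g : nat -> V) (m : nat).
Hypothesis gm : guide g m.

Lemma guide_centers_inj i j : (i < m)%N -> (j < m)%N -> g i.+1 = g j.+1 -> i = j.
Proof. by case: gm => _ _ inj _ im jm /(inj _ _ im jm) []. Qed.

Lemma guide_center_neq i : (i < m)%N -> v0 != g i.+1.
Proof.
by case: gm => <- _ inj _ im; apply/eqP => /(inj _ _ (leq0n _) im).
Qed.

Hypothesis fin : forall v, finite_set [set w | adj G v w].

Lemma guide_nbrs v i : (i < m)%N -> v = g i.+1 ->
  [/\ g i \in nbrs G v, g i.+2 \in nbrs G v & g i != g i.+2].
Proof.
case: gm => _ ad _ ne im ->; split; rewrite ?mem_nbrs ?ad ?ne //.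
by rewrite adj_sym ad // ltnW.
Qed.

End Guide.

Section ReinforcedWalk.
Variables (V : choiceType) (G : graph V) (v0 : V) (R : realType) (a : R).
Hypotheses (fin : forall v, finite_set [set w | adj G v w]) (a_gt0 : 0 < a).
Implicit Types (x : nat -> V) (k : nat).

Lemma vertex_count_local v : local (fun x k => vertex_count G x k v).
Proof.
by move=> k x y xy; apply: eq_bigr => w _; apply: edge_count_local.
Qed.

Lemma lrrw_step_local : local (lrrw_step G a).
Proof.
move=> k x y xy; apply/funext => u; rewrite /lrrw_step.
by rewrite (xy k (leqnn k)) (edge_count_local _ _ xy) (vertex_count_local _ xy).
Qed.

Definition lrrw_mass x k : R :=
  (degree G (x k))%:R * a + (vertex_count G x k (x k))%:R.

Lemma lrrw_stepE x k u : adj G (x k) u ->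
  lrrw_step G a x k u = (a + (edge_count x k (x k) u)%:R) / lrrw_mass x k.
Proof. by rewrite /lrrw_step => ->. Qed.

Lemma lrrw_mass_ge0 x k : 0 <= lrrw_mass x k.
Proof. by rewrite addr_ge0 // mulr_ge0 // ltW. Qed.

Lemma lrrw_step_ge0 x k u : 0 <= lrrw_step G a x k u.
Proof.
rewrite /lrrw_step; case: ifP => // _.
by rewrite divr_ge0 ?lrrw_mass_ge0 // addr_ge0 // ltW.
Qed.

Lemma lrrw_mass_gt0 x k u : adj G (x k) u -> 0 < lrrw_mass x k.
Proof.
move=> ad; rewrite /lrrw_mass ltr_pwDl // mulr_gt0 // ltr0n /degree cardfs_gt0.
by apply/fset0Pn; exists u; rewrite mem_nbrs.
Qed.

Lemma sum_lrrw_step x k : lrrw_mass x k != 0 ->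
  \sum_(u <- nbrs G (x k)) lrrw_step G a x k u = 1.
Proof.
move=> z0; rewrite big_seq.
under eq_bigr => u do [rewrite mem_nbrs // => h; rewrite lrrw_stepE //].
rewrite -big_seq -mulr_suml big_split /= -natr_sum.
rewrite big_const_seq count_predT iter_addr addr0 -[a *+ _]mulr_natl.
by rewrite -[_ + _]/(lrrw_mass x k) mulfV.
Qed.

Lemma sum_lrrw_step_le1 x k : \sum_(u <- nbrs G (x k)) lrrw_step G a x k u <= 1.
Proof.
have [z0|/sum_lrrw_step -> //] := eqVneq (lrrw_mass x k) 0.
rewrite big_seq big1 // => u; rewrite mem_nbrs // => h.
by rewrite lrrw_stepE // z0 invr0 mulr0.
Qed.

Variable K : nat.
Hypotheses (degK : forall v, (degree G v <= K)%N) (Ka : K%:R * a <= 1).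

(** [K a <= 1] lets the initial weights around a vertex count for at most one crossing, so the
    chance of going back is bounded below independently of [a]. *)
Lemma lrrw_mass_le x k : is_walk G v0 x k ->
  lrrw_mass x k <= (2 * (departures x k (x k)).+1)%:R.
Proof.
move=> wx; have := vertex_countE fin (x k) wx; rewrite eqxx => e.
have h : (vertex_count G x k (x k) <= (departures x k (x k)).*2 + 1)%N.
  by rewrite -e leq_addr.
have h2 : (degree G (x k))%:R * a <= 1.
  by apply: le_trans Ka; rewrite ler_pM2r // ler_nat degK.
apply: (@le_trans _ _ (1 + ((departures x k (x k)).*2 + 1)%:R)).
  by apply: lerD => //; rewrite ler_nat.
rewrite -[1 in leLHS]/(1%:R) -natrD ler_nat; lia.
Qed.

Lemma lrrw_mass_ge x k : is_walk G v0 x k -> v0 != x k ->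
  (departures x k (x k)).+1%:R <= lrrw_mass x k.
Proof.
move=> wx ne; have := vertex_countE fin (x k) wx.
rewrite eqxx (negbTE ne) addn0 => e; rewrite /lrrw_mass e.
apply: ler_wpDl; first by rewrite mulr_ge0 // ltW.
rewrite ler_nat; lia.
Qed.

Variables (tA tB : R).
Hypotheses (tA_gt0 : 0 < tA) (tA_le1 : tA <= 1).
Hypotheses (tB_ge0 : 0 <= tB) (tB_lt : tB < 2^-1).
Variables (g : nat -> V) (m : nat).
Hypothesis gm : guide G v0 g m.

Lemma lrrw_urn_product B N :
  kernel_sum G v0 (lrrw_step G a) N
    (fun x k => urn_product g m (fun=> lrrw_value tA tB a) x (exit_time B x k))
  <= (lrrw_const tA tB * a) ^+ m.
Proof.
have val0 (i : nat) s := lrrw_value_ge0 tA_gt0 tB_lt a_gt0 s.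
apply: le_trans (kernel_sum_stopped fin B N lrrw_step_local _ _ _ _ _) _.
- exact: urn_product_local.
- by move=> x k u _; apply: lrrw_step_ge0.
- by move=> x k _; apply: sum_lrrw_step_le1.
- by move=> x k; apply: urn_product_ge0 => i s; apply: val0.
- move=> x k wx; apply: urn_product_step => //.
  + exact: guide_centers_inj gm.
  + by move=> u _; apply: lrrw_step_ge0.
  + exact: sum_lrrw_step_le1.
  + by move=> i im xi; apply: (guide_nbrs gm fin im xi).
  move=> i im xi ok s sE.
  have [n1 n2 n12] := guide_nbrs gm fin im xi.
  have a1 : adj G (x k) (g i) by rewrite -mem_nbrs.
  have a2 : adj G (x k) (g i.+2) by rewrite -mem_nbrs.
  have nc := guide_center_neq gm im.
  have x0 : x 0%N != g i.+1 by rewrite wx.1.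
  have [c1 c2] := first_entry_okP x0 ok.
  have {}c1 := c1 xi.
  have Z0 := lrrw_mass_gt0 a1.
  have ZU := lrrw_mass_le wx.
  have ZL := lrrw_mass_ge wx ltac:(by rewrite xi).
  have nl : x k != g i by apply/eqP => e; move: a1; rewrite e adj_irr.
  have nr : x k != g i.+2 by apply/eqP => e; move: a2; rewrite e adj_irr.
  have pmE : lrrw_step G a x k (g i) =
      (a + (crossings x k (g i.+1) (g i) + crossings x k (g i) (g i.+1))%:R)
        / lrrw_mass x k.
    by rewrite lrrw_stepE // edge_countE // xi.
  have ppE : crossings x k (g i.+1) (g i.+2) = 0%N ->
      lrrw_step G a x k (g i.+2) = a / lrrw_mass x k.
    by move=> e; rewrite lrrw_stepE // edge_countE // xi e (c2 e) addr0.
  have pm1 : (lrrw_mass x k)^-1 <= lrrw_step G a x k (g i).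
    rewrite pmE ler_pdivlMr // mulVf ?gt_eqF //.
    apply: (@le_trans _ _ (0 + 1)); first by rewrite add0r.
    by apply: lerD; [exact: ltW | rewrite ler1n addn_gt0 c1 orbT].
  apply: lrrw_value_step => //; try exact: lrrw_step_ge0.
    apply: le_trans (sum_lrrw_step_le1 x k); apply: ler_sum_two => // u _.
    exact: lrrw_step_ge0.
  have := urn_inv (g i.+1) x k n12; rewrite -sE; case: s {sE} => [t [dt e1 e2]|n [e1 e2]|//|t [dt e1 _]|//].
  + split.
      rewrite ppE // ler_pM2l // lef_pV2 ?posrE ?ltr0n //.
      by rewrite -dt -{1}xi.
    apply: le_trans pm1; rewrite lef_pV2 ?posrE ?mulr_gt0 ?ltr0n //.
    by rewrite -natrM -dt -{1}xi.
  (* Both steps have the same denominator, and the edge to [mi] carries the [n] steps down together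
     with at least one entry from [mi]. *)
  + rewrite pmE ppE // mulrAC ler_pM2r ?invr_gt0 // mulrA ler_pdivlMr ?ltr0n //.
    rewrite mulrC ler_pM2r // e1; apply: ler_wpDl; first exact: ltW.
    by rewrite ler_nat -addn1 leq_add2l.
  + apply: le_trans pm1; rewrite lef_pV2 ?posrE ?mulr_gt0 ?ltr0n //.
    by rewrite -natrM -dt -{1}xi.
rewrite /urn_product (eq_bigr (fun=> lrrw_const tA tB * a)).
  by rewrite prodr_const card_ord.
by move=> i _; rewrite mul1r lrrw_value_start.
Qed.

End ReinforcedWalk.

(** * The urns of a reversible chain *)

Section ChainUrn.
Variables (R : realType) (th r p : R).
Hypotheses (th_ge0 : 0 <= th) (th_le : th <= 2^-1).
Hypotheses (r_ge0 : 0 <= r) (p_gt0 : 0 < p) (pr1 : p + p * r <= 1).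
Implicit Types (s : urn_state).

Definition chain_reward s : R :=
  match s with
  | Down n | DownEnd n => (r * n.+1%:R) `^ th
  | UpEnd t => ((p * t%:R) `^ th)^-1
  | _ => 1
  end.

(** In [Down n] with [r > 0], the final number of steps to [mi] is [n] plus a geometric variable of
    mean [1 / r]. Hence [r n + 1 + r] is the mean of the quantity whose power is rewarded, and
    Jensen's inequality puts the power outside. *)
Definition chain_value s : R :=
  match s with
  | Idle _ => 7
  | Down n => (r * n%:R + 1 + r) `^ th
  | Up t => geom_bound th p t.+1%:R
  | s => chain_reward s
  end.

Lemma chain_value_ge0 s : 0 <= chain_value s.
Proof.
case: s => n /=; rewrite ?invr_ge0 ?powR_ge0 //.
exact: le_trans ler01 (geom_bound_ge1 _ _ _).
Qed.

Lemma chain_reward_le_value s :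
  match s with DownEnd _ | Up _ | UpEnd _ => True | _ => False end ->
  chain_reward s <= chain_value s.
Proof. by case: s => //= t _; apply: geom_bound_ge1. Qed.

Lemma chain_value_step s :
  p * chain_value (urn_step true false s) +
  p * r * chain_value (urn_step false true s) +
  (1 - p - p * r) * chain_value (urn_step false false s) <= chain_value s.
Proof.
have th0 := th_ge0; have th1 := th_le; have r0 := r_ge0; have p0 := p_gt0.
have pr := pr1; have pr0 : 0 <= p * r by rewrite mulr_ge0 // ltW.
have triv z : p * z + p * r * z + (1 - p - p * r) * z <= z.
  by rewrite le_eqVlt; apply/orP; left; apply/eqP; ring.
case: s => [t|n|n|t|t] //=.
(* Here 7 is 2 + 5: with [1 + 2 r] for a first step down and 5 for a first step up, the two outcomes
   cost at most [p + 7 p r]. *)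
- have h1 : (r * 1%:R + 1 + r) `^ th <= 1 + 2 * r.
    have -> : r * 1%:R + 1 + r = 1 + 2 * r by ring.
    apply: le_trans (@powR_bernoulli R th (1 + 2 * r) th0 _ _) _; [lra|lra|].
    rewrite lerD2l addrAC subrr add0r ler_piMl ?mulr_ge0 //; lra.
  have h2 := geom_bound_le5 th p t.+2%:R.
  have := ler_wpM2l (ltW p0) h1; have := ler_wpM2l pr0 h2; lra.
- have := @powR_jensen R th r (r * n.+1%:R) (r * n.+1%:R + 1 + r) (r * n%:R + 1 + r)
    th0 ltac:(lra) r0.
  have n0 : 0 <= r * n%:R by rewrite mulr_ge0.
  have n1 : 0 <= r * n.+1%:R by rewrite mulr_ge0.
  move=> /(_ n1 ltac:(lra) ltac:(lra)).
  have -> : r * (r * n.+1%:R) + (r * n.+1%:R + 1 + r) = (1 + r) * (r * n%:R + 1 + r).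
    by rewrite -[n.+1]addn1 natrD; ring.
  move=> /(_ erefl) h; have := ler_wpM2l (ltW p0) h; lra.
- have pl : p <= 1 by lra.
  have := @geom_bound_step R th p t.+1%:R th0 th1 p0 pl ltac:(by rewrite ler1n).
  have -> : t.+1%:R + 1 = t.+2%:R :> R by rewrite -(natrD _ t.+1 1) addn1.
  set z := geom_bound _ _ _; set z' := ((_ * _) `^ th)^-1.
  lra.
Qed.

Hypothesis rp1 : r * p <= 1.

(** The splitting of one ratio. On the [Down] side the count cancels and equality holds. On the [Up]
    side [t] drops out because [th <= tB], which leaves [p^(-th)], and [r p], the probability of a
    step up, is at most 1. *)
Lemma ratio_le_rewards (tB : R) s : th <= tB ->
  match s with DownEnd _ => True | UpEnd t => (0 < t)%N | _ => False end ->
  r `^ th <= lrrw_reward th tB s * chain_reward s.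
Proof.
move=> tB1; have th0 := th_ge0; case: s => // n /=.
  move=> _; rewrite powRM // mulrCA mulVf ?mulr1 // gt_eqF // powR_gt0.
move=> n0; have n1 : 1 <= n%:R :> R by rewrite ler1n.
rewrite (powRM th (ltW p_gt0)) // invfM mulrCA.
apply: (@le_trans _ _ ((p `^ th)^-1 * 1)).
  rewrite mulr1 -[leRHS]mul1r ler_pdivlMr ?powR_gt0 //.
  rewrite -(powRM th r_ge0 (ltW p_gt0)).
  have := @ge0_ler_powR R th th0 (r * p) 1; rewrite powR1 !nnegrE; apply => //.
  by rewrite mulr_ge0 // ltW.
apply: ler_wpM2l; first by rewrite invr_ge0 powR_ge0.
by rewrite ler_pdivlMr ?powR_gt0 ?ltr0n // mul1r ler_powR.
Qed.

End ChainUrn.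

Section Chain.
Variables (V : choiceType) (G : graph V) (v0 : V) (R : realType).
Variable (w : V -> V -> R).
Hypotheses (fin : forall v, finite_set [set u | adj G v u]).
Hypothesis (w_ge0 : forall v u, adj G v u -> 0 <= w v u).
Hypothesis (w_sym : forall v u, adj G v u -> w v u = w u v).
Implicit Types (x : nat -> V) (k : nat).

Definition chain_kernel x k u := chain_step G w (x k) u.

Lemma chain_kernel_local : local chain_kernel.
Proof. by move=> k x y xy; apply/funext => u; rewrite /chain_kernel xy. Qed.

Lemma vertex_weight_ge0 v : 0 <= vertex_weight G w v.
Proof.
rewrite /vertex_weight big_seq sumr_ge0 // => u.
by rewrite mem_nbrs // => /w_ge0.
Qed.

Lemma le_vertex_weight v u : adj G v u -> w v u <= vertex_weight G w v.
Proof.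
move=> a; rewrite /vertex_weight (bigD1_seq u) ?mem_nbrs ?fset_uniq //= lerDl.
rewrite big_seq_cond sumr_ge0 // => z /andP[].
by rewrite mem_nbrs // => /w_ge0.
Qed.

Lemma chain_step_ge0 v u : 0 <= chain_step G w v u.
Proof.
rewrite /chain_step; case: ifP => // a.
by rewrite divr_ge0 ?w_ge0 // vertex_weight_ge0.
Qed.

Lemma sum_chain_step_le1 v : \sum_(u <- nbrs G v) chain_step G w v u <= 1.
Proof.
rewrite big_seq.
under eq_bigr => u do [rewrite mem_nbrs // => h; rewrite /chain_step h].
rewrite -big_seq -mulr_suml.
have [z|z] := eqVneq (vertex_weight G w v) 0; first by rewrite z invr0 mulr0.
by rewrite mulfV.
Qed.

Lemma chain_probE x k : is_walk G v0 x k ->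
  chain_prob G v0 w x k = path_weight chain_kernel x k.
Proof. by move=> wx; rewrite /chain_prob wx.1 eqxx mul1r. Qed.

Lemma path_weight_pos_edge x k i : is_walk G v0 x k ->
  path_weight chain_kernel x k != 0 -> (i < k)%N -> 0 < w (x i) (x i.+1).
Proof.
move=> wx /prodf_neq0 nz ik; have := nz (Ordinal ik) isT.
rewrite /chain_kernel /chain_step /= wx.2 // mulf_eq0 negb_or => /andP[n _].
by rewrite lt_neqAle eq_sym n w_ge0 // wx.2.
Qed.

Variables (g : nat -> V) (m : nat) (th : R).
Hypotheses (gm : guide G v0 g m) (th_ge0 : 0 <= th) (th_le : th <= 2^-1).
Hypothesis w_gt0 : forall i, (i < m)%N -> 0 < w (g i) (g i.+1).

Definition up_ratio i := w (g i.+1) (g i.+2) / w (g i) (g i.+1).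
Definition down_prob i := w (g i) (g i.+1) / vertex_weight G w (g i.+1).
Definition guide_value i := chain_value th (up_ratio i) (down_prob i).

Let ad i : (i <= m)%N -> adj G (g i) (g i.+1). Proof. by case: gm => _ h _ _; apply: h. Qed.

Lemma center_weight_gt0 i : (i < m)%N -> 0 < vertex_weight G w (g i.+1).
Proof.
move=> im; apply: lt_le_trans (w_gt0 im) _.
have a := ad (ltnW im).
by rewrite (w_sym a) le_vertex_weight // adj_sym.
Qed.

Lemma down_prob_gt0 i : (i < m)%N -> 0 < down_prob i.
Proof. by move=> im; rewrite divr_gt0 ?w_gt0 // center_weight_gt0. Qed.

Lemma up_ratio_ge0 i : (i < m)%N -> 0 <= up_ratio i.
Proof. by move=> im; rewrite divr_ge0 ?w_ge0 ?ad // ltnW. Qed.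

Lemma down_probE i : (i < m)%N -> chain_step G w (g i.+1) (g i) = down_prob i.
Proof.
move=> im; have a := ad (ltnW im).
by rewrite /chain_step adj_sym a /down_prob (w_sym a).
Qed.

Lemma up_probE i : (i < m)%N ->
  chain_step G w (g i.+1) (g i.+2) = down_prob i * up_ratio i.
Proof.
move=> im; rewrite /chain_step ad // /down_prob /up_ratio.
by field; rewrite !gt_eqF ?w_gt0 ?center_weight_gt0.
Qed.

Lemma down_up_le1 i : (i < m)%N -> down_prob i + down_prob i * up_ratio i <= 1.
Proof.
move=> im; rewrite -up_probE // -down_probE //.
have [n1 n2 n12] := guide_nbrs gm fin im erefl.
apply: le_trans (sum_chain_step_le1 (g i.+1)).
by apply: ler_sum_two => // u _; apply: chain_step_ge0.
Qed.

Lemma up_down_le1 i : (i < m)%N -> up_ratio i * down_prob i <= 1.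
Proof.
move=> im; have := down_up_le1 im; have := down_prob_gt0 im; rewrite mulrC; lra.
Qed.

Lemma guide_value_ge0 i s : 0 <= guide_value i s.
Proof. exact: chain_value_ge0. Qed.

Lemma chain_urn_step x k : is_walk G v0 x k ->
  \sum_(u <- nbrs G (x k)) chain_kernel x k u *
    urn_product g m guide_value (upd x k u) k.+1
  <= urn_product g m guide_value x k.
Proof.
move=> wx; apply: urn_product_step => //.
- exact: guide_value_ge0.
- exact: guide_centers_inj gm.
- by move=> u _; apply: chain_step_ge0.
- exact: sum_chain_step_le1.
- by move=> i im xi; apply: (guide_nbrs gm fin im xi).
move=> i im xi _ s _.
rewrite /chain_kernel xi down_probE // up_probE //.
apply: chain_value_step => //.
- exact: up_ratio_ge0.
- exact: down_prob_gt0.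
- exact: down_up_le1.
Qed.

Lemma urn_product_start x : urn_product g m guide_value x 0 = 7 ^+ m.
Proof.
rewrite /urn_product (eq_bigr (fun=> 7)) ?prodr_const ?card_ord // => i _.
by rewrite mul1r.
Qed.

Lemma chain_urn_product B N :
  kernel_sum G v0 chain_kernel N
    (fun x k => urn_product g m guide_value x (exit_time B x k)) <= 7 ^+ m.
Proof.
apply: le_trans (kernel_sum_stopped fin B N chain_kernel_local _ _ _ _ _) _.
- exact: urn_product_local.
- by move=> x k u _; apply: chain_step_ge0.
- by move=> x k _; apply: sum_chain_step_le1.
- by move=> x k; apply: urn_product_ge0 => i s; apply: guide_value_ge0.
- exact: chain_urn_step.
by rewrite urn_product_start.
Qed.

Variable K : nat.
Hypotheses (degK : forall v, (degree G v <= K)%N) (w1 : vertex_weight G w v0 = 1).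

(** Size bias: a small weight [w v0 z] has a large inverse power, but [z] is chosen with probability
    [w v0 z], which wins because [th <= 1]. As the weights at [v0] are at most 1, each neighbour
    contributes at most 1. *)
Lemma chain_first_edge u : adj G v0 u ->
  \sum_(z <- nbrs G v0) chain_step G w v0 z * (w v0 u / w v0 z) `^ th <= K%:R.
Proof.
move=> a; apply: (@le_trans _ _ (\sum_(z <- nbrs G v0) 1)); last first.
  rewrite big_const_seq count_predT iter_addr addr0 -/(degree G v0).
  by rewrite ler_nat degK.
rewrite big_seq [leRHS]big_seq; apply: ler_sum => z; rewrite mem_nbrs // => az.
rewrite /chain_step az w1 divr1.
have wz0 := w_ge0 az; have wu0 := w_ge0 a.
have wz1 : w v0 z <= 1 by rewrite -w1 le_vertex_weight.
have wu1 : w v0 u <= 1 by rewrite -w1 le_vertex_weight.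
have [->|zn] := eqVneq (w v0 z) 0; first by rewrite mul0r.
have zp : 0 < w v0 z by rewrite lt_neqAle eq_sym zn.
have th0 := th_ge0; have th1 := th_le.
rewrite powRM // ?invr_ge0 // -[_^-1]powR_inv1 // powRAC powR_inv1 ?powR_ge0 //.
rewrite mulrCA -[leRHS]mul1r; apply: ler_pM; rewrite ?powR_ge0 ?divr_ge0 ?powR_ge0 //.
  have := @ge0_ler_powR R th th0 (w v0 u) 1.
  by rewrite powR1 !nnegrE; apply.
rewrite ler_pdivrMr ?powR_gt0 // mul1r.
by rewrite -{1}[w v0 z]powRr1 //; apply: ger_powR; [rewrite zp wz1|lra].
Qed.

Definition first_factor x := (w (g 0%N) (g 1%N) / w (x 0%N) (x 1%N)) `^ th.

Lemma chain_urn_product_first N : (0 < N)%N ->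
  kernel_sum G v0 chain_kernel N
    (fun x k => first_factor x * urn_product g m guide_value x k)
  <= K%:R * 7 ^+ m.
Proof.
move=> N0.
(* The first factor is known only after one step, so the supermartingale is given the bound itself
   at time 0. The first step moves no urn, since [v0] is not a center. *)
pose F x k := if k is 0 then K%:R * 7 ^+ m
              else first_factor x * urn_product g m guide_value x k.
have FE : kernel_sum G v0 chain_kernel N
    (fun x k => first_factor x * urn_product g m guide_value x k) =
  kernel_sum G v0 chain_kernel N F.
  by apply: eq_bigr => ? _; case: N N0.
rewrite FE; apply: (kernel_sum_super fin N chain_kernel_local (F := F)).
- move=> [|k] x y xy //=.
  by rewrite (urn_product_local _ _ _ xy) /first_factor !xy.
- by move=> x k u _; apply: chain_step_ge0.
move=> x [|k] wx /=; last first.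
  apply: le_trans (ler_wpM2l _ (chain_urn_step wx)); last exact: powR_ge0.
  rewrite mulr_sumr; apply: ler_sum => u _.
  by rewrite /first_factor !upd_le // mulrCA.
have x0 := wx.1.
have nc (i : nat) : (i < m)%N -> (x 0%N == g i.+1) = false.
  by move=> im; rewrite x0; apply/negbTE; exact: (guide_center_neq gm im).
apply: (@le_trans _ _ (\sum_(u <- nbrs G (x 0%N))
   chain_step G w v0 u * (w v0 (g 1%N) / w v0 u) `^ th * 7 ^+ m)).
  apply: ler_sum => u _; rewrite /chain_kernel x0 -mulrA.
  apply: ler_wpM2l; first exact: chain_step_ge0.
  rewrite /first_factor upd_le // upd_new x0; case: gm => -> _ _ _.
  apply: ler_wpM2l; first exact: powR_ge0.
  rewrite -(urn_product_start x); apply: ler_prod => i _.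
  rewrite mulr_ge0 ?guide_value_ge0 //= (@upd_le _ x 0 u 0 (leqnn 0)) (nc i (ltn_ord i)).
  by apply: ler_pM => //; rewrite lern1 leq_b1.
rewrite -mulr_suml ler_pM2r ?exprn_gt0 // x0.
apply: chain_first_edge; case: gm => g0 _ _ _.
by rewrite -{1}g0 ad.
Qed.

End Chain.

(** * Reversibility and returns *)

Section Reversibility.
Variables (V : choiceType) (G : graph V) (R : realType) (w : V -> V -> R).
Hypotheses (fin : forall v, finite_set [set u | adj G v u]).
Hypothesis (w_ge0 : forall v u, adj G v u -> 0 <= w v u).
Hypothesis (w_sym : forall v u, adj G v u -> w v u = w u v).

Let p := chain_step G w.
Let W := vertex_weight G w.

Let p_ge0 v u : 0 <= p v u. Proof. exact: (chain_step_ge0 fin w_ge0). Qed.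

Lemma chain_step_nadj v u : ~~ adj G v u -> p v u = 0.
Proof. by rewrite /p /chain_step => /negbTE ->. Qed.

Lemma chain_flow v u : adj G v u -> W v * p v u = w v u.
Proof.
move=> a; rewrite /p /chain_step a mulrC.
have [z|nz] := eqVneq (W v) 0; last by rewrite divfK.
rewrite -/W z mulr0; apply/esym/eqP; rewrite eq_le w_ge0 // andbT -z.
exact: (le_vertex_weight fin w_ge0).
Qed.

Lemma chain_flow_sym v u : W v * p v u = W u * p u v.
Proof.
case a : (adj G v u).
  by rewrite !chain_flow // 1?adj_sym // w_sym.
by rewrite !chain_step_nadj ?mulr0 // ?a // adj_sym a.
Qed.

Lemma sum_nbrs_swap (P : pred V) y z (F : V -> R) :
  (forall v, ~~ adj G y v -> F v = 0) -> (forall v, ~~ adj G z v -> F v = 0) ->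
  \sum_(v <- nbrs G z | P v) F v = \sum_(v <- nbrs G y | P v) F v.
Proof.
move=> hy hz.
have E a b : (forall v, ~~ adj G b v -> F v = 0) ->
    \sum_(v <- nbrs G a | P v) F v =
    \sum_(v <- [seq v <- nbrs G a | v \in nbrs G b] | P v) F v.
  move=> hb; rewrite big_filter_cond big_mkcond [RHS]big_mkcond /=.
  apply: eq_bigr => v _; rewrite mem_nbrs //.
  by case: (boolP (adj G b v)) => //= /hb ->; case: (P v).
rewrite (E z y) // (E y z) //; apply: perm_big; apply: uniq_perm.
- by rewrite filter_uniq // fset_uniq.
- by rewrite filter_uniq // fset_uniq.
by move=> v; rewrite !mem_filter andbC.
Qed.

Section Avoid.
Variable u : V.

(* Probability to be at [y] after [k.+1] steps from [z], with no visit to [u]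
   at the intermediate times. *)
Fixpoint avoid k z y : R :=
  if k is j.+1 then \sum_(v <- nbrs G z | v != u) p z v * avoid j v y else p z y.

Lemma avoidSr k z y :
  avoid k.+1 z y = \sum_(v <- nbrs G y | v != u) avoid k z v * p v y.
Proof.
elim: k z y => [|k IH] z y.
  apply: sum_nbrs_swap => v nv; first by rewrite (@chain_step_nadj v) ?mulr0 // adj_sym.
  by rewrite chain_step_nadj ?mul0r.
rewrite [LHS]/=.
under eq_bigr => v _ do rewrite -/(avoid k.+1 v y) IH mulr_sumr.
rewrite exchange_big /=; apply: eq_bigr => v _.
by rewrite mulr_suml; apply: eq_bigr => v' _; rewrite mulrA.
Qed.

Lemma avoid_sym k z y : W z * avoid k z y = W y * avoid k y z.
Proof.
elim: k z y => [|k IH] z y; first exact: chain_flow_sym.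
rewrite [in RHS]avoidSr /= !mulr_sumr; apply: eq_bigr => v _.
by rewrite mulrA chain_flow_sym mulrAC IH mulrA.
Qed.

Lemma first_hit_le1 n y : \sum_(k < n) avoid k y u <= 1.
Proof.
elim: n y => [|n IH] y; first by rewrite big_ord0.
rewrite big_ord_recl /=.
under eq_bigr => i _ do rewrite /bump /= add0n.
rewrite exchange_big /=.
apply: (@le_trans _ _ (p y u + \sum_(v <- nbrs G y | v != u) p y v)).
  by rewrite lerD2l; apply: ler_sum => v _; rewrite -mulr_sumr ler_piMr.
have [a|a] := boolP (adj G y u).
  apply: le_trans (sum_chain_step_le1 w fin y).
  by rewrite [leRHS](bigD1_seq u) ?mem_nbrs ?fset_uniq.
rewrite chain_step_nadj // add0r; apply: le_trans (sum_chain_step_le1 w fin y).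
by rewrite [leRHS](bigID (fun v => v != u)) /= lerDl sumr_ge0.
Qed.

Variable y : V.

(* Expected number of visits to [y] before time [n] and before visiting [u]
   again. *)
Fixpoint visits_before n z : R :=
  if n is j.+1 then
    (z == y)%:R + \sum_(v <- nbrs G z | v != u) p z v * visits_before j v
  else 0.

Lemma visits_before_eq n z : y != u ->
  visits_before n.+1 z = (z == y)%:R + \sum_(k < n) avoid k z y.
Proof.
move=> yu; elim: n z => [|n IH] z.
  by rewrite /= big_ord0 big1 // => v _; rewrite mulr0.
rewrite [LHS]/=; congr (_ + _).
under eq_bigr => v _ do rewrite -/(visits_before n.+1 v) IH mulrDr.
rewrite big_split /= big_ord_recl /=; congr (_ + _).
  have [a|a] := boolP (adj G z y).
    rewrite big_mkcond (bigD1_seq y) ?mem_nbrs ?fset_uniq //= yu eqxx mulr1.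
    by rewrite big1 ?addr0 // => v /negbTE ->; rewrite mulr0 if_same.
  rewrite chain_step_nadj // big_seq_cond big1 // => v /andP[vz _].
  have [e|] := eqVneq v y; last by rewrite mulr0.
  by move: vz; rewrite mem_nbrs // e (negbTE a).
under [RHS]eq_bigr => i _ do rewrite /bump /= add0n.
by rewrite exchange_big /=; apply: eq_bigr => v _; rewrite mulr_sumr.
Qed.

Hypothesis Wu_gt0 : 0 < W u.

(** Time reversal: [W u] times the expected number of visits to [y] on an excursion from [u] is
    [W y] times the probability of hitting [u] from [y], in truncated form, and a probability is at
    most 1. *)
Lemma visits_before_le n : visits_before n u <= W y / W u.
Proof.
have W0 : 0 <= W y by exact: (vertex_weight_ge0 fin w_ge0).
case: n => [|n]; first by rewrite /= divr_ge0 // ltW.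
have [e|yu] := eqVneq y u.
  rewrite e divff ?gt_eqF // /= e eqxx.
  have h0 k v : v != u -> visits_before k v = 0.
    elim: k v => [//|k IH] v vu /=; rewrite e (negbTE vu) add0r big1 // => v' v'u.
    by rewrite IH // mulr0.
  by rewrite big1 ?addr0 // => v vu; rewrite h0 // mulr0.
rewrite visits_before_eq // eq_sym (negbTE yu) add0r.
rewrite ler_pdivlMr // mulrC mulr_sumr.
under eq_bigr => k _ do rewrite avoid_sym.
by rewrite -mulr_sumr ler_piMr // first_hit_le1.
Qed.

(* The same with up to [t] returns to [u]. *)
Fixpoint visits n t z : R :=
  if n is j.+1 then
    (z == y)%:R + \sum_(v <- nbrs G z) p z v *
      (if v == u then (if t is t'.+1 then visits j t' u else 0) else visits j t v)
  else 0.

Lemma visits_le n t z : visits n t z <= visits_before n z + t%:R * (W y / W u).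
Proof.
have r0 : 0 <= W y / W u by rewrite divr_ge0 ?(vertex_weight_ge0 fin w_ge0) // ltW.
elim: n t z => [|n IH] t z; first by rewrite add0r mulr_ge0.
rewrite /= -addrA lerD2l.
rewrite [X in _ <= X + _]big_mkcond /=.
apply: (@le_trans _ _ (\sum_(v <- nbrs G z) ((if v != u then
   p z v * visits_before n v else 0) + p z v * (t%:R * (W y / W u))))).
  apply: ler_sum => v _; case: eqP => [_|_] /=; last by rewrite -mulrDr ler_wpM2l.
  rewrite add0r; apply: ler_wpM2l => //.
  case: t => [|t]; first by rewrite mul0r.
  apply: le_trans (IH t u) _; rewrite -natr1 mulrDl mul1r addrC lerD2l.
  exact: visits_before_le.
rewrite big_split /= lerD2l -mulr_suml; apply: ler_piMl; first exact: mulr_ge0.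
exact: (sum_chain_step_le1 w fin).
Qed.

Lemma visits_returns n t : visits n t u <= t.+1%:R * (W y / W u).
Proof.
apply: le_trans (visits_le _ _ _) _; rewrite -natr1 mulrDl mul1r addrC lerD2l.
exact: visits_before_le.
Qed.

End Avoid.

(** Expanded from the first step on, whereas [kernel_sum] grows at the last step: [cross_then]
    consumes the trajectory from its head. *)
Fixpoint chain_exp n z (F : seq V -> R) : R :=
  if n is j.+1 then
    \sum_(v <- nbrs G z) p z v * chain_exp j v (fun l => F (v :: l))
  else F [::].

Lemma ler_chain_exp n z F F' : (forall l, F l <= F' l) ->
  chain_exp n z F <= chain_exp n z F'.
Proof.
elim: n z F F' => [|n IH] z F F' h /=; first exact: h.
by apply: ler_sum => v _; rewrite ler_wpM2l // IH.
Qed.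

Lemma chain_expD n z F F' :
  chain_exp n z (fun l => F l + F' l) = chain_exp n z F + chain_exp n z F'.
Proof.
elim: n z F F' => [//|n IH] z F F' /=.
by rewrite -big_split; apply: eq_bigr => v _; rewrite IH mulrDr.
Qed.

Lemma chain_exp0 n z : chain_exp n z (fun=> 0) = 0.
Proof. by elim: n z => [//|n IH] z /=; rewrite big1 // => v _; rewrite IH mulr0. Qed.

Lemma chain_exp_le1 n z F : (forall l, F l <= 1) -> chain_exp n z F <= 1.
Proof.
elim: n z F => [|n IH] z F h /=; first exact: h.
apply: le_trans (sum_chain_step_le1 w fin z); apply: ler_sum => v _.
by rewrite ler_piMr // IH.
Qed.

(* Starting at [z] and following [l], the edge from [y] to [h] is crossed
   during the first [t] returns to [u], and the rest of [l] satisfies [E]. *)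
Fixpoint cross_then (u y h : V) (E : seq V -> bool) t z (l : seq V) : bool :=
  if l is v :: l' then
    [&& z == y, v == h & E l'] ||
    (if v == u then (if t is t'.+1 then cross_then u y h E t' v l' else false)
     else cross_then u y h E t v l')
  else false.

(** A union bound over the time of the crossing: each visit to [y] offers the step to [h], followed,
    by the Markov property, by an event of probability at most [b]. *)
Lemma chain_exp_cross u y h (E : seq V -> bool) (b : R) n t z : 0 <= b ->
  (forall j, chain_exp j h (fun l => (E l)%:R) <= b) ->
  chain_exp n z (fun l => (cross_then u y h E t z l)%:R)
    <= visits u y n t z * (p y h * b).
Proof.
have or_le (c d : bool) : (c || d <= c + d)%N by case: c; case: d.
move=> b0 hb; elim: n t z => [|n IH] t z; first by rewrite /= mul0r.
rewrite [leRHS]/= mulrDl.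
apply: (@le_trans _ _ (\sum_(v <- nbrs G z) (p z v * chain_exp n v (fun l =>
    ([&& z == y, v == h & E l])%:R) + p z v * chain_exp n v (fun l =>
    (if v == u then
      (if t is t'.+1 then cross_then u y h E t' v l else false)
     else cross_then u y h E t v l)%:R)))).
  apply: ler_sum => v _; rewrite -mulrDr -chain_expD; apply: ler_wpM2l => //.
  by apply: ler_chain_exp => l /=; rewrite -natrD ler_nat; exact: or_le.
rewrite big_split /=; apply: lerD.
  have [->|zy] := eqVneq z y; last first.
    rewrite mul0r big1 // => v _.
    by rewrite /= chain_exp0 mulr0.
  rewrite mul1r.
  have [a|a] := boolP (adj G y h); last first.
    rewrite big_seq big1 ?mulr_ge0 // => v; rewrite mem_nbrs // => av.
    case: eqP => [e|_]; last by rewrite chain_exp0 mulr0.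
    by rewrite e (negbTE a) in av.
  rewrite (bigD1_seq h) ?mem_nbrs ?fset_uniq //= eqxx.
  rewrite big1 ?addr0 ?ler_wpM2l // => v /negbTE ->.
  by rewrite chain_exp0 mulr0.
rewrite mulr_suml; apply: ler_sum => v _; rewrite -mulrA; apply: ler_wpM2l => //.
case: eqP => [->|_]; last exact: IH.
by case: t => [|t]; [rewrite chain_exp0 mul0r | exact: IH].
Qed.

(** A stage [(t, y, h)] allows [t] visits to its starting vertex. The walk begins there, so this
    leaves [t.-1] returns; the next stage starts afresh at [h]. *)
Fixpoint stages_event (L : seq (nat * V * V)) u (l : seq V) : bool :=
  if L is (t, y, h) :: L' then
    cross_then u y h (stages_event L' h) t.-1 u l
  else true.

Fixpoint stages_bound (L : seq (nat * V * V)) u : R :=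
  if L is (t, y, h) :: L' then t%:R * (w y h / W u) * stages_bound L' h else 1.

Fixpoint stages_valid (L : seq (nat * V * V)) u : Prop :=
  if L is (t, y, h) :: L' then
    [/\ (0 < t)%N, adj G y h, 0 < W u & stages_valid L' h] else True.

Lemma stages_bound_ge0 L u : stages_valid L u -> 0 <= stages_bound L u.
Proof.
elim: L u => [//|[[t y] h] L IH] u /= [t0 a W0 v].
by rewrite mulr_ge0 ?IH // mulr_ge0 // divr_ge0 ?w_ge0 // ltW.
Qed.

Lemma stages_event_le L u n : stages_valid L u ->
  chain_exp n u (fun l => (stages_event L u l)%:R) <= stages_bound L u.
Proof.
elim: L u n => [|[[t y] h] L IH] u n /=; first by move=> _; apply: chain_exp_le1.
move=> [t0 a W0 v].
have b0 := stages_bound_ge0 v.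
apply: le_trans (chain_exp_cross u y n t.-1 u b0 (fun j => IH h j v)) _.
have := visits_returns y W0 n t.-1; rewrite prednK // => hv.
apply: le_trans (ler_wpM2r _ hv) _; first by rewrite mulr_ge0.
rewrite -(chain_flow a) le_eqVlt; apply/orP; left; apply/eqP.
by field; rewrite gt_eqF.
Qed.

End Reversibility.

(** * Exit paths cut into stages *)

Section GuideStages.
Variables (V : choiceType) (g : nat -> V) (f : nat -> nat).
Implicit Types (x : nat -> V).

(* Consecutive edges of the guide grouped into stages: a triple [i] with
   [f i = t > 0] opens a stage at [g i.+1] with [t] visits allowed; the
   edges [(g i, g i.+1)] with [f i = 0] do not end the current stage. *)
Fixpoint stages t i n : seq (nat * V * V) :=
  if n is n'.+1 then
    if f i == 0%N then stages t i.+1 n'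
    else (t, g i, g i.+1) :: stages (f i) i.+1 n'
  else [:: (t, g i, g i.+1)].

Definition future x s N : seq V := [seq x j | j <- iota s.+1 (N - s)].

Lemma future_cons x s N : (s < N)%N -> future x s N = x s.+1 :: future x s.+1 N.
Proof. by move=> sN; rewrite /future -(subnSK sN). Qed.

Lemma cross_then_future x u y h (E : seq V -> bool) t s k N : (s <= k)%N -> (k < N)%N ->
  x k = y -> x k.+1 = h -> E (future x k.+1 N) ->
  (departures x k.+1 u <= departures x s.+1 u + t)%N ->
  cross_then u y h E t (x s) (future x s N).
Proof.
move=> /subnKC; move: (k - s)%N => n; elim: n s t => [|n IH] s t.
  rewrite addn0 => -> kN xk xk1 Ek _.
  by rewrite future_cons //= xk xk1 !eqxx Ek.
move=> ks kN xk xk1 Ek dep.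
have sk : (s < k)%N by rewrite -ks addnS ltnS leq_addr.
rewrite future_cons ?(ltn_trans sk) //=; apply/orP; right.
have ks' : (s.+1 + n)%N = k by rewrite addSn -addnS.
case: (eqVneq (x s.+1) u) => [e|ne]; last first.
  by apply: IH => //; rewrite (departuresS x s.+1) (negbTE ne) addn0.
have dge : (departures x s.+2 u <= departures x k.+1 u)%N by apply: leq_departures.
case: t dep => [|t] dep.
  by move: dge; rewrite (departuresS x s.+1) e eqxx; move: dep; lia.
by apply: IH => //; rewrite (departuresS x s.+1) e eqxx; move: dep; lia.
Qed.

Lemma stages_future x (kk : nat -> nat) m N t i n s u :
  (forall j, (j <= m)%N -> x (kk j) = g j /\ x (kk j).+1 = g j.+1) ->
  (forall j, (j < m)%N -> (kk j < kk j.+1)%N) -> (kk m < N)%N ->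
  (forall j, (j < m)%N -> (0 < f j)%N ->
    (departures x (kk m).+1 (g j.+1) <= f j)%N) ->
  (i + n)%N = m -> (s <= kk i)%N -> x s = u ->
  (departures x (kk m).+1 u <= t)%N ->
  stages_event (stages t i n) u (future x s N).
Proof.
move=> hx hk kN hf; move=> inm; elim: n i t s u inm => [|n IH] i t s u inm sk xs ht.
  rewrite addn0 in inm; rewrite /= inm -xs.
  apply: (@cross_then_future x _ _ _ _ _ s (kk m)) => //.
  - by rewrite -inm.
  - by case: (hx m).
  - by case: (hx m).
  rewrite (departuresS x s) xs eqxx addn1; move: ht; lia.
have im : (i < m)%N by rewrite -inm addnS ltnS leq_addr.
have inm' : (i.+1 + n)%N = m by rewrite addSn -addnS.
have kmono j : (j <= m)%N -> (kk j <= kk m)%N.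
  move=> /subnKC; move: (m - j)%N => d; elim: d j => [|d IHd] j.
    by rewrite addn0 => ->.
  move=> e; have jm : (j < m)%N by rewrite -e addnS ltnS leq_addr.
  by apply: leq_trans (ltnW (hk j jm)) (IHd _ _); rewrite addSn -addnS.
rewrite /=; case: eqP => [_|f0].
  by apply: IH => //; apply: leq_trans sk (ltnW (hk i im)).
rewrite /= -{2}xs.
have [xk xk1] := hx i (ltnW im).
have fi : (0 < f i)%N by rewrite lt0n; apply/eqP.
apply: (@cross_then_future x _ _ _ _ _ s (kk i)) => //.
- by apply: leq_ltn_trans (kmono _ (ltnW im)) kN.
- apply: IH => //; first exact: hk.
  exact: hf.
have := leq_departures x u (kmono _ (ltnW im) : ((kk i).+1 <= (kk m).+1)%N).
rewrite (departuresS x s) xs eqxx addn1; move: ht; lia.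
Qed.

End GuideStages.

Lemma sum_inv_squares (R : realType) n :
  \sum_(j < n.+1) (if j == 0%N :> nat then 1 else j%:R ^- 2) <= 3 :> R.
Proof.
rewrite big_ord_recl /=.
suff : \sum_(i < n) ((lift ord0 i)%:R ^- 2 : R) <= 2 - n%:R^-1.
  have : 0 <= n%:R^-1 :> R by rewrite invr_ge0.
  move=> h0 h1.
  have -> : \sum_(i < n) (if lift ord0 i == 0%N :> nat then 1 else (lift ord0 i)%:R ^- 2)
    = \sum_(i < n) ((lift ord0 i)%:R ^- 2 : R) by apply: eq_bigr.
  by move: (n%:R^-1) (\sum_(i < n) _) h0 h1 => c S; lra.
elim: n => [|[|n] IH]; first by rewrite big_ord0 invr0; lra.
  by rewrite big_ord_recr big_ord0 /= /bump leq0n add1n expr1n invr1; lra.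
rewrite big_ord_recr /=; apply: le_trans (lerD IH (lexx _)) _.
rewrite /bump leq0n add1n.
have a0 : 0 < n.+1%:R :> R by rewrite ltr0n.
have -> : n.+2%:R = n.+1%:R + 1 :> R by rewrite natr1.
move: (n.+1%:R : R) a0 => a a0.
have h : (a + 1) ^- 2 <= (a * (a + 1))^-1.
  rewrite lef_pV2 ?posrE ?mulr_gt0 ?exprn_gt0 ?addr_gt0 // expr2.
  by rewrite ler_pM2r ?addr_gt0 // lerDl.
have E : (a * (a + 1))^-1 = a^-1 - (a + 1)^-1.
  by field; rewrite !gt_eqF ?addr_gt0.
rewrite E in h; lra.
Qed.

Section ChainStages.
Variables (V : choiceType) (G : graph V) (v0 : V) (R : realType) (w : V -> V -> R).
Hypotheses (fin : forall v, finite_set [set u | adj G v u]).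
Hypothesis (w_ge0 : forall v u, adj G v u -> 0 <= w v u).
Hypothesis (w_sym : forall v u, adj G v u -> w v u = w u v).

Lemma kernel_sum_chain_exp N (F : seq V -> R) :
  \sum_(l <- walks G v0 N) path_weight (chain_kernel G w) (nth v0 l) N * F l =
  chain_exp G w N v0 (fun l => F (v0 :: l)).
Proof.
have last_step n z (H : seq V -> R) : chain_exp G w n.+1 z H =
    chain_exp G w n z (fun l => \sum_(v <- nbrs G (last z l))
      chain_step G w (last z l) v * H (rcons l v)).
  elim: n z H => [//|n IH] z H.
  change (\sum_(v <- nbrs G z) chain_step G w z v *
      chain_exp G w n.+1 v (fun l => H (v :: l)) =
    \sum_(v <- nbrs G z) chain_step G w z v *
      chain_exp G w n v (fun l => \sum_(u <- nbrs G (last v l))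
        chain_step G w (last v l) u * H (v :: rcons l u))).
  by apply: eq_bigr => v _; rewrite IH.
elim: N F => [|N IH] F.
  by rewrite /= big_seq1 /path_weight big_ord0 mul1r.
rewrite big_walksS last_step -(IH (fun l => \sum_(v <- nbrs G (last v0 l))
      chain_step G w (last v0 l) v * F (rcons l v))).
rewrite big_seq [RHS]big_seq; apply: eq_bigr => l /(walksP _ fin)[sl _].
rewrite mulr_sumr; apply: eq_bigr => u _.
rewrite path_weightS (path_weight_local (@chain_kernel_local _ G _ w)
  (agreeW (leqnSn N) (nth_rcons_upd v0 u sl))).
rewrite (path_weight_local (@chain_kernel_local _ G _ w) (@agree_upd _ _ _ _)).
rewrite -mulrA; congr (_ * (_ * _)).
rewrite /chain_kernel !nth_rcons sl ltnSn ltnn eqxx.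
by rewrite -nth_last sl.
Qed.

Variables (g : nat -> V) (m : nat).
Hypothesis gm : guide G v0 g m.
Hypothesis w_gt0 : forall i, (i <= m)%N -> 0 < w (g i) (g i.+1).

Let ad i : (i <= m)%N -> adj G (g i) (g i.+1). Proof. by case: gm => _ h _ _; apply: h. Qed.
Let Wg i : (i <= m)%N -> 0 < vertex_weight G w (g i).
Proof.
move=> im; apply: lt_le_trans (w_gt0 im) _.
exact: (le_vertex_weight fin w_ge0 (ad im)).
Qed.

Lemma stages_valid_guide f t i n u : (i + n)%N = m -> (0 < t)%N ->
  0 < vertex_weight G w u -> stages_valid G w (stages g f t i n) u.
Proof.
elim: n i t u => [|n IH] i t u inm t0 Wu /=.
  by rewrite addn0 in inm; split=> //; apply: ad; rewrite inm.
have im : (i < m)%N by rewrite -inm addnS ltnS leq_addr.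
have inm' : (i.+1 + n)%N = m by rewrite addSn -addnS.
case: eqP => [_|/eqP f0]; first exact: IH.
split=> //; first by apply: ad; rewrite ltnW.
by apply: IH => //; [rewrite lt0n | apply: Wg].
Qed.

(** A vertex with flag 0 replaces the weight of an edge by that of the next one, hence its ratio.
    Where a new stage opens, its leading quotient of an edge weight by a vertex weight is at most 1,
    and only the count remains. *)
Lemma stages_bound_guide f t i n u : (i + n)%N = m -> 0 < vertex_weight G w u ->
  stages_bound G w (stages g f t i n) u <=
  t%:R * (w (g i) (g i.+1) / vertex_weight G w u) *
    \prod_(j < n) (if f (i + j)%N == 0%N then up_ratio w g (i + j) else (f (i + j)%N)%:R).
Proof.
elim: n i t u => [|n IH] i t u inm Wu /=; first by rewrite big_ord0 lexx.
have im : (i < m)%N by rewrite -inm addnS ltnS leq_addr.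
have inm' : (i.+1 + n)%N = m by rewrite addSn -addnS.
rewrite big_ord_recl addn0.
under eq_bigr => j _ do rewrite lift0 addnS -addSn.
set P := \prod_(j < n) _.
have P0 : 0 <= P.
  apply: prodr_ge0 => j _; case: ifP => // _.
  have jm : (i.+1 + j < m)%N by rewrite -inm' ltn_add2l.
  by apply: divr_ge0; rewrite ltW // w_gt0 // ltnW.
have wi := w_gt0 (ltnW im); have wi1 := w_gt0 im.
case: eqP => [f0|f0].
  apply: le_trans (IH _ _ _ inm' Wu) _.
  rewrite -/P /up_ratio le_eqVlt; apply/orP; left; apply/eqP.
  by field; rewrite !gt_eqF.
rewrite /=; apply: ler_wpM2l; first by rewrite mulr_ge0 // divr_ge0 // ltW.
apply: le_trans (IH _ _ _ inm' (Wg im)) _.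
rewrite -/P ler_wpM2r // ler_piMr // ler_pdivrMr ?Wg // mul1r.
exact: (le_vertex_weight fin w_ge0 (ad im)).
Qed.

Variables (kappa N : nat).
Hypothesis kappa_gt0 : (0 < kappa)%N.

Lemma stages_prob f :
  kernel_sum G v0 (chain_kernel G w) N
    (fun x _ => (stages_event (stages g f kappa 0 m) v0 (future x 0 N))%:R)
  <= kappa%:R *
    \prod_(j < m) (if f j == 0%N then up_ratio w g j else (f j)%:R).
Proof.
have g0 : g 0%N = v0 by case: gm.
have W0 : 0 < vertex_weight G w v0 by rewrite -g0 Wg.
have fE l : l \in walks G v0 N -> future (nth v0 l) 0 N = behead l.
  move=> /(walksP _ fin)[sl _]; rewrite /future subn0; apply: (@eq_from_nth _ v0).
    by rewrite size_map size_iota size_behead sl.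
  rewrite size_map size_iota => j jN.
  by rewrite (nth_map 0%N) ?size_iota // nth_iota // add1n nth_behead.
rewrite /kernel_sum big_seq.
under eq_bigr => l hl do rewrite fE //.
rewrite -big_seq
  (@kernel_sum_chain_exp N (fun l => (stages_event (stages g f kappa 0 m) v0 (behead l))%:R)).
apply: le_trans (stages_event_le fin w_ge0 w_sym _ _) _.
  exact: stages_valid_guide.
apply: le_trans (stages_bound_guide _ _ _ W0) _ => //.
set P := \prod_(j < m) _.
have P0 : 0 <= P.
  apply: prodr_ge0 => j _; case: ifP => // _; rewrite add0n.
  by apply: divr_ge0; rewrite ltW // w_gt0 // ltnW.
rewrite ler_wpM2r // ler_piMr // g0 ler_pdivrMr // mul1r.
by apply: (le_vertex_weight fin w_ge0); rewrite -{1}g0 ad.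
Qed.

Definition urn_flag (s : urn_state) : nat := if s is Up t then t else 0%N.

(** For an urn still in [Up t] the departures do not control the ratio, and [t^3] stands in for it:
    the stage bound costs a factor [t], and dividing by [t^3] leaves the summable [t^(-2)]. *)
Definition flag_weight i (s : urn_state) : R :=
  if s is Up t then t%:R ^+ 3 else up_ratio w g i.

Variable B : pred V.

Definition guide_states x i : urn_state :=
  urn (g i) (g i.+1) (g i.+2) x (exit_time B x N).

Definition staged_exit x : bool :=
  stages_event (stages g (fun i => urn_flag (guide_states x i)) kappa 0 m)
    v0 (future x 0 N).

Lemma stages_ext f f' t i n : (forall j, (i <= j)%N -> (j < i + n)%N -> f j = f' j) ->
  stages g f t i n = stages g f' t i n.
Proof.
elim: n i t => [//|n IH] i t h /=.
rewrite (h i) ?leqnn ?addnS ?ltnS ?leq_addr //.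
have h' j : (i < j)%N -> (j < i.+1 + n)%N -> f j = f' j.
  by move=> ij jn; apply: h; [exact: ltnW | rewrite addnS -addSn].
by case: ifP => _; rewrite IH.
Qed.

(** A union bound over all vectors of flags. Flag 0 contributes a ratio times its inverse, the
    positive flags together at most the sum of [t^(-2)], which makes 1 + 2 = 3 per inner vertex. *)
Lemma staged_exit_prob :
  kernel_sum G v0 (chain_kernel G w) N
    (fun x _ => (staged_exit x)%:R * \prod_(i < m) (flag_weight i (guide_states x i))^-1)
  <= kappa%:R * 3 ^+ m.
Proof.
have r0 i : (i < m)%N -> 0 < up_ratio w g i.
  by move=> im; rewrite divr_gt0 // w_gt0 // ltnW.
pose fn (phi : {ffun 'I_m -> 'I_N.+1}) (i : nat) : nat :=
  if insub i is Some j then phi j else 0%N.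
have fnE (phi : {ffun 'I_m -> 'I_N.+1}) (j : 'I_m) : fn phi j = phi j.
  by rewrite /fn valK.
pose c (i : nat) (t : nat) : R := if t == 0%N then (up_ratio w g i)^-1 else t%:R ^- 3.
have c0 i t : (i < m)%N -> 0 <= c i t.
  move=> im; rewrite /c; case: ifP => _; rewrite invr_ge0 ?exprn_ge0 //.
  by rewrite ltW // r0.
pose ev (phi : {ffun 'I_m -> 'I_N.+1}) x : R :=
  (stages_event (stages g (fn phi) kappa 0 m) v0 (future x 0 N))%:R.
apply: (@le_trans _ _ (kernel_sum G v0 (chain_kernel G w) N (fun x _ =>
  \sum_(phi : {ffun 'I_m -> 'I_N.+1}) (\prod_(i < m) c i (phi i)) * ev phi x))).
  apply: ler_kernel_sum => //.
    by move=> x wx; apply: path_weight_ge0 => i u _; exact: (chain_step_ge0 fin w_ge0).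
  move=> x wx _.
  have fl (i : 'I_m) : (urn_flag (guide_states x i) < N.+1)%N.
    rewrite ltnS /guide_states.
    have ne : g i != g i.+2 by case: gm => _ _ _; apply.
    have := urn_inv (g i.+1) x (exit_time B x N) ne.
    case: (urn _ _ _ _ _) => [t|t|t|t|t] //= [<- _ _].
    apply: leq_trans (exit_time_le B x N).
    rewrite -[leqRHS]muln1 -[X in (_ <= X * _)%N]card_ord -sum_nat_const.
    by apply: leq_sum => j _; case: (_ == _).
  pose phi := [ffun i : 'I_m => Ordinal (fl i)].
  rewrite (bigD1 phi) //= ler_wpDr //.
    apply: sumr_ge0 => psi _; rewrite mulr_ge0 //.
    by apply: prodr_ge0 => i _; apply: c0.
  rewrite mulrC /ev (@stages_ext (fn phi) (fun i => urn_flag (guide_states x i))).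
    rewrite -/(staged_exit x) ler_wpM2r //; apply: ler_prod => i _.
    rewrite ffunE /= /c /flag_weight /urn_flag.
    case: (guide_states x i) => [t|t|t|t|t] /=; rewrite ?invr_ge0 ?lexx ?andbT;
      try by rewrite ltW // r0.
    rewrite exprn_ge0 //=.
    (* For [Up 0] the weight is 0 and so, by convention, is its inverse; the bound by the inverse
       ratio still holds. *)
    case: eqP => [->|_ //]; rewrite expr0n /= invr0 invr_ge0 ltW //.
    exact: r0.
  move=> j _; rewrite add0n => jm.
  by rewrite -[j]/(nat_of_ord (Ordinal jm)) fnE ffunE.
rewrite /kernel_sum.
under eq_bigr => l _ do rewrite mulr_sumr.
rewrite exchange_big /=.
apply: (@le_trans _ _ (\sum_(phi : {ffun 'I_m -> 'I_N.+1})
   kappa%:R * \prod_(i < m) (if phi i == 0%N :> nat then 1 else (phi i)%:R ^- 2))).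
  apply: ler_sum => phi _.
  under eq_bigr => l _ do rewrite mulrCA.
  rewrite -mulr_sumr.
  apply: le_trans (ler_wpM2l _ (stages_prob (fn phi))) _.
    by apply: prodr_ge0 => i _; apply: c0.
  rewrite mulrCA ler_wpM2l // -big_split /=; apply: ler_prod => i _.
  rewrite fnE /c; case: eqP => [_|/eqP t0].
    by rewrite mulVf ?gt_eqF ?r0 //= ler01 lexx.
  rewrite mulr_ge0 ?invr_ge0 ?exprn_ge0 //=.
  have tn : (phi i)%:R != 0 :> R by rewrite pnatr_eq0.
  by rewrite le_eqVlt; apply/orP; left; apply/eqP; field.
rewrite -mulr_sumr ler_wpM2l // -(bigA_distr_bigA (fun _ (j : 'I_N.+1) =>
  if j == 0%N :> nat then 1 else (j%:R : R) ^- 2)) /=.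
rewrite prodr_const card_ord.
apply: lerXn2r; rewrite ?nnegrE //; last exact: sum_inv_squares.
by apply: sumr_ge0 => j _; case: ifP => // _; rewrite invr_ge0 exprn_ge0.
Qed.

End ChainStages.

(** * Paths of first entrances *)

Section FirstEntrance.
Variables (V : choiceType) (G : graph V) (v0 : V).
Implicit Types (x : nat -> V).

Record first_entrance x (g : nat -> V) (kk : nat -> nat) m : Prop :=
  FirstEntrance {
    entrance_step : forall i, (i < m)%N -> x (kk i) = g i /\ x (kk i).+1 = g i.+1;
    entrance_first : forall i l, (i < m)%N -> (l <= kk i)%N -> x l <> g i.+1;
    entrance_incr : forall i, (i.+1 < m)%N -> (kk i < kk i.+1)%N }.

Lemma first_visit x k : exists2 j, (j <= k)%N & x j = x k /\ forall l, (l < j)%N -> x l <> x k.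
Proof.
have ex : exists j, x j == x k by exists k.
case: (ex_minnP ex) => j /eqP xj jmin; exists j; first exact: jmin.
by split=> // l lj /eqP /jmin; rewrite leqNgt lj.
Qed.

(** Backwards in time: the vertex occupied just before the first visit to [x j] has a first visit of
    its own, which is strictly earlier, and strong induction applies to it. *)
Lemma first_entrance_exists x j : is_walk G v0 x j ->
  (forall l, (l < j)%N -> x l <> x j) ->
  exists m g kk, [/\ (m <= j)%N, g 0%N = v0, g m = x j, first_entrance x g kk m
    & (0 < m)%N -> (kk m.-1).+1 = j].
Proof.
elim/ltn_ind: j => -[|j] IH wx fv.
  by exists 0%N, (fun=> v0), (fun=> 0%N); split; rewrite ?wx.1 //; apply: FirstEntrance.
have [j' j'j [xj' fv']] := first_visit x j.
rewrite -xj' in fv'.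
have [//||m [g [kk [mj g0 gm [h1 h2 h3] h4]]]] := IH j' _ _ fv'.
  by apply: is_walkW wx; apply: leq_trans j'j (leqnSn _).
exists m.+1, (fun i => if (i <= m)%N then g i else x j.+1),
  (fun i => if (i < m)%N then kk i else j); split.
- by rewrite ltnS (leq_trans mj).
- by [].
- by rewrite ltnn.
- split.
  + move=> i; rewrite ltnS => im1.
    have /orP[/eqP ->|im] : (i == m) || (i < m)%N by rewrite -leq_eqVlt.
      by rewrite leqnn !ltnn gm.
    by rewrite (ltnW im) im; apply: h1.
  + move=> i l; rewrite ltnS => im1.
    have /orP[/eqP ->|im] : (i == m) || (i < m)%N by rewrite -leq_eqVlt.
      by rewrite !ltnn => lj; apply: fv.
    by rewrite im; apply: h2.
  + move=> i; rewrite ltnS => im; rewrite im.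
    case: (ltnP i.+1 m) => im'; first exact: h3.
    have e : m = i.+1 by apply/eqP; rewrite eqn_leq im im'.
    by move: h4; rewrite e /= => /(_ isT) h; rewrite h.
- by rewrite /= ltnn.
Qed.

Lemma first_entrance_mono x g kk m i j : first_entrance x g kk m ->
  (i <= j)%N -> (j < m)%N -> (kk i <= kk j)%N.
Proof.
move=> [_ _ h] /subnKC <-; elim: (j - i)%N => [|n IH]; first by rewrite addn0.
by rewrite addnS => jm; apply: leq_trans (IH (ltnW jm)) (ltnW (h _ jm)).
Qed.

Lemma first_entrance_inj x g kk m i j : first_entrance x g kk m ->
  (i <= m)%N -> (j <= m)%N -> g i = g j -> i = j.
Proof.
move=> fe; wlog ij : i j / (i < j)%N => [hw im jm e|].
  by case: (ltngtP i j) => // lt; [exact: hw | apply/esym; exact: hw].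
move=> im jm e; case: j ij jm e => // j ij jm e.
have [h1 h2 _] := fe.
have := h2 j (kk i) jm (first_entrance_mono fe (ij : (i <= j)%N) jm).
rewrite -e => ne; case: ne; exact: (h1 i (leq_ltn_trans (ij : (i <= j)%N) jm)).1.
Qed.

Lemma first_entry_ok_entrance x mi c pl k k' :
  x k = mi -> x k.+1 = c -> (forall l, (l <= k)%N -> x l <> c) ->
  x k' = c -> x k'.+1 = pl -> (k < k')%N ->
  (forall l, (l <= k')%N -> x l = pl -> x l.+1 = c -> False) ->
  forall n, first_entry_ok mi c pl x n.
Proof.
move=> xk xk1 fc xk' xk1' kk' np; elim=> [//|n IH] /=; apply/and3P; split=> //.
- apply/negP => /and3P[/eqP e1 /eqP e2 /eqP e3].
  case: (ltngtP n k) => nk.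
  + exact: (fc n.+1 nk).
  + by have := crossings_gt0 nk xk xk1; rewrite e3.
  + by apply: e2; rewrite nk.
- apply/negP => /and3P[/eqP e1 /eqP e2 /eqP e3].
  case: (leqP n k') => nk; first exact: (np n nk).
  by have := crossings_gt0 nk xk' xk1'; rewrite e3.
Qed.

Hypothesis fin : forall v, finite_set [set u | adj G v u].

(* The guide follows the first entrances of [x] back from [x k] to [v0]; its
   last edge is the one crossed at time [k]. *)
Lemma guide_of_crossing x k : is_walk G v0 x k.+1 ->
  crossings x k (x k) (x k.+1) = 0%N -> crossings x k (x k.+1) (x k) = 0%N ->
  exists m gs kk, let g := nth v0 gs in
    [/\ (m <= k)%N, gs \in walks G v0 m.+1, guide G v0 g m
      & [/\ g m = x k, g m.+1 = x k.+1, forall n, path_ok g m x n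
          & [/\ kk m = k,
          forall j, (j <= m)%N -> x (kk j) = g j /\ x (kk j).+1 = g j.+1
        & forall j, (j < m)%N -> (kk j < kk j.+1)%N]]].
Proof.
move=> wx c1 c2.
have [j jk [xj fv]] := first_visit x k; rewrite -xj in fv.
have [|m [g [kk [mj g0 gm fe h4]]]] := first_entrance_exists _ fv.
  by apply: is_walkW wx; apply: leq_trans jk (leqnSn _).
have [h1 h2 h3] := fe.
have mk : (m <= k)%N := leq_trans mj jk.
have kj i : (i < m)%N -> (kk i < j)%N.
  move=> im; have m0 : (0 < m)%N by apply: leq_ltn_trans im.
  rewrite -h4 // ltnS; apply: first_entrance_mono fe _ _; last by rewrite prednK.
  by rewrite -ltnS prednK.
pose gs := mkseq (fun i => if (i <= m)%N then g i else x k.+1) m.+2.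
pose kk' := fun i => if (i < m)%N then kk i else k.
have gE i : (i <= m)%N -> nth v0 gs i = g i.
  by move=> im; rewrite nth_mkseq ?im // ltnW // ltnS.
have g0' : nth v0 gs 0 = v0 by rewrite gE.
have gm1 : nth v0 gs m.+1 = x k.+1 by rewrite nth_mkseq // ltnn.
have stepE i : (i <= m)%N -> x (kk' i) = nth v0 gs i /\ x (kk' i).+1 = nth v0 gs i.+1.
  move=> im1; have /orP[/eqP ->|im] : (i == m) || (i < m)%N by rewrite -leq_eqVlt.
    by rewrite /kk' ltnn gE // gm1 gm xj.
  by rewrite /kk' im !gE ?(ltnW im) //; apply: h1.
have kk'k i : (i <= m)%N -> (kk' i <= k)%N.
  rewrite /kk'; case: (ltnP i m) => // im _; exact: leq_trans (ltnW (kj i im)) jk.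
have kk'i i : (i < m)%N -> (kk' i < kk' i.+1)%N.
  move=> im; rewrite /kk' im; case: (ltnP i.+1 m) => im'; first exact: h3.
  exact: leq_trans (kj i im) jk.
have adE i : (i <= m)%N -> adj G (nth v0 gs i) (nth v0 gs i.+1).
  move=> im; have [<- <-] := stepE i im; apply: wx.2.
  by rewrite ltnS kk'k.
have gd : guide G v0 (nth v0 gs) m.
  split=> //.
    move=> i l im lm; rewrite !gE //; exact: first_entrance_inj fe im lm.
  move=> i im; have [im2|im2] := ltnP i.+1 m.
    rewrite !gE ?(ltnW im) //; apply/eqP => /(first_entrance_inj fe (ltnW im) im2).
    by move=> e; have := ltn_trans (ltnSn i) (ltnSn i.+1); rewrite -e ltnn.
  (* If [g i.+2] were [g i], the step from [g i] into [g m] would already have crossed the last edge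
     backwards, against [c2]. *)
  have e : i.+1 = m by apply/eqP; rewrite eqn_leq im im2.
  have e2 : i.+2 = m.+1 by rewrite e.
  rewrite e2 gm1; apply/eqP => ge.
  have [xk1 xk2] := stepE i (ltnW im).
  have := @crossings_gt0 _ x (x k.+1) (x k) (kk' i) k.
  rewrite c2 xk1 xk2 ge e (gE m) // gm xj => h; suff: false by [].
  apply: h => //; rewrite /kk' im; exact: leq_trans (kj i im) jk.
exists m, gs, kk'; split=> //.
- apply/(walksP _ fin); split; first by rewrite size_mkseq.
  by split=> [|i im]; [exact: g0' | exact: adE].
split=> //; first by rewrite gE // gm.
  move=> n; apply/forallP => i; move: (nat_of_ord i) (ltn_ord i) => {}i im.
  have [a1 a2] := stepE i (ltnW im); have [b1 b2] := stepE i.+1 im.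
  apply: (first_entry_ok_entrance a1 a2 _ b1 b2 (kk'i i im)).
    move=> l; rewrite /kk' im gE //; exact: h2.
  move=> l; rewrite /kk'; case: (ltnP i.+1 m) => im'.
    move=> lk xl _; move: (h2 i.+1 l im' lk); rewrite xl gE //.
  have e : i.+1 = m by apply/eqP; rewrite eqn_leq im im'.
  rewrite e gm1 gE // gm xj => lk1 xl xl1.
  have /orP[/eqP lE|lk] : (l == k) || (l < k)%N by rewrite -leq_eqVlt.
    rewrite lE in xl.
    by have := wx.2 k (ltnSn k); rewrite xl adj_irr.
  by have := crossings_gt0 lk xl xl1; rewrite c2.
by split=> //; rewrite /kk' ltnn.
Qed.

End FirstEntrance.

(** * Random environments *)

Lemma measurable_inv d (T : measurableType d) (R : realType) (f : T -> R) : (forall t, 0 <= f t) ->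
  measurable_fun setT f -> measurable_fun setT (fun t => (f t)^-1).
Proof.
move=> f0 mf; rewrite (_ : (fun t => _) = (fun t => (f t) `^ (-1))).
  exact: (measurableT_comp (measurable_powR (-1)) mf).
by apply/funext => t; rewrite powR_inv1.
Qed.

Section IntegrationFacts.
Context d (T : measurableType d) (R : realType).
Variable P : {measure set T -> \bar R}.
Local Open Scope ereal_scope.
Import HBNNSimple.

(* The integral of a nonnegative function is a supremum over simple functions
   below it, so these two comparisons need no measurability of [f]. *)
Lemma ge0_le_integralT (f g : T -> \bar R) :
  (forall t, 0 <= g t) -> (forall t, g t <= f t) ->
  \int[P]_t g t <= \int[P]_t f t.
Proof.
move=> g0 gf; rewrite !ge0_integralTE //; last first.
  by move=> t; apply: le_trans (g0 t) (gf t).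
apply: ge_ereal_sup => /= _ [h hg <-]; apply: ereal_sup_ubound; exists h => //= t.
exact: le_trans (hg t) (gf t).
Qed.

Lemma ae_ge0_le_integralT (f g : T -> \bar R) :
  (forall t, 0 <= f t) -> (forall t, 0 <= g t) -> measurable_fun setT g ->
  {ae P, forall t, f t <= g t} -> \int[P]_t f t <= \int[P]_t g t.
Proof.
move=> f0 g0 mg fg; rewrite ge0_integralTE //.
apply: ge_ereal_sup => /= _ [h hf <-]; rewrite -integralT_nnsfun.
apply: ae_ge0_le_integral => //.
- by move=> t _; rewrite lee_fin.
- by apply/measurable_EFinP.
- by apply: filterS fg => t h1 _; apply: le_trans (hf t) h1.
Qed.

Lemma le_ae_ge0_integralT (f g : T -> \bar R) :
  (forall t, 0 <= f t) -> (forall t, 0 <= g t) -> measurable_fun setT g ->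
  {ae P, forall t, g t <= f t} -> \int[P]_t g t <= \int[P]_t f t.
Proof.
move=> f0 g0 mg [N [mN N0 sub]].
rewrite [leLHS](_ : _ = \int[P]_t (g \_ (~` N)) t); last first.
  apply: ae_eq_integral => //.
    by apply/(measurable_restrictT g (measurableC mN)); exact: measurable_funTS.
  exists N; split=> // t /= h; apply: contrapT => nN; apply: h => _.
  by rewrite patchE mem_set.
apply: ge0_le_integralT => t.
  by rewrite patchE; case: ifP.
rewrite patchE; case: ifPn => [/set_mem nN|_] //.
by apply: contrapT => h; apply: nN; apply: sub.
Qed.

(** [A] lies in the increasing union of the sets on which all late [E n] hold, and continuity from
    below bounds this union by [e]. Thus [A] is enclosed in measurable sets of small measure. *)
Lemma negligible_liminf (A : set T) :
  (forall e : R, (0 < e)%R -> exists E : nat -> set T,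
     [/\ forall n, measurable (E n), forall n, P (E n) <= e%:E
       & forall t, A t -> exists M, forall n, (M <= n)%N -> E n t]) ->
  P.-negligible A.
Proof.
move=> h.
have h2 k : exists B : set T,
    [/\ measurable B, P B <= (k.+1%:R^-1)%:E & A `<=` B].
  have [|E [mE PE AE]] := h (k.+1%:R^-1)%R; first by rewrite invr_gt0.
  pose F M := \bigcap_(n in [set n | (M <= n)%N]) E n.
  have mF M : measurable (F M) by apply: bigcap_measurableType.
  have mU : measurable (\bigcup_M F M) by apply: bigcupT_measurable.
  exists (\bigcup_M F M); split=> //.
    have nd : {homo F : n m / (n <= m)%N >-> (n <= m)%O}.
      move=> n m nm; apply/subsetPset => t Ft l ml; apply: Ft.
      by apply: leq_trans nm ml.
    have cv := @nondecreasing_cvg_mu _ _ _ P F mF mU nd.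
    rewrite -(cvg_lim _ cv) //; apply: lime_le; first by apply/cvg_ex; exists (P (\bigcup_M F M)).
    apply: nearW => M /=; apply: le_trans (PE M).
    by apply: le_measure; rewrite ?inE // => t; apply => /=.
  move=> t /AE [M hM]; exists M => // n; exact: hM.
have [B hB] := choice h2.
exists (\bigcap_k B k); split.
- by apply: bigcap_measurableType => k _; case: (hB k).
- apply/eqP; rewrite eq_le measure_ge0 andbT; apply/lee_addgt0Pr => e e0.
  rewrite add0e; have [k ke] : exists k, (k.+1%:R^-1 <= e)%R.
    exists (Num.Def.truncn e^-1).
    by rewrite -[leRHS]invrK lef_pV2 ?posrE ?invr_gt0 // ltW // truncnS_gt.
  have [mB PB _] := hB k.
  apply: (@le_trans _ _ (P (B k))); last by apply: le_trans PB _; rewrite lee_fin.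
  apply: le_measure; rewrite ?inE //; last by move=> t; apply.
  by apply: bigcap_measurableType => j _; case: (hB j).
- by move=> t At k _; have [_ _] := hB k; apply.
Qed.

(** The conditional law is given on events of the environment; simple functions on the generated
    sigma-algebra and monotone convergence carry it over to functions of the environment, such as
    ratios of weights. *)
Lemma integral_sub_sigma (Gen : set (set T)) (C : set T) (rho F : T -> R) :
  Gen `<=` measurable -> measurable C ->
  (forall t, (0 <= rho t)%R) -> measurable_fun setT rho ->
  (forall A, <<s Gen >> A -> P (A `&` C) = \int[P]_(t in A) (rho t)%:E) ->
  (forall t, (0 <= F t)%R) ->
  measurable_fun [set: g_sigma_algebraType Gen] (F : g_sigma_algebraType Gen -> R) ->
  \int[P]_(t in C) (F t)%:E = \int[P]_t (F t * rho t)%:E.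
Proof.
move=> Gm mC rho0 mrho hA F0 mF.
pose T' := g_sigma_algebraType Gen.
have sub (A : set T) : measurable (A : set T') -> measurable A.
  by apply: smallest_sub => //; exact: sigma_algebra_measurable.
have mEF : measurable_fun [set: T'] (EFin \o (F : T' -> R)) by apply/measurable_EFinP.
pose h := nnsfun_approx (measurableT : measurable [set: T']) mEF.
have mh n : measurable_fun [set: T] (h n : T -> R).
  by move=> _ B mB; rewrite setTI; apply: sub; exact: (measurable_funPTI (h n) mB).
have h0 n t : (0 <= h n t)%R by [].
have hnd t : {homo (fun n => h n t) : n m / (n <= m)%N >-> (n <= m)%R}.
  move=> n m nm; have := nd_nnsfun_approx (measurableT : measurable [set: T']) mEF nm.
  by move/lefP; apply.
have hcv t : (EFin \o h ^~ t) n @[n --> \oo] --> (F t)%:E.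
  have F0' (t' : T') : [set: T'] t' -> 0 <= (EFin \o (F : T' -> R)) t'.
    by move=> _; rewrite lee_fin.
  exact: (@cvg_nnsfun_approx _ T' R [set: T'] measurableT _ mEF F0' t I).
have simple n : \int[P]_(t in C) (h n t)%:E = \int[P]_t (h n t * rho t)%:E.
  have mlev' y : measurable (h n @^-1` [set y] : set T') by exact: measurable_funPTI.
  have mlev y : measurable (h n @^-1` [set y] : set T) by exact: sub.
  have hE t : h n t = (\sum_(y \in range (h n)) y * \1_(h n @^-1` [set y]) t)%R.
    exact: fimfunE.
  have fr : finite_set (range (h n)) by exact: fimfunP.
  have y0 y t : (0 <= y * \1_(h n @^-1` [set y]) t :> R)%R.
    rewrite indicE; case: (boolP (t \in _)) => [/set_mem /= <-|_].
      by rewrite mulr1.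
    by rewrite mulr0.
  have mlr y : measurable_fun [set: T] (fun t : T => (y * \1_(h n @^-1` [set y]) t)%:E).
    apply/measurable_EFinP; apply: measurable_funM => //; exact: measurable_indic.
  transitivity (\sum_(y \in range (h n))
      \int[P]_(t in C) (y * \1_(h n @^-1` [set y]) t)%:E).
    rewrite -ge0_integral_fsum //; last 2 first.
      by move=> y; apply: measurable_funTS; exact: mlr.
      by move=> y t _; rewrite lee_fin.
    by apply: eq_integral => t _; rewrite fsumEFin // hE.
  transitivity (\sum_(y \in range (h n))
      \int[P]_t (y * \1_(h n @^-1` [set y]) t * rho t)%:E); last first.
    rewrite -ge0_integral_fsum //; last 2 first.
      move=> y; apply/measurable_EFinP; apply: measurable_funM => //.
      by apply/measurable_EFinP; exact: mlr.
      by move=> y t _; rewrite lee_fin mulr_ge0.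
    by apply: eq_integral => t _; rewrite fsumEFin // hE -mulr_fsuml.
  apply: eq_fsbigr => y /set_mem [t0 _ yE].
  have yp : (0 <= y)%R by rewrite -yE.
  under eq_integral => t _ do rewrite EFinM.
  under [RHS]eq_integral => t _ do rewrite -mulrA EFinM.
  rewrite !ge0_integralZl_EFin //; last 3 first.
  - by move=> t _; rewrite lee_fin mulr_ge0.
  - apply/measurable_EFinP; apply: measurable_funM => //; exact: measurable_indic.
  - by apply/measurable_EFinP; apply: measurable_funTS; exact: measurable_indic.
  congr (_ * _); rewrite integral_indic // hA; last exact: mlev'.
  rewrite integral_mkcond; apply: eq_integral => t _.
  rewrite patchE indicE; case: ifP => _; first by rewrite mul1r.
  by rewrite mul0r.
have limE t : limn (fun n => (h n t)%:E) = (F t)%:E by apply: cvg_lim => //; exact: hcv.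
have limE2 t : limn (fun n => (h n t * rho t)%:E) = (F t * rho t)%:E.
  apply: cvg_lim => //; under eq_fun => n do rewrite EFinM.
  by rewrite EFinM; apply: cvgeZr => //; exact: hcv.
transitivity (limn (fun n => \int[P]_(t in C) (h n t)%:E)).
  rewrite -monotone_convergence //.
  - by apply: eq_integral => t _; rewrite limE.
  - by move=> n; apply/measurable_EFinP; apply: measurable_funTS.
  - by move=> n t _; rewrite lee_fin.
  - by move=> t _ n m nm; rewrite lee_fin; exact: hnd.
transitivity (limn (fun n => \int[P]_t (h n t * rho t)%:E)).
  by congr (limn _); apply/funext => n; exact: simple.
rewrite -monotone_convergence //.
- by apply: eq_integral => t _; rewrite limE2.
- by move=> n; apply/measurable_EFinP; apply: measurable_funM.
- by move=> n t _; rewrite lee_fin mulr_ge0.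
- by move=> t _ n m nm; rewrite lee_fin ler_wpM2r //; exact: hnd.
Qed.
End IntegrationFacts.

Section WalkEnvironment.
Variables (V : choiceType) (G : graph V) (R : realType) (v0 : V) (a : R).
Variables (d : measure_display) (T : measurableType d) (P : probability T R).
Variables (X : nat -> T -> V) (W : T -> V -> V -> R).
Hypotheses (fin : forall v, finite_set [set w | adj G v w]) (a_gt0 : 0 < a).
Hypothesis has_nbr : forall v, exists u, adj G v u.
Hypothesis env : is_random_environment G P v0 a X W.
Local Open Scope ereal_scope.

Let lw := path_weight (lrrw_step G a).
Let cw t := path_weight (chain_kernel G (W t)).

Lemma env_lrrw : is_lrrw G P v0 a X. Proof. by case: env. Qed.

Lemma env_ge0 t v u : adj G v u -> (0 <= W t v u)%R.
Proof. by case: env => _ h _ _ /h[_ + _]; apply. Qed.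

Lemma env_sym t v u : adj G v u -> W t v u = W t u v.
Proof. by case: env => _ h _ _ /h[_ _]; apply. Qed.

Lemma measurable_env v u : adj G v u -> measurable_fun setT (fun t => W t v u).
Proof. by case: env => _ h _ _ /h[]. Qed.

Lemma measurable_position k v : measurable (X k @^-1` [set v]).
Proof. by case: env_lrrw. Qed.

Lemma cylinderS x n : cylinder X x n.+1 =
  cylinder X x n `&` X n.+1 @^-1` [set x n.+1].
Proof.
apply/seteqP; split => t /=.
  by move=> h; split; [move=> i im; apply: h; apply: leq_trans im _ | apply: h].
move=> [h1 h2] i; rewrite leq_eqVlt => /orP[/eqP ->//|im].
exact: h1.
Qed.

Lemma measurable_cylinder x n : measurable (cylinder X x n).
Proof.
elim: n => [|n IH]; last by rewrite cylinderS; apply: measurableI => //; exact: measurable_position.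
rewrite (_ : cylinder X x 0 = X 0%N @^-1` [set x 0%N]); first exact: measurable_position.
apply/seteqP; split => t /= h; first exact: h.
by move=> i; rewrite leqn0 => /eqP ->.
Qed.

Lemma prob_cylinder x n : x 0%N = v0 -> P (cylinder X x n) = (lw x n)%:E.
Proof.
move=> x0; elim: n => [|n IH]; last first.
  case: env_lrrw => _ _ ->; rewrite IH /lw path_weightS EFinM //.
rewrite /lw /path_weight big_ord0.
have [_ [N [mN N0 sub]] _] := env_lrrw.
apply/eqP; rewrite eq_le probability_le1 /=; last exact: measurable_cylinder.
rewrite -(@probability_setT _ _ _ P).
apply: (@le_trans _ _ (P (cylinder X x 0 `|` N))).
  apply: le_measure; rewrite ?inE //.
    by apply: measurableU => //; exact: measurable_cylinder.
  move=> t _; apply: contrapT => /not_orP[h1 h2]; apply: h2; apply: sub => h3.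
  by apply: h1 => i; rewrite leqn0 => /eqP ->; rewrite x0.
rewrite measureU0 //; exact: measurable_cylinder.
Qed.

Lemma cw_chain_prob t x n : is_walk G v0 x n -> chain_prob G v0 (W t) x n = cw t x n.
Proof. exact: chain_probE. Qed.

Lemma cw_ge0 t x n : (0 <= cw t x n)%R.
Proof.
apply: path_weight_ge0 => i u _; apply: chain_step_ge0 => //.
exact: env_ge0.
Qed.

Lemma prob_env_cylinder A x n : is_walk G v0 x n -> env_sigma G W A ->
  P (A `&` cylinder X x n) = \int[P]_(t in A) (cw t x n)%:E.
Proof.
move=> wx hA; case: env => _ _ _ /(_ A x n hA) ->.
by apply: eq_integral => t _; rewrite cw_chain_prob.
Qed.

Lemma env_sigmaT : env_sigma G W setT.
Proof.
have [h _ _] := smallest_sigma_algebra setT [set A | exists x y (B : set R),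
  [/\ adj G x y, measurable B & A = (fun t => W t x y) @^-1` B]].
by rewrite -(setD0 setT); case: (smallest_sigma_algebra setT [set A | exists x y (B : set R),
  [/\ adj G x y, measurable B & A = (fun t => W t x y) @^-1` B]]) => _ + _; apply.
Qed.

Lemma lw_mix x n : is_walk G v0 x n -> (lw x n)%:E = \int[P]_t (cw t x n)%:E.
Proof.
move=> wx; rewrite -prob_cylinder; last exact: wx.1.
by rewrite -prob_env_cylinder ?setTI //; exact: env_sigmaT.
Qed.

Lemma measurable_vertex_weight v : measurable_fun setT (fun t => vertex_weight G (W t) v).
Proof.
rewrite /vertex_weight.
rewrite (_ : (fun t => _) = (fun t => \sum_(u <- nbrs G v) (if adj G v u then W t v u else 0))%R).
  apply: (@measurable_sum _ _ _ _ _ (nbrs G v)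
    (fun u t => if adj G v u then W t v u else 0%R)) => u.
  by case A : (adj G v u); [exact: measurable_env | exact: measurable_cst].
apply/funext => t; rewrite big_seq [RHS]big_seq; apply: eq_bigr => u.
by rewrite mem_nbrs // => ->.
Qed.

Lemma measurable_cw x n : is_walk G v0 x n -> measurable_fun setT (fun t => cw t x n).
Proof.
move=> wx; apply: (@measurable_prod _ _ _ _ _ (index_enum 'I_n)
  (fun (i : 'I_n) t => chain_kernel G (W t) x i (x i.+1))) => i _.
rewrite /chain_kernel /chain_step wx.2 //.
apply: measurable_funM; first by apply: measurable_env; apply: wx.2.
apply: measurable_inv; last exact: measurable_vertex_weight.
by move=> t; apply: vertex_weight_ge0 => // v u; exact: env_ge0.
Qed.

Lemma kernel_sum_mix N (F : (nat -> V) -> nat -> R) :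
  (forall x k, (0 <= F x k)%R) ->
  (kernel_sum G v0 (lrrw_step G a) N F)%:E =
    \int[P]_t (kernel_sum G v0 (chain_kernel G (W t)) N F)%:E /\
  measurable_fun setT (fun t => kernel_sum G v0 (chain_kernel G (W t)) N F).
Proof.
move=> F0; rewrite /kernel_sum.
pose s := walks G v0 N.
pose b (l : seq V) := is_walk G v0 (nth v0 l) N.
have hb l : l \in s -> b l by move=> /(walksP _ fin)[].
pose f (l : seq V) t := (if `[< b l >] then cw t (nth v0 l) N * F (nth v0 l) N else 0)%R.
have fE t : (\sum_(l <- s) cw t (nth v0 l) N * F (nth v0 l) N = \sum_(l <- s) f l t)%R.
  by rewrite big_seq [RHS]big_seq; apply: eq_bigr => l /hb h; rewrite /f asboolT.
have mf l : measurable_fun setT (f l).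
  rewrite /f; case: asboolP => // h; apply: measurable_funM => //; exact: measurable_cw.
have f0 l t : (0 <= f l t)%R.
  by rewrite /f; case: ifP => // _; rewrite mulr_ge0 // cw_ge0.
split; last first.
  rewrite (_ : (fun t => _) = (fun t => \sum_(l <- s) f l t)%R); last by apply/funext.
  exact: (@measurable_sum _ _ _ _ _ s f).
under eq_integral => t _ do rewrite fE -sumEFin.
rewrite ge0_integral_sum //; last 2 first.
  by move=> l; apply/measurable_EFinP.
  by move=> l t _; rewrite lee_fin.
rewrite -sumEFin big_seq [RHS]big_seq; apply: eq_bigr => l /hb h.
rewrite /f; under eq_integral => t _ do rewrite asboolT // mulrC EFinM.
rewrite ge0_integralZl_EFin //.
- by rewrite EFinM muleC; congr (_ * _); exact: lw_mix.
- by move=> t _; rewrite lee_fin cw_ge0.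
- by apply/measurable_EFinP; exact: measurable_cw.
Qed.

Lemma kernel_sum_ge0 N (F : (nat -> V) -> nat -> R) t : (forall x k, (0 <= F x k)%R) ->
  (0 <= kernel_sum G v0 (chain_kernel G (W t)) N F)%R.
Proof. by move=> F0; apply: sumr_ge0 => l _; rewrite mulr_ge0 // cw_ge0. Qed.

(** The hinge between the two laws: a bound proved in almost every environment becomes, after
    integration, a bound whose remaining sum is taken under the reinforced walk, where its urns
    apply. *)
Lemma integral_le_kernel_sum N (F : T -> R) (H : (nat -> V) -> nat -> R) (A c : R) :
  (0 <= A)%R -> (0 <= c)%R -> (forall t, (0 <= F t)%R) -> (forall x k, (0 <= H x k)%R) ->
  {ae P, forall t, (F t <= A + c * kernel_sum G v0 (chain_kernel G (W t)) N H)%R} ->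
  \int[P]_t (F t)%:E <= (A + c * kernel_sum G v0 (lrrw_step G a) N H)%:E.
Proof.
move=> A0 c0 F0 H0 h.
have [HE mH] := kernel_sum_mix N H0.
have K0 t := kernel_sum_ge0 N t H0.
rewrite EFinD EFinM HE.
apply: (@le_trans _ _ (\int[P]_t (A%:E +
   c%:E * (kernel_sum G v0 (chain_kernel G (W t)) N H)%:E))).
  apply: ae_ge0_le_integralT => //.
  - by move=> t; rewrite -EFinM -EFinD lee_fin addr_ge0 // mulr_ge0 // K0.
  - apply/measurable_EFinP; apply: measurable_funD => //.
    exact: measurable_funM.
rewrite ge0_integralD //.
- rewrite integral_cst // [X in _ * X + _](_ : _ = 1); last exact: probability_setT.
  rewrite mule1 ge0_integralZl_EFin //.
    by move=> t _; rewrite lee_fin K0.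
  by apply/measurable_EFinP.
- by move=> t _; rewrite -EFinM lee_fin mulr_ge0 // K0.
- by apply/measurable_EFinP; apply: measurable_funM.
Qed.

Lemma kernel_sum_mix_le N (F H : (nat -> V) -> nat -> R) (A c : R) :
  (0 <= A)%R -> (0 <= c)%R ->
  (forall x k, (0 <= F x k)%R) -> (forall x k, (0 <= H x k)%R) ->
  {ae P, forall t, (kernel_sum G v0 (chain_kernel G (W t)) N F <=
     A + c * kernel_sum G v0 (chain_kernel G (W t)) N H)%R} ->
  (kernel_sum G v0 (lrrw_step G a) N F <= A + c * kernel_sum G v0 (lrrw_step G a) N H)%R.
Proof.
move=> A0 c0 F0 H0 h; rewrite -lee_fin (kernel_sum_mix N F0).1.
by apply: integral_le_kernel_sum => // t; exact: kernel_sum_ge0.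
Qed.

Definition trajectory t : nat -> V := fun i => X i t.

(** [V] is an arbitrary type, so an event of the trajectory is replaced by a finite union of
    cylinders, for which both measurability and probability are at hand. *)
Definition path_event N (c : (nat -> V) -> bool) : set T :=
  \big[setU/set0]_(l <- walks G v0 N | c (nth v0 l)) cylinder X (nth v0 l) N.

Lemma measurable_path_event N c : measurable (path_event N c).
Proof. by apply: bigsetU_measurable => l _; exact: measurable_cylinder. Qed.

Lemma prob_path_event N c :
  P (path_event N c) <=
    (kernel_sum G v0 (lrrw_step G a) N (fun x _ => (c x)%:R))%:E.
Proof.
apply: (@le_trans _ _ (\sum_(l <- walks G v0 N | c (nth v0 l)) P (cylinder X (nth v0 l) N))).
  rewrite /path_event; elim: (walks G v0 N) => [|l s IH].
    by rewrite !big_nil measure0.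
  rewrite !big_cons; case: ifP => // _.
  apply: le_trans (leeD2l _ IH); apply: measureU2.
    exact: measurable_cylinder.
  by apply: bigsetU_measurable => l' _; exact: measurable_cylinder.
rewrite /kernel_sum -sumEFin big_mkcond big_seq [leRHS]big_seq.
apply: lee_sum => l /(walksP _ fin)[_ wl].
case: (c _); first by rewrite mulr1 prob_cylinder //; exact: wl.1.
by rewrite mulr0.
Qed.

Lemma path_eventP N (c : (nat -> V) -> bool) t : (forall x y, agree N x y -> c x = c y) ->
  is_walk G v0 (trajectory t) N -> c (trajectory t) -> path_event N c t.
Proof.
move=> lc wt ct; rewrite /path_event -bigcup_seq_cond.
pose l := mkseq (trajectory t) N.+1.
have ag : agree N (nth v0 l) (trajectory t).
  by move=> i iN; rewrite nth_mkseq // ltnS.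
exists l => /=.
  apply/andP; split; last by rewrite (lc _ _ ag).
  apply/(walksP _ fin); split; first by rewrite size_mkseq.
  split; first by rewrite ag //; exact: wt.1.
  by move=> i iN; rewrite !ag //; [exact: wt.2 | exact: ltnW].
by move=> i iN; rewrite ag.
Qed.

Lemma prob_avoid (A : set T) n (s : seq V) : measurable A -> uniq s ->
  P (A `&` [set t | forall u, u \in s -> X n t <> u]) +
    \sum_(u <- s) P (A `&` X n @^-1` [set u]) = P A.
Proof.
move=> mA.
have mB (s' : seq V) : measurable (A `&` [set t | forall u, u \in s' -> X n t <> u]).
  elim: s' => [|u s' IH].
    by rewrite (_ : [set t | _] = setT) ?setIT //; apply/seteqP; split.
  rewrite (_ : _ `&` _ = (A `&` [set t | forall u, u \in s' -> X n t <> u])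
      `\` X n @^-1` [set u]); first by apply: measurableD => //; exact: measurable_position.
  apply/seteqP; split => t /=.
    move=> [At h]; split; last by apply: h; rewrite mem_head.
    by split=> // v vs; apply: h; rewrite inE vs orbT.
  move=> [[At h] h2]; split=> // v; rewrite inE => /orP[/eqP ->//|]; exact: h.
elim: s => [|u s IH] /=.
  move=> _; rewrite big_nil adde0; congr (P _); apply/seteqP; split => t /=; first by case.
  by move=> At; split.
move=> /andP[us /IH <-]; rewrite big_cons.
rewrite (measureDI P (mB s) (measurable_position n u)) addeA.
congr (_ + _ + _); congr (P _); apply/seteqP; split => t /=.
- move=> [At h]; split; last by apply: h; rewrite mem_head.
  by split=> // v vs; apply: h; rewrite inE vs orbT.
- by move=> [[At h] h2]; split=> // v; rewrite inE => /orP[/eqP ->//|]; exact: h.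
- move=> [At e]; split=> //; split=> // v vs; rewrite e => uv.
  by rewrite -uv (negbTE us) in vs.
- by case=> -[].
Qed.

(** The law prescribes cylinders only. On each of the finitely many cylinders of length [N] the
    steps to neighbours have total mass 1, so the event of stepping elsewhere is null. *)
Lemma is_walk_ae : {ae P, forall t, forall N, is_walk G v0 (trajectory t) N}.
Proof.
apply: ae_foralln => N; elim: N => [|N IH].
  case: env_lrrw => _ h _; apply: filterS h => t xt; split=> //.
pose bad l := cylinder X (nth v0 l) N `&`
  [set t | forall u, u \in nbrs G (nth v0 l N) -> X N.+1 t <> u].
have bad0 l : l \in walks G v0 N -> P.-negligible (bad l).
  move=> /(walksP _ fin)[_ wl].
  have mc := measurable_cylinder (nth v0 l) N.
  have e := @prob_avoid _ N.+1 (nbrs G (nth v0 l N)) mc (fset_uniq _).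
  have z : \sum_(u <- nbrs G (nth v0 l N))
      P (cylinder X (nth v0 l) N `&` X N.+1 @^-1` [set u]) = P (cylinder X (nth v0 l) N).
    have [u0 /(lrrw_mass_gt0 fin a_gt0) Z0] := has_nbr (nth v0 l N).
    rewrite prob_cylinder; last exact: wl.1.
    rewrite -[in RHS](mulr1 (lw _ _)) -(sum_lrrw_step fin (lt0r_neq0 Z0)) mulr_sumr.
    rewrite -sumEFin; apply: eq_bigr => u _.
    pose x := upd (nth v0 l) N u.
    have xl : agree N x (nth v0 l) by apply: agree_upd.
    have cE : cylinder X x N = cylinder X (nth v0 l) N.
      by apply/seteqP; split => t h i iN; [rewrite -xl // h | rewrite xl // h].
    have xu : x N.+1 = u by apply: upd_new.
    have := cylinderS x N; rewrite cE xu => <-.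
    rewrite prob_cylinder; last by rewrite xl //; exact: wl.1.
    rewrite /lw path_weightS (path_weight_local (lrrw_step_local _ _) xl) xu.
    by rewrite (lrrw_step_local _ _ xl).
  have mb : measurable (bad l).
    apply: measurableI => //.
    rewrite (_ : [set t | _] = \bigcap_(u in [set` nbrs G (nth v0 l N)])
      ~` (X N.+1 @^-1` [set u])); last first.
      by apply/seteqP; split => t h u /= un; apply: h.
    apply: fin_bigcap_measurable; first exact: finite_fset.
    by move=> u _; apply: measurableC; exact: measurable_position.
  exists (bad l); split=> //; move: e; rewrite z -/(bad l).
  rewrite -(fineK (fin_num_measure P _ mb)) -(fineK (fin_num_measure P _ mc)).
  by rewrite -EFinD => -[] e; congr (_%:E); lra.
have allbad : P.-negligible (\big[setU/set0]_(l <- walks G v0 N) bad l).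
  rewrite big_seq; elim/big_ind: _ => //; first exact: negligible_set0.
  exact: negligibleU.
have [N1 [mN1 N10 sub1]] := allbad.
have h2 : {ae P, forall t, ~ (\big[setU/set0]_(l <- walks G v0 N) bad l) t}.
  by exists N1; split=> // t /= /contrapT; apply: sub1.
apply: filterS2 IH h2 => t wt nb; split; first exact: wt.1.
move=> i; rewrite ltnS leq_eqVlt => /orP[/eqP ->|]; last exact: wt.2.
apply: contrapT => na; apply: nb; rewrite -bigcup_seq.
pose l := mkseq (trajectory t) N.+1.
have ag i' : (i' <= N)%N -> nth v0 l i' = trajectory t i'.
  by move=> i'N; rewrite nth_mkseq // ltnS.
exists l => /=.
  apply/(walksP _ fin); split; first by rewrite size_mkseq.
  split; first by rewrite ag //; exact: wt.1.
  by move=> j jN; rewrite !ag //; [exact: wt.2 | exact: ltnW].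
split; first by move=> j jN; rewrite ag.
move=> u; rewrite mem_nbrs // ag // => au e; apply: na.
by rewrite -[trajectory t N.+1]/(X N.+1 t) e.
Qed.
End WalkEnvironment.

(** * Recurrence *)

Section LateCrossings.
Variables (V : choiceType) (G : graph V) (R : realType) (v0 : V) (a : R).
Hypotheses (fin : forall v, finite_set [set w | adj G v w]) (a_gt0 : 0 < a).
Variable K : nat.
Hypotheses (degK : forall v, (degree G v <= K)%N) (Ka : K%:R * a <= 1) (a1 : a <= 1).
Variables (v w : V) (J0 : nat).
Hypothesis vw : adj G v w.
Implicit Types (x : nat -> V) (k : nat).

Fixpoint late_crossing x k : bool :=
  if k is j.+1 then
    late_crossing x j || [&& x j == v, x j.+1 == w & (J0 <= departures x j v)%N]
  else false.

Lemma late_crossing_local : local late_crossing.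
Proof.
elim=> [//|k IH] x y xy /=; rewrite !xy // (IH x y); last exact: agreeW xy.
by rewrite (departures_local v (agreeW (leqnSn k) xy)).
Qed.

Definition late_value x k : R :=
  (~~ late_crossing x k)%:R * (maxn (departures x k v) J0).+1%:R `^ (a / 2).

(* After n visits a step to [w] has probability at least [a / (2 n)], which
   absorbs the growth of [n `^ (a / 2)]. *)
Lemma late_value_step x k : is_walk G v0 x k ->
  \sum_(u <- nbrs G (x k)) lrrw_step G a x k u * late_value (upd x k u) k.+1
    <= late_value x k.
Proof.
move=> wx.
have a0 := a_gt0; have a1' := a1.
have lE u : late_value (upd x k u) k.+1 =
  (~~ (late_crossing x k ||
      [&& x k == v, u == w & (J0 <= departures x k v)%N]))%:R *
  (maxn (departures x k v + (x k == v)) J0).+1%:R `^ (a / 2).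
  rewrite /late_value /= departuresS (departures_local v (@agree_upd _ x k u)).
  by rewrite (late_crossing_local (@agree_upd _ x k u)) upd_new upd_le.
under eq_bigr => u _ do rewrite lE.
have p1 := sum_lrrw_step_le1 a fin x k.
have p0 u := lrrw_step_ge0 G a_gt0 x k u.
rewrite /late_value; case L : (late_crossing x k).
  by rewrite /= mul0r big1 // => u _; rewrite ?mul0r ?mulr0.
rewrite /= mul1r.
have h0 n : 0 <= n%:R `^ (a / 2) :> R by apply: powR_ge0.
case: (eqVneq (x k) v) => [xv|xv] /=; last first.
  under eq_bigr => u _ do rewrite addn0 mul1r.
  by rewrite -mulr_suml ler_piMl.
case: (boolP (J0 <= departures x k v)%N) => Jd; last first.
  rewrite -ltnNge in Jd.
  under eq_bigr => u _ do rewrite andbF mul1r.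
  rewrite -mulr_suml addn1 (maxn_idPr Jd) (maxn_idPr (ltnW Jd)).
  by rewrite ler_piMl.
rewrite addn1 (maxn_idPl Jd) (maxn_idPl (leq_trans Jd (leqnSn _))).
move: Jd; set n := departures x k v => Jd.
under eq_bigr => u _ do rewrite andbT mulrA.
rewrite -mulr_suml.
have axw : adj G (x k) w by rewrite xv.
have q : a / (2 * n.+1%:R) <= lrrw_step G a x k w.
  rewrite lrrw_stepE //; have Z := lrrw_mass_gt0 fin a_gt0 axw.
  apply: (@le_trans _ _ (a / lrrw_mass G a x k)).
    rewrite ler_pM2l // lef_pV2 ?posrE // ?mulr_gt0 // -natrM.
    by have := lrrw_mass_le fin a_gt0 degK Ka wx; rewrite xv.
  by rewrite ler_pM2r ?invr_gt0 // lerDl.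
have s : \sum_(u <- nbrs G (x k)) lrrw_step G a x k u * (~~ (u == w))%:R <=
    1 - a / (2 * n.+1%:R).
  rewrite (bigD1_seq w) ?mem_nbrs ?fset_uniq //= eqxx mulr0 add0r.
  move: p1; rewrite (bigD1_seq w) ?mem_nbrs ?fset_uniq //=.
  have -> : \sum_(u <- nbrs G (x k) | u != w) lrrw_step G a x k u * (u != w)%:R =
     \sum_(u <- nbrs G (x k) | u != w) lrrw_step G a x k u.
    by apply: eq_bigr => u ->; rewrite mulr1.
  move: (\sum_(u <- nbrs G (x k) | u != w) lrrw_step G a x k u) => S.
  by move: (a / _) (lrrw_step _ _ _ _ _) q => y z; lra.
apply: le_trans (ler_wpM2r (h0 _) s) _.
have g : n.+2%:R `^ (a / 2) <= n.+1%:R `^ (a / 2) * (1 + (a / 2) / n.+1%:R) :> R.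
  rewrite -[X in X%:R `^ _]addn1 natrD; apply: powR_succ; rewrite ?ler1n //; lra.
have yE : a / (2 * n.+1%:R) = a / 2 / n.+1%:R :> R by rewrite invfM mulrA.
rewrite yE; set y := a / 2 / n.+1%:R in g *.
have n1 : 1 <= n.+1%:R :> R by rewrite ler1n.
have y0 : 0 <= y by rewrite /y !divr_ge0 // ltW.
have y1 : y <= 1.
  rewrite /y ler_pdivrMr ?ltr0n // mul1r; apply: le_trans _ n1; lra.
apply: le_trans (ler_wpM2l _ g) _; first by lra.
rewrite mulrCA ler_piMr //; nra.
Qed.

(** Markov's inequality for the supermartingale [late_value], which grows with the departures from
    [v] as long as the step is avoided. The bound tends to 0 with growing [J]. *)
Lemma late_crossing_prob N J : (J0 <= J)%N ->
  kernel_sum G v0 (lrrw_step G a) N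
    (fun x k => (~~ late_crossing x k && (J <= departures x k v)%N)%:R)
  <= J0.+1%:R `^ (a / 2) / J.+1%:R `^ (a / 2).
Proof.
move=> JJ; have hJ : 0 < J.+1%:R `^ (a / 2) by apply: powR_gt0.
rewrite ler_pdivlMr // mulrC /kernel_sum mulr_sumr.
have lL : local late_value.
  move=> k x y xy; rewrite /late_value (late_crossing_local xy).
  by rewrite (departures_local v xy).
have := kernel_sum_super fin N (@lrrw_step_local _ G _ a) lL
  (fun x k u _ => lrrw_step_ge0 G a_gt0 x k u) late_value_step.
rewrite {2}/late_value departures0 max0n mul1r; apply: le_trans.
apply: ler_sum => l _; rewrite mulrCA; apply: ler_wpM2l.
  by apply: path_weight_ge0 => i u _; exact: lrrw_step_ge0.
rewrite /late_value; case: (late_crossing _ _) => /=; first by rewrite mulr0 mul0r.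
case: leqP => Jd; last by rewrite mulr0 mul1r powR_ge0.
rewrite mulr1 mul1r ge0_ler_powR ?nnegrE //; first by rewrite divr_ge0 // ltW.
by rewrite ler_nat ltnS leq_max Jd.
Qed.

End LateCrossings.

Section VisitedNeighbours.
Variables (V : choiceType) (G : graph V) (R : realType) (v0 : V) (a : R).
Variables (d : measure_display) (T : measurableType d) (P : probability T R).
Variables (X : nat -> T -> V) (W : T -> V -> V -> R).
Hypotheses (fin : forall v, finite_set [set w | adj G v w]) (a_gt0 : 0 < a).
Hypothesis has_nbr : forall v, exists u, adj G v u.
Hypothesis env : is_random_environment G P v0 a X W.
Variable K : nat.
Hypotheses (degK : forall v, (degree G v <= K)%N) (Ka : K%:R * a <= 1) (a1 : a <= 1).

Implicit Types (x : nat -> V).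

Lemma late_crossing_ae v w J0 : adj G v w ->
  {ae P, forall t, (forall J, exists N, (J <= departures (trajectory X t) N v)%N) ->
     exists N, late_crossing v w J0 (trajectory X t) N}.
Proof.
move=> vw.
pose A := [set t | [/\ forall N, is_walk G v0 (trajectory X t) N,
  forall J, exists N, (J <= departures (trajectory X t) N v)%N
  & forall N, ~~ late_crossing v w J0 (trajectory X t) N]].
have hA : P.-negligible A.
  apply: negligible_liminf => e e0.
  set c := J0.+1%:R `^ (a / 2) : R.
  have c0 : 0 < c by apply: powR_gt0.
  have [J [JJ JE]] : exists J, (J0 <= J)%N /\ c / J.+1%:R `^ (a / 2) <= e.
    set z := (c / e) `^ (2 / a).
    exists (maxn J0 (Num.Def.truncn z)); split; first exact: leq_maxl.
    have zJ : z <= (maxn J0 (Num.Def.truncn z)).+1%:R.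
      apply: le_trans (ltW (truncnS_gt z)) _.
      by rewrite ler_nat ltnS leq_maxr.
    rewrite ler_pdivrMr ?powR_gt0 // mulrC -ler_pdivrMr //.
    have cz : c / e = z `^ (a / 2).
      rewrite /z -powRrM [_ / _ * _](_ : _ = 1) ?powRr1 //.
        by rewrite divr_ge0 // ltW.
      by field; rewrite gt_eqF.
    rewrite cz ge0_ler_powR ?nnegrE ?powR_ge0 // divr_ge0 // ltW //.
  exists (fun N => path_event G v0 X N (fun x =>
    ~~ late_crossing v w J0 x N && (J <= departures x N v)%N)); split.
  - move=> N; exact: (measurable_path_event env).
  - move=> N; apply: le_trans (prob_path_event fin env _ _) _.
    rewrite lee_fin; apply: le_trans JE.
    exact: (@late_crossing_prob V G R v0 a fin a_gt0 K degK Ka a1 v w J0 vw N J JJ).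
  move=> t [wt dep nl]; have [M hM] := dep J; exists M => N MN.
  apply: (path_eventP fin) => //.
    move=> x y xy; rewrite (late_crossing_local v w J0 xy).
    by rewrite (departures_local v xy).
  by rewrite nl /= (leq_trans hM) // leq_departures.
have hA' : {ae P, forall t, ~ A t}.
  by move: hA => [N [mN N0 sub]]; exists N; split=> // t /= /contrapT; apply: sub.
apply: filterS2 (is_walk_ae fin a_gt0 has_nbr env) hA' => t wt nA dep.
apply: contrapT => ne; apply: nA; split=> // N.
by apply/negP => h; apply: ne; exists N.
Qed.

Definition visited_io (x : nat -> V) v := forall M, exists2 k, (M <= k)%N & x k = v.

Lemma departures_unbounded x v : visited_io x v ->
  forall J, exists N, (J <= departures x N v)%N.
Proof.
move=> io; elim=> [|J [N hN]]; first by exists 0%N.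
have [k Nk xk] := io N; exists k.+1; rewrite departuresS xk eqxx addn1 ltnS.
exact: leq_trans hN (leq_departures _ _ Nk).
Qed.

Lemma departures_le x N v : (departures x N v <= N)%N.
Proof.
rewrite -[leqRHS]muln1 -[X in (_ <= X * _)%N]card_ord -sum_nat_const.
by apply: leq_sum => j _; case: (_ == _).
Qed.

Lemma late_crossingP v w J0 x N : late_crossing v w J0 x N ->
  exists2 k, (J0 <= k)%N & x k = v /\ x k.+1 = w.
Proof.
elim: N => [//|N IH] /= /orP[/IH //|/and3P[/eqP xN /eqP xN1 JN]].
by exists N => //; apply: leq_trans JN (departures_le _ _ _).
Qed.

(** Infinitely many visits to one vertex produce infinitely many steps to each neighbour, and
    connectedness spreads this over the whole graph. *)
Lemma visited_io_ae : connected_graph G ->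
  {ae P, forall t, (exists v, visited_io (trajectory X t) v) ->
    (forall v w, adj G v w -> exists k, trajectory X t k = v /\ trajectory X t k.+1 = w)}.
Proof.
move=> conn.
pose good t v w := forall J0, visited_io (trajectory X t) v ->
  exists2 k, (J0 <= k)%N & trajectory X t k = v /\ trajectory X t k.+1 = w.
have good_ae v w : adj G v w -> {ae P, forall t, good t v w}.
  move=> vw; apply: ae_foralln => J0.
  apply: filterS (late_crossing_ae J0 vw) => t h io.
  by have [N] := h (departures_unbounded io); exact: late_crossingP.
(* Pairs of neighbours are indexed by natural numbers, as entries of the finite lists of walks and
   neighbours, so that countably many null sets suffice. *)
have all_ae : {ae P, forall t, forall n i j, let v := last v0 (nth [::] (walks G v0 n) i) in
    forall w, nth v0 (nbrs G v) j = w -> adj G v w -> good t v w}.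
  apply: ae_foralln => n; apply: ae_foralln => i; apply: ae_foralln => j /=.
  set v := last _ _; set w := nth v0 (nbrs G v) j.
  have [vw|nvw] := boolP (adj G v w).
    by apply: filterS (good_ae v w vw) => t h w' <-.
  by apply: (aeW P) => t w' <- h; rewrite h in nvw.
apply: filterS2 (is_walk_ae fin a_gt0 has_nbr env) all_ae => t wt h.
have reach v : exists n i, v = last v0 (nth [::] (walks G v0 n) i).
  have [p [pp lp]] := conn v0 v; exists (size p).
  have pin : v0 :: p \in walks G v0 (size p).
    apply/(walksP _ fin); split=> //; split=> // i isz.
    by have /(pathP v0) := pp; apply.
  by exists (index (v0 :: p) (walks G v0 (size p))); rewrite nth_index.
have goodt v w : adj G v w -> good t v w.
  move=> vw; have [n [i vE]] := reach v.
  rewrite [X in good t X w]vE.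
  apply: (h n i (index w (nbrs G v)) w); rewrite -vE //.
  by rewrite nth_index // mem_nbrs.
move=> [v io].
have step u w : adj G u w -> visited_io (trajectory X t) u -> visited_io (trajectory X t) w.
  move=> uw iou M; have [k Mk [_ xk]]   := goodt u w uw M iou.
  by exists k.+1 => //; apply: leq_trans Mk (leqnSn _).
have all_io u : visited_io (trajectory X t) u.
  have [p [pp <-]] := conn v u; elim: p v io pp => [//|z p IH] v io /= /andP[vz pz].
  by apply: IH => //; exact: step io.
move=> u w uw; have [k _ hk]   := goodt u w uw 0%N (all_io u).
by exists k.
Qed.

End VisitedNeighbours.

(** * Leaving a ball with few departures from the root *)

Section Exit.
Variables (V : choiceType) (G : graph V) (R : realType) (v0 : V) (a : R).
Hypotheses (fin : forall v, finite_set [set w | adj G v w]) (a_gt0 : 0 < a).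
Implicit Types (x : nat -> V) (B : pred V).

Definition ball n : pred V :=
  fun v => has (fun j => v \in [seq last v0 l | l <- walks G v0 j]) (iota 0 n).

Definition exits B kappa N x : bool :=
  (exit_time B x N < N)%N && (departures x (exit_time B x N) v0 <= kappa)%N.

Definition is_exited (s : urn_state) : bool :=
  match s with DownEnd _ | Up _ | UpEnd _ => true | _ => false end.

Definition guide_event g m B kappa N x : bool :=
  [&& path_ok g m x (exit_time B x N),
      [forall i : 'I_m, is_exited (guide_states g N B x i)],
      [forall i : 'I_m.+1, (0 < crossings x N (g i) (g i.+1))%N]
    & staged_exit v0 g m kappa N B x].

Lemma exits_guide n kappa N x : (0 < n)%N -> is_walk G v0 x N ->
  exits (ball n) kappa N x ->
  exists m gs, [/\ (n <= m.+1)%N, (m < N)%N, gs \in walks G v0 m.+1,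
    guide G v0 (nth v0 gs) m & guide_event (nth v0 gs) m (ball n) kappa N x].
Proof.
move=> n0 wx /andP[]; set tau := exit_time _ _ _ => tN dep.
have outB := exit_time_out tN; rewrite -/tau in outB.
have inB j : (j < tau)%N -> ball n (x j) by move=> jt; apply: (exit_time_in jt).
have first j : (j < tau)%N -> x j <> x tau.
  by move=> jt e; move: outB; rewrite -e inB.
case E : tau => [|k].
  move: outB; rewrite E wx.1 /ball; case: (n) n0 => // n' _ /=.
  by rewrite inE eqxx.
have [c1 c2] : crossings x k (x k) (x k.+1) = 0%N /\ crossings x k (x k.+1) (x k) = 0%N.
  split; apply/eqP; rewrite -leqn0 leqNgt; apply/negP => /crossings_gt0P[j jk [e1 e2]].
    by apply: (first j.+1); rewrite E ?ltnS.
  by apply: (first j); rewrite E // ltnS ltnW.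
have wxk : is_walk G v0 x k.+1 by apply: is_walkW wx; rewrite -E ltnW.
have [m [gs [kk hh]]] := guide_of_crossing fin wxk c1 c2.
case: hh => mk gsin gd [gm gm1 pok [kkm hkk kki]].
set g := nth v0 gs in gd gm gm1 pok hkk.
have kkt j : (j <= m)%N -> (kk j < tau)%N.
  move=> /subnKC; move: (m - j)%N => i; elim: i j => [|i IH] j.
    by rewrite addn0 => ->; rewrite E kkm.
  move=> e; have jm : (j < m)%N by rewrite -e addnS ltnS leq_addr.
  by apply: leq_ltn_trans (ltnW (kki j jm)) (IH _ _); rewrite addSn -addnS.
exists m, gs; split=> //.
- rewrite leqNgt; apply/negP => mn; move: outB; rewrite E -gm1 => /negP; apply.
  apply/hasP; exists m.+1; first by rewrite mem_iota.
  apply/mapP; exists gs => //.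
  by have [sg _] := (walksP _ fin _ _).1 gsin; rewrite -nth_last sg.
- by apply: leq_ltn_trans mk _; apply: leq_trans (ltnW tN); rewrite E.
have ne i : (i < m)%N -> g i != g i.+2 by case: gd => _ _ _; apply.
have cr i : (i <= m)%N -> (0 < crossings x tau (g i) (g i.+1))%N.
  by move=> im; have [e1 e2] := hkk i im; apply: crossings_gt0 (kkt i im) e1 e2.
apply/and4P; split.
- by rewrite -/tau.
- apply/forallP => i; have im := ltn_ord i; rewrite /guide_states -/tau.
  by have := urn_exited (ne i im) (cr i.+1 im); case: (urn _ _ _ _ _).
- apply/forallP => i; apply: leq_trans (cr i _) (leq_crossings _ _ _ (ltnW tN)).
  by rewrite -ltnS.
rewrite /staged_exit.
apply: (@stages_future V g _ x kk m N kappa 0 m 0 v0) => //.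
- exact: leq_trans (kkt m (leqnn m)) (ltnW tN).
- move=> j jm; rewrite /guide_states -/tau.
  have := urn_inv (g j.+1) x tau (ne j jm).
  case: (urn _ _ _ _ _) => [t|t|t|t|t] //= [<- _ _] _.
  by rewrite kkm -E.
- exact: wx.1.
by rewrite kkm -E.
Qed.

(** With [tB = 3 th], an open urn of flag weight [t^3] has [(t^3)^th = t^tB], exactly its reward
    under reinforcement, and 3/8 < 1/2 is admissible. *)
Let th : R := 8^-1.
Let tB : R := 3 / 8.
Let CL : R := lrrw_const th tB.

(** A common bound for the bases 7 and [CL] of the two halves of the AM-GM inequality. *)
Definition exit_const : R := 7 + CL.

Lemma exit_const_gt0 : 0 < exit_const.
Proof.
rewrite /exit_const; have : 0 < CL by apply: lrrw_const_gt0; rewrite /th /tB; lra.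
lra.
Qed.

(** Here a probability is wanted instead of a moment, and the product [Y] of flag weights may be
    arbitrarily small. If [Y > 1/M], its small power is at least [1/M] and the urns apply; otherwise
    [1/Y >= M], and the term to be bounded by reversibility takes over. *)
Lemma one_le_split (M Y : R) : 1 <= M -> 0 < Y -> 1 <= M * Y `^ (th / 2) + M^-1 * Y^-1.
Proof.
move=> M1 Y0; have M0 : 0 < M by lra.
have Mi0 : 0 < M^-1 by rewrite invr_gt0.
have Mi1 : M^-1 <= 1 by rewrite invf_le1.
have P0 : 0 <= Y `^ (th / 2) by apply: powR_ge0.
have Yi0 : 0 <= Y^-1 by rewrite invr_ge0 ltW.
have A0 : 0 <= M * Y `^ (th / 2) by rewrite mulr_ge0 // ltW.
have B0 : 0 <= M^-1 * Y^-1 by rewrite mulr_ge0 // ltW.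
case: (lerP Y M^-1) => h.
  suff : 1 <= M^-1 * Y^-1 by lra.
  by rewrite ler_pdivlMr // mul1r.
suff : 1 <= M * Y `^ (th / 2) by lra.
have th2 : 0 <= th / 2 by rewrite /th; lra.
have : M^-1 `^ (th / 2) <= Y `^ (th / 2).
  by rewrite ge0_ler_powR ?nnegrE // ltW.
have : M^-1 <= M^-1 `^ (th / 2).
  by apply: ger1_powR; [rewrite Mi0 | rewrite /th; lra].
move=> h1 h2; rewrite -ler_pdivrMl // mulr1; exact: le_trans h1 h2.
Qed.

Lemma powR_prod (I : Type) (s : seq I) (F : I -> R) (e : R) :
  (forall i, 0 <= F i) -> (\prod_(i <- s) F i) `^ e = \prod_(i <- s) F i `^ e.
Proof.
move=> F0; elim: s => [|i s IH]; first by rewrite !big_nil powR1.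
by rewrite !big_cons powRM ?IH // prodr_ge0.
Qed.

Lemma am_gm (y U L lam : R) : 0 <= y -> 0 <= U -> 0 <= L -> 0 < lam ->
  y ^+ 2 <= U * L -> y <= 2^-1 * (lam * U + lam^-1 * L).
Proof.
move=> y0 U0 L0 l0 h.
have li0 : 0 < lam^-1 by rewrite invr_gt0.
have A0 : 0 <= lam * U by rewrite mulr_ge0 // ltW.
have B0 : 0 <= lam^-1 * L by rewrite mulr_ge0 // ltW.
have E : (lam * U) * (lam^-1 * L) = U * L.
  by rewrite mulrACA mulfV ?gt_eqF // mul1r.
rewrite -E in h; move: (lam * U) (lam^-1 * L) h A0 B0 => A B h A0 B0.
rewrite -(@ler_pXn2r _ 2) ?nnegrE //; last by rewrite mulr_ge0 // addr_ge0.
apply: le_trans h _.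
have -> : (2^-1 * (A + B)) ^+ 2 = A * B + 4^-1 * (A - B) ^+ 2 by field.
by rewrite lerDl mulr_ge0 ?sqr_ge0.
Qed.

Section OneEnvironment.
Variables (w : V -> V -> R).
Hypothesis (w_ge0 : forall v u, adj G v u -> 0 <= w v u).
Hypothesis (w_sym : forall v u, adj G v u -> w v u = w u v).
Variables (g : nat -> V) (m kappa N : nat) (B : pred V) (M lam : R).
Hypotheses (gd : guide G v0 g m) (k0 : (0 < kappa)%N) (M1 : 1 <= M) (lam0 : 0 < lam).

Let Up x k := urn_product g m (guide_value G w g th) x (exit_time B x k).
Let Lp x k := urn_product g m (fun=> lrrw_value th tB a) x (exit_time B x k).

Lemma guide_event_chain :
  kernel_sum G v0 (chain_kernel G w) N (fun x _ => (guide_event g m B kappa N x)%:R)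
  <= (M * (2^-1 * lam) * 7 ^+ m + M^-1 * (kappa%:R * 3 ^+ m)) +
     M * (2^-1 * lam^-1) * kernel_sum G v0 (chain_kernel G w) N Lp.
Proof.
have th0 : 0 < th by rewrite /th; lra.
have th1 : th <= 2^-1 by rewrite /th; lra.
have M0 : 0 < M by apply: lt_le_trans M1.
have pw0 x k : 0 <= path_weight (chain_kernel G w) x k.
  by apply: path_weight_ge0 => i u _; exact: (chain_step_ge0 fin w_ge0).
have lv0 (i : nat) s : 0 <= lrrw_value th tB a s.
  by apply: lrrw_value_ge0 => //; rewrite /tB; lra.
have Lp0 x k : 0 <= Lp x k by apply: urn_product_ge0.
have Up0 x k : 0 <= Up x k.
  by apply: urn_product_ge0 => i s; apply: guide_value_ge0.
have KL0 : 0 <= kernel_sum G v0 (chain_kernel G w) N Lp.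
  by apply: sumr_ge0 => l _; rewrite mulr_ge0.
have mi0 : 0 < M^-1 by rewrite invr_gt0.
have li0 : 0 < lam^-1 by rewrite invr_gt0.
have A0 : 0 <= M * (2^-1 * lam) * 7 ^+ m by rewrite !mulr_ge0 ?exprn_ge0 // ltW.
have B0 : 0 <= M^-1 * (kappa%:R * 3 ^+ m) by rewrite !mulr_ge0 ?exprn_ge0 // ltW.
have C0 : 0 <= M * (2^-1 * lam^-1) by rewrite !mulr_ge0 // ltW.
(* A chain does not cross an edge of weight 0, so with such an edge on the guide the sum vanishes.
   Otherwise all ratios are positive. *)
case: (boolP [forall i : 'I_m.+1, 0 < w (g i) (g i.+1)]) => [/forallP pos|]; last first.
  move=> /forallPn[i ni].
  apply: (@le_trans _ _ (kernel_sum G v0 (chain_kernel G w) N (fun _ _ => 0))).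
    apply: (ler_kernel_sum fin) => [x _|x wx nz]; first exact: pw0.
    case E : (guide_event _ _ _ _ _ _) => //.
    case/and4P: E => _ _ /forallP/(_ i)/crossings_gt0P[j jN [e1 e2]] _.
    by move: ni; rewrite -e1 -e2 (path_weight_pos_edge w_ge0 wx nz jN).
  rewrite /kernel_sum big1 => [|l _]; last by rewrite mulr0.
  by rewrite !addr_ge0 // mulr_ge0.
have wpos i : (i <= m)%N -> 0 < w (g i) (g i.+1).
  by move=> im; have := pos (Ordinal (im : (i < m.+1)%N)).
have wpos' i : (i < m)%N -> 0 < w (g i) (g i.+1) by move=> im; apply: wpos; rewrite ltnW.
pose S x : R := (staged_exit v0 g m kappa N B x)%:R *
  \prod_(i < m) (flag_weight w g i (guide_states g N B x i))^-1.
have rp i : (i < m)%N -> 0 < up_ratio w g i.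
  by move=> im; rewrite divr_gt0 ?wpos // ltnW.
apply: (@le_trans _ _ (kernel_sum G v0 (chain_kernel G w) N (fun x k =>
   M * (2^-1 * lam) * Up x k + M * (2^-1 * lam^-1) * Lp x k + M^-1 * S x))).
  apply: (ler_kernel_sum fin) => [x _|x wx nz]; first exact: pw0.
  have S0 : 0 <= S x.
    rewrite mulr_ge0 //; apply: prodr_ge0 => i _; rewrite invr_ge0 /flag_weight.
    by case: (guide_states _ _ _ _ _) => *; rewrite ?exprn_ge0 // ltW // rp.
  have A1 : 0 <= M * (2^-1 * lam) by rewrite !mulr_ge0 // ltW.
  case E : (guide_event _ _ _ _ _ _); last first.
    by rewrite !addr_ge0 //; apply: mulr_ge0 => //; exact: ltW.
  case/and4P: E => pok /forallP ex _ st.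
  pose Y := \prod_(i < m) flag_weight w g i (guide_states g N B x i).
  have fp (i : 'I_m) : 0 < flag_weight w g i (guide_states g N B x i).
    rewrite /flag_weight /guide_states.
    have ne : g i != g i.+2 by case: gd => _ _ _; apply.
    have := urn_inv (g i.+1) x (exit_time B x N) ne.
    case: (urn _ _ _ _ _) => [t _|t _|t _|t [_ _ t0]|t _]; rewrite ?rp //.
    by rewrite exprn_gt0 // ltr0n.
  have Y0 : 0 < Y by apply: prodr_gt0 => i _.
  have SE : S x = Y^-1 by rewrite /S st mul1r -prodfV.
  have h := one_le_split M1 Y0.
  have y2 : (Y `^ (th / 2)) ^+ 2 <= Up x N * Lp x N.
    rewrite -powR_mulrn ?powR_ge0 // -powRrM divfK //.
    rewrite /Up /Lp !urn_productE // -big_split /=.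
    have -> : Y `^ th = \prod_(i < m) (flag_weight w g i (guide_states g N B x i)) `^ th.
      by rewrite powR_prod // => i; exact: ltW.
    apply: ler_prod => i _; rewrite powR_ge0 /=.
    have im := ltn_ord i.
    have r0 := ltW (rp i im).
    have p0 := down_prob_gt0 fin w_ge0 w_sym gd wpos' im.
    have rp1 := up_down_le1 fin w_ge0 w_sym gd wpos' im.
    have ne : g i != g i.+2 by case: gd => _ _ _; apply.
    have := urn_inv (g i.+1) x (exit_time B x N) ne.
    have := ex i; rewrite /guide_states; set s := urn _ _ _ _ _ => exs inv.
    apply: (@le_trans _ _ (lrrw_reward th tB s *
        chain_reward th (up_ratio w g i) (down_prob G w g i) s)).
      case: s exs inv => // t _ inv.
      - by apply: ratio_le_rewards => //; rewrite ?ltW // /th /tB; lra.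
      - rewrite /= mulr1 -powR_mulrn // -powRrM.
        by rewrite (_ : 3%:R * th = tB) // /th /tB; field.
      - by apply: ratio_le_rewards => //; rewrite ?ltW // /th /tB; lra.
    rewrite mulrC; apply: ler_pM.
    - by case: s exs inv => // t _ _ /=; rewrite ?invr_ge0 ?powR_ge0.
    - by case: s exs inv => // t _ _ /=; rewrite ?invr_ge0 ?powR_ge0.
    - by apply: chain_reward_le_value; case: s exs inv.
    - have tB0 : 0 <= tB by rewrite /tB; lra.
      have tB1 : tB < 2^-1 by rewrite /tB; lra.
      by apply: (lrrw_reward_le_value th a tB0 tB1); case: s exs inv.
  have := am_gm (powR_ge0 _ _) (Up0 x N) (Lp0 x N) lam0 y2.
  move=> h2; rewrite SE.
  have := ler_wpM2l (ltW M0) h2.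
  rewrite /=; move: h; move: (Y `^ _) (Up x N) (Lp x N) (M^-1 * Y^-1) => y u l z; lra.
have -> : kernel_sum G v0 (chain_kernel G w) N (fun x k =>
     M * (2^-1 * lam) * Up x k + M * (2^-1 * lam^-1) * Lp x k + M^-1 * S x) =
   M * (2^-1 * lam) * kernel_sum G v0 (chain_kernel G w) N Up +
   M * (2^-1 * lam^-1) * kernel_sum G v0 (chain_kernel G w) N Lp +
   M^-1 * kernel_sum G v0 (chain_kernel G w) N (fun x _ => S x).
  rewrite /kernel_sum !mulr_sumr -!big_split /=; apply: eq_bigr => l _; ring.
have h1 := chain_urn_product fin w_ge0 w_sym gd (ltW th0) th1 wpos' B N.
have h2 := staged_exit_prob fin w_ge0 w_sym gd wpos N k0 B.
rewrite addrAC lerD2r; apply: lerD.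
  by apply: ler_wpM2l => //; rewrite !mulr_ge0 // ltW.
by apply: ler_wpM2l => //; exact: ltW.
Qed.

End OneEnvironment.
End Exit.

Lemma geometric_tail (R : realType) (q : R) n N : 0 <= q -> q <= 2^-1 ->
  \sum_(m < N) (if (n <= m)%N then q ^+ m else 0) <= 2 * q ^+ n.
Proof.
move=> q0 q1.
suff : \sum_(m < N) (if (n <= m)%N then q ^+ m else 0) <=
    2 * (q ^+ n - q ^+ (maxn n N)).
  move/le_trans; apply; rewrite ler_pM2l // lerBlDr lerDl exprn_ge0 //.
elim: N => [|N IH]; first by rewrite big_ord0 maxn0 subrr mulr0.
rewrite big_ord_recr /=; case: (leqP n N) => nN.
  rewrite (maxn_idPr nN) in IH; rewrite (maxn_idPr (leqW nN)).
  have : q ^+ N.+1 <= 2^-1 * q ^+ N.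
    by rewrite exprS ler_wpM2r // exprn_ge0.
  move: IH; move: (\sum_(i < N) _) (q ^+ N) (q ^+ N.+1) (q ^+ n) => S x y z; lra.
rewrite (maxn_idPl (ltnW nN)) in IH; rewrite (maxn_idPl nN).
by rewrite addr0.
Qed.

Lemma io_pigeonhole (V : choiceType) (x : nat -> V) (L : seq V) M :
  (forall k, (M <= k)%N -> x k \in L) -> exists v, visited_io x v.
Proof.
elim: L M => [|v L IH] M h; first by have := h M (leqnn M).
have [io|nio] := pselect (visited_io x v); first by exists v.
have [M' hM'] : exists M', forall k, (M' <= k)%N -> x k <> v.
  apply: contrapT => ne; apply: nio => M'; apply: contrapT => ne'.
  by apply: ne; exists M' => k Mk e; apply: ne'; exists k.
apply: (IH (maxn M M')) => k; rewrite geq_max => /andP[Mk M'k].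
by have := h k Mk; rewrite inE => /orP[/eqP|//]; move/hM': M'k.
Qed.

Section Recurrence.
Variables (V : choiceType) (G : graph V) (R : realType) (v0 : V) (a : R).
Variables (d : measure_display) (T : measurableType d) (P : probability T R).
Variables (X : nat -> T -> V) (W : T -> V -> V -> R).
Hypotheses (fin : forall v, finite_set [set w | adj G v w]) (a_gt0 : 0 < a).
Hypothesis has_nbr : forall v, exists u, adj G v u.
Hypothesis env : is_random_environment G P v0 a X W.
Variable K : nat.
Hypotheses (degK : forall v, (degree G v <= K)%N) (Ka : K%:R * a <= 1) (a1 : a <= 1).
Hypotheses (K0 : (0 < K)%N).
Hypothesis a_small : 48%:R * K%:R ^+ 2 * exit_const R * Num.sqrt a <= 1.
Implicit Types (x : nat -> V).

Let KR : 1 <= K%:R :> R. Proof. by rewrite ler1n. Qed.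

Lemma guide_event_prob gs m kappa N B :
  guide G v0 (nth v0 gs) m -> (0 < kappa)%N ->
  kernel_sum G v0 (lrrw_step G a) N
    (fun x _ => (guide_event v0 (nth v0 gs) m B kappa N x)%:R)
  <= (1 + kappa%:R) * ((4 * K%:R) ^+ m)^-1.
Proof.
move=> gd k0; set g := nth v0 gs.
have K1 := KR.
(* As [12 K] is 3 times [4 K], the factor [1/M] cancels the [3^m] of the stages and leaves
   [(4 K)^(-m)], small against the number of guides. In the AM-GM term [M] is paid for by [sqrt a];
   hence [48 K^2], which is [12 K] times [4 K]. *)
set M : R := (12 * K%:R) ^+ m.
set lam : R := Num.sqrt a ^+ m.
have sa0 : 0 < Num.sqrt a by rewrite sqrtr_gt0.
have lam0 : 0 < lam by rewrite exprn_gt0.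
have M1 : 1 <= M by rewrite exprn_ege1 //; lra.
have M0 : 0 < M by lra.
have E0 := exit_const_gt0 R.
set th : R := 8^-1; set tB : R := 3 / 8.
have CLp : 0 < lrrw_const th tB by apply: lrrw_const_gt0; rewrite /th /tB; lra.
have L0 (i : nat) s : 0 <= lrrw_value th tB a s.
  by apply: lrrw_value_ge0 => //; rewrite /th /tB; lra.
have tA0 : 0 < th by rewrite /th; lra.
have tA1 : th <= 1 by rewrite /th; lra.
have tB0 : 0 <= tB by rewrite /tB; lra.
have tB1 : tB < 2^-1 by rewrite /tB; lra.
have hL := lrrw_urn_product fin a_gt0 degK Ka tA0 tA1 tB0 tB1 gd B N.
pose A := M * (2^-1 * lam) * 7 ^+ m + M^-1 * (kappa%:R * 3 ^+ m).
pose c := M * (2^-1 * lam^-1).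
have A0 : 0 <= A by rewrite addr_ge0 // !mulr_ge0 ?exprn_ge0 ?invr_ge0 // ltW.
have c0 : 0 <= c by rewrite !mulr_ge0 ?invr_ge0 // ltW.
have := @kernel_sum_mix_le V G R v0 a d T P X W fin env N
  (fun x _ => (guide_event v0 g m B kappa N x)%:R)
  (fun x k => urn_product g m (fun=> lrrw_value th tB a) x (exit_time B x k))
  A c A0 c0 (fun _ _ => ler0n _ _) (fun _ _ => urn_product_ge0 _ _ L0 _ _).
move=> /(_ _)/le_trans; apply.
  apply: aeW => t; apply: guide_event_chain => //.
  - by move=> v u; exact: env_ge0 env _ _ _.
  - by move=> v u; exact: env_sym env _ _ _.
apply: le_trans (lerD (lexx A) (ler_wpM2l c0 hL)) _.
have sa : a = Num.sqrt a ^+ 2 by rewrite sqr_sqrtr // ltW.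
set q := (4 * K%:R) ^+ m; have q0 : 0 < q by rewrite exprn_gt0 //; lra.
have key : (12 * K%:R * exit_const R * Num.sqrt a) ^+ m <= q^-1.
  rewrite -exprVn; apply: lerXn2r; rewrite ?nnegrE.
  - by rewrite !mulr_ge0 // ltW.
  - by rewrite invr_ge0; lra.
  rewrite -[leRHS]mul1r ler_pdivlMr; last by lra.
  apply: le_trans a_small; rewrite le_eqVlt; apply/orP; left; apply/eqP.
  ring.
have e7 : 7 <= exit_const R by rewrite /exit_const lerDl ltW.
have eC : lrrw_const th tB <= exit_const R by rewrite /exit_const lerDr.
have x1 : M * (2^-1 * lam) * 7 ^+ m <= 2^-1 * q^-1.
  apply: (@le_trans _ _ (2^-1 * (12 * K%:R * exit_const R * Num.sqrt a) ^+ m)).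
    rewrite /M /lam !exprMn.
    have : 7 ^+ m <= exit_const R ^+ m.
      by apply: lerXn2r => //; rewrite nnegrE ltW.
    move=> h; have := ler_wpM2l (ltW (mulr_gt0 M0 lam0)) h.
    rewrite /M /lam !exprMn; lra.
  by rewrite ler_pM2l.
have x2 : c * (lrrw_const th tB * a) ^+ m <= 2^-1 * q^-1.
  apply: (@le_trans _ _ (2^-1 * (12 * K%:R * exit_const R * Num.sqrt a) ^+ m)).
    have -> : c * (lrrw_const th tB * a) ^+ m = 2^-1 * (M * lam * lrrw_const th tB ^+ m).
      rewrite /c {1}sa exprMn -exprM mulnC exprM -/lam expr2.
      by field; rewrite gt_eqF.
    rewrite ler_pM2l // /M /lam !exprMn.
    have : lrrw_const th tB ^+ m <= exit_const R ^+ m.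
      by apply: lerXn2r => //; rewrite nnegrE ltW.
    move=> h; have := ler_wpM2l (ltW (mulr_gt0 M0 lam0)) h.
    rewrite /M /lam !exprMn; lra.
  by rewrite ler_pM2l.
have x3 : M^-1 * (kappa%:R * 3 ^+ m) = kappa%:R * q^-1.
  have K0' : K%:R != 0 :> R by rewrite gt_eqF //; lra.
  rewrite mulrCA /M /q -!exprVn -exprMn; congr (_ * _ ^+ _).
  by field.
rewrite /A x3 [leRHS]mulrDl mul1r.
move: (M * _ * _) (c * _ ^+ m) (kappa%:R / q) (q^-1) x1 x2 => y1 y2 y3 y4; lra.
Qed.

Lemma exits_prob n kappa N : (0 < kappa)%N ->
  kernel_sum G v0 (lrrw_step G a) N
    (fun x _ => (exits v0 (ball G v0 n.+1) kappa N x)%:R)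
  <= 2 * K%:R * (1 + kappa%:R) * 4^-1 ^+ n.
Proof.
move=> k0; have K1 := KR.
pose B := ball G v0 n.+1.
pose F m (gs : seq V) x : R := if `[< guide G v0 (nth v0 gs) m >] && (n <= m)%N
   then (guide_event v0 (nth v0 gs) m B kappa N x)%:R else 0.
have F0 m gs x : 0 <= F m gs x by rewrite /F; case: ifP.
have pw0 x k : 0 <= path_weight (lrrw_step G a) x k.
  by apply: path_weight_ge0 => i u _; exact: lrrw_step_ge0.
apply: (@le_trans _ _ (kernel_sum G v0 (lrrw_step G a) N (fun x _ =>
   \sum_(m < N) \sum_(gs <- walks G v0 m.+1) F m gs x))).
  apply: (ler_kernel_sum fin) => [x _|x wx _]; first exact: pw0.
  have FF0 (m : nat) : 0 <= \sum_(gs <- walks G v0 m.+1) F m gs x.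
    by apply: sumr_ge0.
  case E : (exits _ _ _ _ _); last by apply: sumr_ge0 => m _.
  have [m [gs [nm mN gin gd ge]]] := exits_guide fin (ltn0Sn n) wx E.
  rewrite (bigD1 (Ordinal mN)) //= ler_wpDr ?sumr_ge0 // => [? _|]; first exact: FF0.
  rewrite (big_rem gs) //= ler_wpDr ?sumr_ge0 //.
  by rewrite /F asboolT //= -ltnS nm /B ge.
rewrite /kernel_sum.
under eq_bigr => l _ do rewrite mulr_sumr.
rewrite exchange_big /=.
apply: (@le_trans _ _ (\sum_(m < N) (if (n <= m)%N then
   (K%:R * (1 + kappa%:R)) * 4^-1 ^+ m else 0))).
  apply: ler_sum => m _.
  under eq_bigr => l _ do rewrite mulr_sumr.
  rewrite exchange_big /=.
  case: ifP => nm; last first.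
    rewrite big1 // => gs _; rewrite big1 // => l _.
    by rewrite /F nm andbF mulr0.
  apply: (@le_trans _ _ (\sum_(gs <- walks G v0 m.+1) (1 + kappa%:R) * ((4 * K%:R) ^+ m)^-1)).
    apply: ler_sum => gs _; rewrite /F nm andbT.
    case: asboolP => gd; first exact: guide_event_prob.
    rewrite big1 => [|l _]; last by rewrite mulr0.
    by rewrite mulr_ge0 ?addr_ge0 // invr_ge0 exprn_ge0 // mulr_ge0.
  rewrite big_const_seq count_predT iter_addr addr0 -[leLHS]mulr_natl.
  apply: (@le_trans _ _ ((K ^ m.+1)%:R * ((1 + kappa%:R) / (4 * K%:R) ^+ m))).
    apply: ler_wpM2r; last by rewrite ler_nat size_walks.
    by rewrite mulr_ge0 ?addr_ge0 // invr_ge0 exprn_ge0 // mulr_ge0.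
  rewrite natrX exprS le_eqVlt; apply/orP; left; apply/eqP.
  have K0' : K%:R ^+ m != 0 :> R by rewrite expf_neq0 // gt_eqF //; lra.
  by rewrite exprMn invfM exprVn; field; rewrite K0' expf_neq0.
rewrite (eq_bigr (fun m : 'I_N => (K%:R * (1 + kappa%:R)) *
   (if (n <= m)%N then 4^-1 ^+ m else 0))); last first.
  by move=> m _; case: ifP => // _; rewrite mulr0.
rewrite -mulr_sumr.
have h := @geometric_tail R 4^-1 n N ltac:(lra) ltac:(lra).
apply: le_trans (ler_wpM2l _ h) _; first by rewrite mulr_ge0 // addr_ge0.
by rewrite le_eqVlt; apply/orP; left; apply/eqP; ring.
Qed.

Lemma exit_time_stable B x N N' : (exit_time B x N < N)%N -> (N <= N')%N ->
  exit_time B x N' = exit_time B x N.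
Proof.
move=> lt /subnKC <-; elim: (N' - N)%N => [|n IH]; first by rewrite addn0.
rewrite addnS /= IH; case: eqP => //= e; move: lt.
by rewrite e ltnNge leq_addr.
Qed.

Lemma no_exit_ae kappa : (0 < kappa)%N ->
  {ae P, forall t, exists n, forall N, ~~ exits v0 (ball G v0 n) kappa N (trajectory X t)}.
Proof.
move=> k0.
pose A := [set t | (forall N, is_walk G v0 (trajectory X t) N) /\
  forall n, exists N, exits v0 (ball G v0 n) kappa N (trajectory X t)].
have hA : P.-negligible A.
  apply: negligible_liminf => e e0.
  set c : R := 2 * K%:R * (1 + kappa%:R).
  have c0 : 0 < c by rewrite !mulr_gt0 ?ltr0n // ltr_pwDl.
  have [n nE] : exists n, c * 4^-1 ^+ n <= e.
    exists (Num.Def.truncn (c / e)).+1.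
    set n := (Num.Def.truncn (c / e)).+1.
    have h1 : c / e <= n%:R by rewrite ltW // truncnS_gt.
    have h2 : n%:R <= 4 ^+ n :> R.
      by rewrite -natrX ler_nat ltnW // ltn_expl.
    rewrite exprVn ler_pdivrMr ?exprn_gt0 // mulrC -ler_pdivrMr //.
    exact: le_trans h1 h2.
  exists (fun N => path_event G v0 X N (exits v0 (ball G v0 n.+1) kappa N)); split.
  - move=> N; exact: (measurable_path_event env).
  - move=> N; apply: le_trans (prob_path_event fin env _ _) _.
    rewrite lee_fin; apply: le_trans nE; exact: exits_prob.
  move=> t [wt /(_ n.+1) [M hM]]; exists M => N MN.
  have hE : exits v0 (ball G v0 n.+1) kappa N (trajectory X t).
    move: hM => /andP[lt dep]; rewrite /exits (exit_time_stable lt MN) dep andbT.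
    exact: leq_trans lt MN.
  apply: (path_eventP fin) => // x y xy.
  rewrite /exits (exit_time_local _ xy).
  by rewrite (departures_local v0 (agreeW (exit_time_le _ y N) xy)).
have hA' : {ae P, forall t, ~ A t}.
  by move: hA => [N [mN N0 sub]]; exists N; split=> // t /= /contrapT; apply: sub.
apply: filterS2 (is_walk_ae fin a_gt0 has_nbr env) hA' => t wt nA.
apply: contrapT => ne; apply: nA; split=> // n.
apply: contrapT => ne'; apply: ne; exists n => N; apply/negP => h.
by apply: ne'; exists N.
Qed.

(** If [v0] is visited finitely often, departures from it are bounded, so the walk never leaves some
    ball; this is finite, and one of its vertices is visited infinitely often. Otherwise [v0] is
    such a vertex. *)
Lemma all_edges_crossed_ae : connected_graph G ->
  {ae P, forall t, forall v w, adj G v w ->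
     exists k, trajectory X t k = v /\ trajectory X t k.+1 = w}.
Proof.
move=> conn.
have h1 : {ae P, forall t, forall kappa, exists n, forall N,
    ~~ exits v0 (ball G v0 n) kappa.+1 N (trajectory X t)}.
  by apply: ae_foralln => kappa; exact: no_exit_ae.
apply: filterS2 h1 (visited_io_ae fin a_gt0 has_nbr env degK Ka a1 conn) => t hk; apply.
set x := trajectory X t in hk *.
have [io|nio] := pselect (visited_io x v0); first by exists v0.
have [M hM] : exists M, forall k, (M <= k)%N -> x k <> v0.
  apply: contrapT => ne; apply: nio => M; apply: contrapT => ne'.
  by apply: ne; exists M => k Mk e; apply: ne'; exists k.
have dep k : (departures x k v0 <= M)%N.
  elim: k => [|k IH]; first by rewrite departures0.
  case: (leqP M k) => Mk.
    by rewrite departuresS; case: eqP => [/(hM _ Mk)|] //; rewrite addn0.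
  by apply: leq_trans (departures_le x k.+1 v0) Mk.
have [n hn] := hk M.
apply: (@io_pigeonhole _ x (flatten [seq [seq last v0 l | l <- walks G v0 j] | j <- iota 0 n]) 0).
move=> k _; have := hn k.+1; rewrite /exits negb_and => /orP[|]; last first.
  by rewrite (leq_trans (dep _) (leqnSn M)).
rewrite -leqNgt => le.
have := @exit_time_in V (ball G v0 n) x k.+1 k le => /hasP[j jn jin].
by apply/flattenP; exists [seq last v0 l | l <- walks G v0 j] => //; apply: map_f.
Qed.

End Recurrence.

(** * The first crossing of an edge *)

Lemma exit_timeT (V : choiceType) (x : nat -> V) k : exit_time predT x k = k.
Proof. by elim: k => [//|k /= ->]; rewrite eqxx. Qed.

Section ReachEdge.
Variables (V : choiceType) (G : graph V) (R : realType) (v0 : V) (a : R).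
Hypotheses (fin : forall v, finite_set [set w | adj G v w]) (a_gt0 : 0 < a).
Implicit Types (x : nat -> V).

Definition is_ended (s : urn_state) : bool :=
  match s with DownEnd _ | UpEnd _ => true | _ => false end.

Definition reach_event g m N x : bool :=
  [&& path_ok g m x N,
      [forall i : 'I_m, is_ended (urn (g i) (g i.+1) (g i.+2) x N)]
    & [forall i : 'I_m.+1, (0 < crossings x N (g i) (g i.+1))%N]].

Lemma reach_event_local g m : local (fun x N => reach_event g m N x).
Proof.
move=> N x y xy; rewrite /reach_event (path_ok_local _ _ xy).
congr [&& _, _ & _].
- by apply: eq_forallb => i; rewrite (urn_local _ _ _ xy).
- by apply: eq_forallb => i; rewrite (crossings_local _ _ xy).
Qed.

Variables (w : V -> V -> R) (K : nat) (s : R).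
Hypothesis (w_ge0 : forall v u, adj G v u -> 0 <= w v u).
Hypothesis (w_sym : forall v u, adj G v u -> w v u = w u v).
Hypotheses (degK : forall v, (degree G v <= K)%N) (w1 : vertex_weight G w v0 = 1).
Hypotheses (s_gt0 : 0 < s) (s_lt : s < 4^-1).
Variables (g : nat -> V) (m N : nat) (lam : R).
Hypotheses (gd : guide G v0 g m) (N0 : (0 < N)%N) (lam0 : 0 < lam).

Let th : R := 2 * s.
Let Up := urn_product g m (guide_value G w g th).
Let Lp := urn_product g m (fun=> lrrw_value th th a).

Lemma reach_event_chain :
  kernel_sum G v0 (chain_kernel G w) N (fun x _ =>
    (reach_event g m N x)%:R * (w (g m) (g m.+1) / w (x 0%N) (x 1%N)) `^ s)
  <= 2^-1 * lam * (K%:R * 7 ^+ m) +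
     2^-1 * lam^-1 * kernel_sum G v0 (chain_kernel G w) N Lp.
Proof.
have s0 := s_gt0; have s1 := s_lt.
have th0 : 0 < th by rewrite /th; lra.
have th1 : th <= 2^-1 by rewrite /th; lra.
have th2 : th < 2^-1 by rewrite /th; lra.
have pw0 x k : 0 <= path_weight (chain_kernel G w) x k.
  by apply: path_weight_ge0 => i u _; exact: (chain_step_ge0 fin w_ge0).
have lv0 (i : nat) st : 0 <= lrrw_value th th a st.
  by apply: lrrw_value_ge0.
have Lp0 x k : 0 <= Lp x k by apply: urn_product_ge0.
have Up0 x k : 0 <= Up x k.
  by apply: urn_product_ge0 => i st; apply: guide_value_ge0.
have KL0 : 0 <= kernel_sum G v0 (chain_kernel G w) N Lp.
  by apply: sumr_ge0 => l _; rewrite mulr_ge0.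
have li0 : 0 < lam^-1 by rewrite invr_gt0.
have A0 : 0 <= 2^-1 * lam * (K%:R * 7 ^+ m) by rewrite !mulr_ge0 ?exprn_ge0 // ltW.
have B0 : 0 <= 2^-1 * lam^-1 by rewrite mulr_ge0 // ltW.
case: (boolP [forall i : 'I_m.+1, 0 < w (g i) (g i.+1)]) => [/forallP pos|]; last first.
  move=> /forallPn[i ni].
  apply: (@le_trans _ _ (kernel_sum G v0 (chain_kernel G w) N (fun _ _ => 0))).
    apply: (ler_kernel_sum fin) => [x _|x wx nz]; first exact: pw0.
    case E : (reach_event _ _ _ _); last by rewrite mul0r.
    case/and3P: E => _ _ /forallP/(_ i)/crossings_gt0P[j jN [e1 e2]].
    by move: ni; rewrite -e1 -e2 (path_weight_pos_edge w_ge0 wx nz jN).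
  rewrite /kernel_sum big1 => [|l _]; last by rewrite mulr0.
  by rewrite addr_ge0 // mulr_ge0.
have wpos i : (i <= m)%N -> 0 < w (g i) (g i.+1).
  by move=> im; have := pos (Ordinal (im : (i < m.+1)%N)).
have wpos' i : (i < m)%N -> 0 < w (g i) (g i.+1) by move=> im; apply: wpos; rewrite ltnW.
have rp i : (i < m)%N -> 0 < up_ratio w g i.
  by move=> im; rewrite divr_gt0 ?wpos // ltnW.
have tele n : (n <= m)%N ->
    w (g n) (g n.+1) = w (g 0%N) (g 1%N) * \prod_(i < n) up_ratio w g i.
  elim: n => [|n IH] nm; first by rewrite big_ord0 mulr1.
  rewrite big_ord_recr /= mulrA -IH ?(ltnW nm) // /up_ratio mulrCA mulfV ?mulr1 //.
  by rewrite gt_eqF // wpos'.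
pose FU x k := first_factor w g th x * Up x k.
apply: (@le_trans _ _ (kernel_sum G v0 (chain_kernel G w) N (fun x k =>
   2^-1 * lam * FU x k + 2^-1 * lam^-1 * Lp x k))).
  apply: (ler_kernel_sum fin) => [x _|x wx nz]; first exact: pw0.
  have FU0 : 0 <= FU x N by rewrite mulr_ge0 ?powR_ge0.
  have A1 : 0 <= 2^-1 * lam by rewrite mulr_ge0 // ltW.
  case E : (reach_event _ _ _ _); last by rewrite mul0r addr_ge0 // mulr_ge0.
  case/and3P: E => pok /forallP ex _; rewrite mul1r.
  have x01 : 0 < w (x 0%N) (x 1%N) by apply: (path_weight_pos_edge w_ge0 wx nz N0).
  have y2 : ((w (g m) (g m.+1) / w (x 0%N) (x 1%N)) `^ s) ^+ 2 <= FU x N * Lp x N.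
    rewrite -powR_mulrn ?powR_ge0 // -powRrM [s * _]mulrC -/th.
    rewrite tele // mulrAC /FU -[leRHS]mulrA.
    have q0 : 0 <= w (g 0%N) (g 1%N) / w (x 0%N) (x 1%N).
      by apply: divr_ge0; apply: ltW => //; apply: wpos.
    have u0 : 0 <= \prod_(i < m) up_ratio w g i.
      by apply: prodr_ge0 => i _; apply: ltW; apply: rp.
    rewrite (powRM _ q0 u0).
    apply: ler_wpM2l; first exact: powR_ge0.
    rewrite /Up /Lp !urn_productE // -big_split /=.
    have -> : (\prod_(i < m) up_ratio w g i) `^ th = \prod_(i < m) up_ratio w g i `^ th.
      by apply: powR_prod => i; rewrite ltW // rp.
    apply: ler_prod => i _; rewrite powR_ge0 /=.
    have im := ltn_ord i.
    have r0 := ltW (rp i im).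
    have p0 := down_prob_gt0 fin w_ge0 w_sym gd wpos' im.
    have rp1 := up_down_le1 fin w_ge0 w_sym gd wpos' im.
    have ne : g i != g i.+2 by case: gd => _ _ _; apply.
    have := urn_inv (g i.+1) x N ne.
    have := ex i; set st := urn _ _ _ _ _ => exs inv.
    apply: (@le_trans _ _ (lrrw_reward th th st *
        chain_reward th (up_ratio w g i) (down_prob G w g i) st)).
      apply: ratio_le_rewards => //; first exact: ltW.
      by case: st exs inv.
    rewrite mulrC; apply: ler_pM.
    - by case: st exs inv => // t _ _ /=; rewrite ?invr_ge0 ?powR_ge0.
    - by case: st exs inv => // t _ _ /=; rewrite ?invr_ge0 ?powR_ge0.
    - by apply: chain_reward_le_value; case: st exs inv.
    - by apply: (lrrw_reward_le_value th a (ltW th0) th2); case: st exs inv.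
  have := am_gm (powR_ge0 _ _) FU0 (Lp0 x N) lam0 y2.
  by rewrite mulrDr !mulrA.
have -> : kernel_sum G v0 (chain_kernel G w) N (fun x k =>
     2^-1 * lam * FU x k + 2^-1 * lam^-1 * Lp x k) =
   2^-1 * lam * kernel_sum G v0 (chain_kernel G w) N FU +
   2^-1 * lam^-1 * kernel_sum G v0 (chain_kernel G w) N Lp.
  rewrite /kernel_sum !mulr_sumr -!big_split /=; apply: eq_bigr => l _; ring.
rewrite lerD2r ler_wpM2l //; first by rewrite mulr_ge0 // ltW.
exact: (chain_urn_product_first fin w_ge0 w_sym gd (ltW th0) th1 wpos' degK w1 N0).
Qed.

End ReachEdge.

Section Eventually.
Context d (T : measurableType d) (R : realType).
Variable P : {measure set T -> \bar R}.
Local Open Scope ereal_scope.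

(** The bounds hold at each finite horizon, but the edge is crossed at a random time. Fatou's lemma
    bridges this: [f] lies almost everywhere below the lower limit of the measurable [g n]. *)
Lemma integral_le_eventually (f : T -> \bar R) (g : nat -> T -> \bar R) (B : \bar R) :
  (forall t, 0 <= f t) -> (forall n t, 0 <= g n t) ->
  (forall n, measurable_fun setT (g n)) -> (forall n, \int[P]_t g n t <= B) ->
  {ae P, forall t, exists M, forall n, (M <= n)%N -> f t <= g n t} ->
  \int[P]_t f t <= B.
Proof.
move=> f0 g0 mg gB fg.
apply: (@le_trans _ _ (\int[P]_t limn_einf (g^~ t))).
  apply: ae_ge0_le_integralT => //.
  - move=> t; rewrite limn_einf_lim; apply: lime_ge; first exact: is_cvg_einfs.
    by apply: nearW => n; apply: le_ereal_inf_tmp => _ [m _ <-].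
  - have mi n : measurable_fun setT (fun t => einfs (g^~ t) n).
      exact: measurable_fun_einfs.
    apply: (@emeasurable_fun_cvg _ _ _ _ (fun n t => einfs (g^~ t) n) _ mi) => t _.
    by rewrite limn_einf_lim; exact: is_cvg_einfs.
  - apply: filterS fg => t [M hM]; rewrite limn_einf_lim.
    apply: lime_ge; first exact: is_cvg_einfs.
    exists M => // n /= Mn; apply: le_ereal_inf_tmp => _ [m /= nm <-].
    by apply: hM; exact: leq_trans Mn nm.
apply: le_trans (@fatou _ _ _ P setT measurableT g _ _) _ => //.
rewrite limn_einf_lim; apply: lime_le; first exact: is_cvg_einfs.
apply: nearW => n; apply: ge_ereal_inf; exists (\int[P]_t g n t) => //.
by rewrite /sdrop; exists n => /=.
Qed.

End Eventually.

(** * Ratios to the weight of the first edge *)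

Section FirstEdge.
Variables (V : choiceType) (G : graph V) (R : realType) (v0 : V) (a : R).
Variables (d : measure_display) (T : measurableType d) (P : probability T R).
Variables (X : nat -> T -> V) (W : T -> V -> V -> R).
Hypotheses (fin : forall v, finite_set [set w | adj G v w]) (a_gt0 : 0 < a).
Hypothesis has_nbr : forall v, exists u, adj G v u.
Hypothesis env : is_random_environment G P v0 a X W.
Variables (x y : V) (s : R).
Hypotheses (xy : adj G x y) (s_ge0 : 0 <= s).
Local Open Scope ereal_scope.

Let Gen : set (set T) := [set A | exists x y (B : set R),
  [/\ adj G x y, measurable B & A = (fun t => W t x y) @^-1` B]].

(** The inverse of 0 is 0, so a first edge of weight 0 would make the ratio vanish. Almost surely it
    is not crossed, and the normalization at [v0] gives the upper bound. *)
Lemma env_edge_pos_ae :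
  {ae P, forall t, (0 < W t (X 0%N t) (X 1%N t) <= 1)%R}.
Proof.
pose z u := [set t | W t v0 u = 0%R] `&` cylinder X (nth v0 [:: v0; u]) 1.
have z0 u : adj G v0 u -> P.-negligible (z u).
  move=> au; have wl : is_walk G v0 (nth v0 [:: v0; u]) 1.
    by split=> // i; rewrite ltnS leqn0 => /eqP ->.
  have zE : [set t | W t v0 u = 0%R] = (fun t => W t v0 u) @^-1` [set 0%R] by [].
  have hA : env_sigma G W [set t | W t v0 u = 0%R].
    apply: sub_sigma_algebra; by exists v0, u, [set 0%R]; split.
  have mA : measurable [set t | W t v0 u = 0%R].
    rewrite zE -[X in measurable X]setTI; apply: (measurable_env env au measurableT).
    exact: measurable_set1.
  exists (z u); split=> //.
    by apply: measurableI => //; exact: (measurable_cylinder env).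
  rewrite /z (prob_env_cylinder env wl hA) integral0_eq // => t /= wt0.
  by rewrite /path_weight big_ord1 /chain_kernel /chain_step /= au wt0 mul0r.
have hz : P.-negligible (\big[setU/set0]_(u <- nbrs G v0) z u).
  rewrite big_seq; elim/big_ind: _ => //; first exact: negligible_set0.
    exact: negligibleU.
  by move=> u; rewrite mem_nbrs //; exact: z0.
have [N1 [mN1 N10 sub1]] := hz.
have h2 : {ae P, forall t, ~ (\big[setU/set0]_(u <- nbrs G v0) z u) t}.
  by exists N1; split=> // t /= /contrapT; apply: sub1.
have w1 : {ae P, forall t, vertex_weight G (W t) v0 = 1%R} by case: env.
apply: filterS3 (is_walk_ae fin a_gt0 has_nbr env) h2 w1 => t wt nz wv.
have [e0 /(_ 0%N isT)] := wt 1%N; rewrite /trajectory in e0 *; rewrite e0 => a01.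
have w0 := env_ge0 env t a01.
apply/andP; split; last first.
  by rewrite -wv; apply: (le_vertex_weight fin (env_ge0 env t)).
rewrite lt_neqAle w0 andbT eq_sym; apply/eqP => e; apply: nz.
rewrite -bigcup_seq; exists (X 1%N t); first by rewrite /= mem_nbrs.
by split=> // -[|[|]] //= _; rewrite e0.
Qed.

Definition edge_ratio t (l : nat -> V) : R := (W t x y / W t (l 0%N) (l 1%N)) `^ s.

(** A measurable stand-in for the ratio along the random trajectory: on each cylinder the first edge
    is fixed, and the ratio is a function of the environment. *)
Definition ratio_sum N (c : (nat -> V) -> bool) t : \bar R :=
  \sum_(l <- walks G v0 N | c (nth v0 l))
    ((fun t => (edge_ratio t (nth v0 l))%:E) \_ (cylinder X (nth v0 l) N)) t.

Lemma edge_ratio_ge0 t l : (0 <= edge_ratio t l)%R. Proof. exact: powR_ge0. Qed.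

Lemma ratio_sum_ge0 N (c : (nat -> V) -> bool) t : 0 <= ratio_sum N c t.
Proof.
apply: sume_ge0 => l _; rewrite patchE; case: ifP => // _.
by rewrite lee_fin edge_ratio_ge0.
Qed.

Lemma edge_ratio_le_sum N (c : (nat -> V) -> bool) t :
  (0 < N)%N -> (forall l l', agree N l l' -> c l = c l') ->
  is_walk G v0 (trajectory X t) N -> c (trajectory X t) ->
  (edge_ratio t (trajectory X t))%:E <= ratio_sum N c t.
Proof.
move=> N0 lc wt ct; pose l := mkseq (trajectory X t) N.+1.
have ag : agree N (nth v0 l) (trajectory X t).
  by move=> i iN; rewrite nth_mkseq // ltnS.
have lin : l \in walks G v0 N.
  apply/(walksP _ fin); split; first by rewrite size_mkseq.
  split; first by rewrite ag //; exact: wt.1.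
  by move=> i iN; rewrite !ag //; [exact: wt.2 | exact: ltnW].
rewrite /ratio_sum big_mkcond (big_rem l) //= (lc _ _ ag) ct.
rewrite patchE mem_set; last by move=> i iN; rewrite ag.
rewrite {2}/edge_ratio !ag // leeDl //; apply: sume_ge0 => l' _.
case: ifP => // _; rewrite patchE; case: ifP => // _.
by rewrite lee_fin edge_ratio_ge0.
Qed.

Lemma measurable_ratio N l : (0 < N)%N -> is_walk G v0 l N ->
  measurable_fun setT (edge_ratio ^~ l).
Proof.
move=> N0 wl; apply: (measurableT_comp (measurable_powR s)).
apply: measurable_funM; first exact: (measurable_env env xy).
have a01 : adj G (l 0%N) (l 1%N) by apply: wl.2.
apply: measurable_inv; last exact: (measurable_env env a01).
by move=> t; exact: (env_ge0 env _ a01).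
Qed.

Lemma measurable_ratio_cylinder N l : (0 < N)%N -> is_walk G v0 l N ->
  measurable_fun setT ((fun t => (edge_ratio t l)%:E) \_ (cylinder X l N)).
Proof.
move=> N0 wl; apply: (iffLR (measurable_restrictT _ (measurable_cylinder env l N))).
by apply: measurable_funTS; apply/measurable_EFinP; exact: measurable_ratio wl.
Qed.

Lemma measurable_ratio_sum N (c : (nat -> V) -> bool) :
  (0 < N)%N -> measurable_fun setT (ratio_sum N c).
Proof.
move=> N0; rewrite /ratio_sum.
pose f l t := if `[< is_walk G v0 (nth v0 l) N >] && c (nth v0 l) then
  ((fun t => (edge_ratio t (nth v0 l))%:E) \_ (cylinder X (nth v0 l) N)) t else 0.
rewrite (_ : (fun t => _) = (fun t => \sum_(l <- walks G v0 N) f l t)); last first.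
  apply/funext => t; rewrite big_mkcond big_seq [RHS]big_seq; apply: eq_bigr => l.
  by move=> /(walksP _ fin)[_ wl]; rewrite /f asboolT.
apply: (@emeasurable_sum _ _ _ _ _ (walks G v0 N) f) => l; rewrite /f.
case: asboolP => // wl; case: (c _) => //.
exact: measurable_ratio_cylinder.
Qed.

Lemma integral_ratio_cylinder N l : (0 < N)%N -> is_walk G v0 l N ->
  \int[P]_(t in cylinder X l N) (edge_ratio t l)%:E =
  \int[P]_t (edge_ratio t l * path_weight (chain_kernel G (W t)) l N)%:E.
Proof.
move=> N0 wl.
have mW u v : adj G u v -> measurable_fun [set: g_sigma_algebraType Gen]
    ((fun t => W t u v) : g_sigma_algebraType Gen -> R).
  move=> uv _ B mB; rewrite setTI; apply: sub_sigma_algebra.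
  by exists u, v, B.
apply: (@integral_sub_sigma _ _ _ P Gen).
- move=> A [u [v [B [uv mB ->]]]]; rewrite -[X in measurable X]setTI.
  exact: (measurable_env env uv measurableT).
- exact: (measurable_cylinder env).
- by move=> t; exact: (cw_ge0 fin env).
- exact: (measurable_cw fin env).
- by move=> A hA; apply: (prob_env_cylinder env).
- by move=> t; exact: edge_ratio_ge0.
apply: (measurableT_comp (measurable_powR s)).
apply: measurable_funM; first exact: mW.
have a01 : adj G (l 0%N) (l 1%N) by apply: wl.2.
apply: measurable_inv; last exact: mW.
by move=> t; exact: (env_ge0 env _ a01).
Qed.

Lemma integral_ratio_sum_le N (c : (nat -> V) -> bool) (H : (nat -> V) -> nat -> R) (A : R) :
  (0 < N)%N -> (0 <= A)%R -> (forall z k, (0 <= H z k)%R) ->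
  {ae P, forall t, (kernel_sum G v0 (chain_kernel G (W t)) N
      (fun z _ => (c z)%:R * edge_ratio t z)
    <= A + kernel_sum G v0 (chain_kernel G (W t)) N H)%R} ->
  \int[P]_t ratio_sum N c t <= (A + kernel_sum G v0 (lrrw_step G a) N H)%:E.
Proof.
move=> N0 A0 H0 h.
have F0 t : (0 <= kernel_sum G v0 (chain_kernel G (W t)) N
    (fun z _ => (c z)%:R * edge_ratio t z))%R.
  apply: sumr_ge0 => l _; rewrite mulr_ge0 //; first exact: (cw_ge0 fin env).
  by rewrite mulr_ge0 // edge_ratio_ge0.
apply: (@le_trans _ _ (\int[P]_t (kernel_sum G v0 (chain_kernel G (W t)) N
    (fun z _ => (c z)%:R * edge_ratio t z))%:E)); last first.
  rewrite -[X in (A + X)%R]mul1r.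
  apply: (integral_le_kernel_sum fin env) => //.
  by apply: filterS h => t; rewrite mul1r.
pose b l := is_walk G v0 (nth v0 l) N.
have hb l : l \in walks G v0 N -> b l by move=> /(walksP _ fin)[].
pose f l t := if `[< b l >] && c (nth v0 l) then
  ((fun t => (edge_ratio t (nth v0 l))%:E) \_ (cylinder X (nth v0 l) N)) t else 0.
pose h' l t := if `[< b l >] && c (nth v0 l) then
  (edge_ratio t (nth v0 l) * path_weight (chain_kernel G (W t)) (nth v0 l) N)%:E else 0.
have mf l : measurable_fun setT (f l).
  rewrite /f; case: asboolP => // wl; case: (c _) => //.
  exact: measurable_ratio_cylinder.
have mh l : measurable_fun setT (h' l).
  rewrite /h'; case: asboolP => // wl; case: (c _) => //.
  apply/measurable_EFinP; apply: measurable_funM; last exact: (measurable_cw fin env).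
  exact: measurable_ratio wl.
rewrite (_ : ratio_sum N c = (fun t => \sum_(l <- walks G v0 N) f l t)); last first.
  apply/funext => t; rewrite /ratio_sum big_mkcond big_seq [RHS]big_seq.
  by apply: eq_bigr => l /hb wl; rewrite /f asboolT.
rewrite ge0_integral_sum //; last first.
  move=> l t _; rewrite /f; case: ifP => // _; rewrite patchE; case: ifP => // _.
  by rewrite lee_fin edge_ratio_ge0.
under [leRHS]eq_integral => t _.
  rewrite (_ : (kernel_sum _ _ _ _ _)%:E = \sum_(l <- walks G v0 N) h' l t).
    over.
  rewrite /kernel_sum -sumEFin big_seq [RHS]big_seq; apply: eq_bigr => l /hb wl.
  rewrite /h' asboolT //=; case: (c _); last by rewrite mul0r mulr0.
  by rewrite mul1r mulrC.
rewrite ge0_integral_sum //; last first.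
  move=> l t _; rewrite /h'; case: ifP => // _; rewrite lee_fin mulr_ge0 //.
    exact: edge_ratio_ge0.
  exact: (cw_ge0 fin env).
rewrite big_seq [leRHS]big_seq; apply: lee_sum => l /hb wl.
rewrite /f /h' asboolT //=; case: (c _) => //.
by rewrite -integral_mkcond integral_ratio_cylinder.
Qed.

Lemma env_le_ratio :
  \int[P]_t (W t x y `^ s)%:E <= \int[P]_t (edge_ratio t (trajectory X t))%:E.
Proof.
apply: le_ae_ge0_integralT.
- by move=> t; rewrite lee_fin powR_ge0.
- by move=> t; rewrite lee_fin powR_ge0.
- apply/measurable_EFinP; apply: (measurableT_comp (measurable_powR s)).
  exact: (measurable_env env xy).
apply: filterS env_edge_pos_ae => t /andP[p0 p1]; rewrite lee_fin.
have w0 := env_ge0 env t xy.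
apply: ge0_ler_powR; rewrite // ?nnegrE // ?divr_ge0 //; first exact: ltW.
by rewrite ler_pdivlMr // ler_piMr.
Qed.

End FirstEdge.

Lemma walk_of_is_walk (V : choiceType) (G : graph V) (v0 : V) (g : nat -> V) m :
  is_walk G v0 g m -> walk_of_length G v0 (g m) m.
Proof.
move=> [g0 gadj]; exists (mkseq (fun i => g i.+1) m).
have nthE i : (i < m)%N -> nth v0 (mkseq (fun i => g i.+1) m) i = g i.+1.
  exact: nth_mkseq.
split; last exact: size_mkseq.
- apply/(pathP v0) => i; rewrite size_mkseq => im; rewrite nthE //.
  case: i im => [|i] im /=; last by rewrite nthE ?gadj // ltnW.
  by rewrite -g0; apply: gadj.
- by case: m {gadj nthE} => [//|m]; rewrite (last_nth v0) size_mkseq /= nth_mkseq.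
Qed.

Lemma gdist_le (V : choiceType) (G : graph V) x y m :
  walk_of_length G x y m -> (gdist G x y <= m)%N.
Proof.
move=> h; rewrite /gdist; case: pselect => // ex.
by case: ex_minnP => i _ imin; apply: imin; apply/asboolP.
Qed.

Lemma gdist0 (V : choiceType) (G : graph V) x y :
  connected_graph G -> gdist G x y = 0%N -> x = y.
Proof.
move=> conn; rewrite /gdist; case: pselect => [ex|nex _]; last first.
  by have [p [px py]] := conn x y; case: nex; exists (size p); apply/asboolP; exists p.
by case: ex_minnP => i /asboolP[p [_ pl sp]] _ i0; move: pl sp; rewrite i0; case: p.
Qed.

Section EdgeEvent.
Variables (V : choiceType) (G : graph V) (R : realType) (v0 : V) (a : R).
Hypotheses (fin : forall v, finite_set [set w | adj G v w]) (a_gt0 : 0 < a).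
Variables (x y : V) (n : nat).
Hypothesis xy : adj G x y.
Implicit Types (z : nat -> V).

Definition reaches (gs : seq V) m : bool :=
  `[< guide G v0 (nth v0 gs) m >] &&
  (((nth v0 gs m == x) && (nth v0 gs m.+1 == y)) ||
   ((nth v0 gs m == y) && (nth v0 gs m.+1 == x))).

Definition edge_event N z : bool :=
  [exists m : 'I_N, (n <= m)%N &&
     has (fun gs => reaches gs m && reach_event (nth v0 gs) m N z) (walks G v0 m.+1)].

Lemma edge_event_local : local (fun z N => edge_event N z).
Proof.
move=> N z z' zz; apply: eq_existsb => m; congr (_ && _); apply: eq_has => gs.
by rewrite (reach_event_local _ _ zz).
Qed.

(** The guide is taken at the first crossing of the edge in either direction. All edges being
    crossed both ways, its urns are closed from some time on. Its first [m] edges form a walk from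
    [v0] to an endpoint, hence [n <= m]. *)
Lemma edge_event_eventually z :
  (n <= gdist G v0 x)%N -> (n <= gdist G v0 y)%N ->
  (forall N, is_walk G v0 z N) ->
  (forall v w, adj G v w -> exists k, z k = v /\ z k.+1 = w) ->
  exists M, forall N, (M <= N)%N -> edge_event N z.
Proof.
move=> nx ny wz cz.
pose is_e u v := ((u == x) && (v == y)) || ((u == y) && (v == x)).
have ex : exists k, is_e (z k) (z k.+1).
  by have [k [kx ky]] := cz _ _ xy; exists k; rewrite /is_e kx ky !eqxx.
case: (ex_minnP ex) => k ek kmin.
have es u v : is_e u v = is_e v u by rewrite /is_e orbC ![(u == _) && _]andbC.
have [c1 c2] : crossings z k (z k) (z k.+1) = 0%N /\ crossings z k (z k.+1) (z k) = 0%N.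
  split; apply/eqP; rewrite -leqn0 leqNgt; apply/negP => /crossings_gt0P[j jk [e1 e2]].
    by have := kmin j; rewrite e1 e2 ek leqNgt jk => /(_ isT).
  by have := kmin j; rewrite e1 e2 es ek leqNgt jk => /(_ isT).
have [m [gs [kk hh]]] := guide_of_crossing fin (wz k.+1) c1 c2.
case: hh => mk gsin gd [gm gm1 pok [kkm hkk kki]].
set g := nth v0 gs in gd gm gm1 pok hkk.
have gw : is_walk G v0 g m.
  by case: gd => g0 ga _ _; split=> // i im; apply: ga; rewrite ltnW.
have nm : (n <= m)%N.
  have := gdist_le (walk_of_is_walk gw); apply: leq_trans.
  by rewrite gm; move: ek => /orP[/andP[/eqP -> _]|/andP[/eqP -> _]].
have adjg i : (i <= m)%N -> adj G (g i) (g i.+1) by case: gd => _ + _ _; apply.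
have cr v w : adj G v w -> exists M, forall N, (M <= N)%N -> (0 < crossings z N v w)%N.
  move=> /cz[j [j1 j2]]; exists j.+1 => N jN; exact: crossings_gt0 jN j1 j2.
have both i : exists M, forall N, (M <= N)%N -> (i <= m)%N ->
    (0 < crossings z N (g i) (g i.+1))%N /\ (0 < crossings z N (g i.+1) (g i))%N.
  case: (leqP i m) => im; last by exists 0%N.
  have [M1 h1] := cr _ _ (adjg i im).
  have [|M2 h2] := cr (g i.+1) (g i); first by rewrite adj_sym adjg.
  exists (maxn M1 M2) => N; rewrite geq_max => /andP[l1 l2] _.
  by split; [exact: h1|exact: h2].
pose Mf i := projT1 (cid (both i)).
have hMf i N : (Mf i <= N)%N -> (i <= m)%N ->
    (0 < crossings z N (g i) (g i.+1))%N /\ (0 < crossings z N (g i.+1) (g i))%N.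
  by move: i N; rewrite /Mf => i N; case: cid => /= M; apply.
exists (maxn m.+1 (\max_(i < m.+1) Mf i)) => N; rewrite geq_max => /andP[mN MN].
have cN i : (i <= m)%N ->
    (0 < crossings z N (g i) (g i.+1))%N /\ (0 < crossings z N (g i.+1) (g i))%N.
  move=> im; apply: hMf => //; apply: leq_trans MN.
  exact: (leq_bigmax (Ordinal (im : (i < m.+1)%N))).
apply/existsP; exists (Ordinal mN); rewrite /= nm /=; apply/hasP; exists gs => //.
rewrite /reaches asboolT //= -/g gm gm1 -/(is_e _ _) ek /=.
apply/and3P; split=> //.
- apply/forallP => i; have im := ltn_ord i.
  have ne : g i != g i.+2 by case: gd => _ _ _; apply.
  have [_ c3] := cN i (ltnW im); have [c4 _] := cN i.+1 im.
  by have := urn_end ne c3 c4; case: (urn _ _ _ _ _).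
- by apply/forallP => i; have [] := cN i (ltn_ord i).
Qed.

Variables (K : nat) (s : R).
Hypotheses (degK : forall v, (degree G v <= K)%N) (Ka : K%:R * a <= 1).
Hypotheses (s_gt0 : 0 < s) (s_lt : s < 4^-1) (K0 : (0 < K)%N).

Let th : R := 2 * s.
Let lam m : R := Num.sqrt a ^+ m.

Definition reach_const : R := 7 + lrrw_const th th.

(* [edge_bound] and [edge_gain] are the two halves of the AM-GM inequality,
   with weight [lam m], summed over the guides that end with the edge. *)
Definition edge_bound N : R := \sum_(m < N) (if (n <= m)%N then
  \sum_(gs <- walks G v0 m.+1) 2^-1 * lam m * (K%:R * 7 ^+ m) else 0).

Definition edge_gain N z k : R := \sum_(m < N) (if (n <= m)%N then
  \sum_(gs <- walks G v0 m.+1) (if reaches gs m then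
     2^-1 * (lam m)^-1 * urn_product (nth v0 gs) m (fun=> lrrw_value th th a) z k
   else 0) else 0).

Let th0 : 0 < th. Proof. by rewrite /th mulr_gt0. Qed.
Let th2 : th < 2^-1. Proof. by have h := s_lt; rewrite /th; lra. Qed.
Let CLp : 0 < lrrw_const th th.
Proof. by have h0 := th0; have h2 := th2; apply: lrrw_const_gt0 => //; lra. Qed.
Let lam0 m : 0 < lam m. Proof. by rewrite exprn_gt0 // sqrtr_gt0. Qed.
Let L0 (i : nat) st : 0 <= lrrw_value th th a st.
Proof. by have h0 := th0; have h2 := th2; apply: lrrw_value_ge0 => //; lra. Qed.

Lemma edge_bound_ge0 N : 0 <= edge_bound N.
Proof.
apply: sumr_ge0 => m _; case: ifP => // _; apply: sumr_ge0 => gs _.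
by rewrite !mulr_ge0 ?exprn_ge0 // ltW // lam0.
Qed.

Lemma edge_gain_ge0 N z k : 0 <= edge_gain N z k.
Proof.
apply: sumr_ge0 => m _; case: ifP => // _; apply: sumr_ge0 => gs _.
case: ifP => // _; rewrite !mulr_ge0 ?invr_ge0 //; first exact: ltW.
exact: urn_product_ge0.
Qed.

Lemma edge_event_chain (w : V -> V -> R) N :
  (forall v u, adj G v u -> 0 <= w v u) -> (forall v u, adj G v u -> w v u = w u v) ->
  vertex_weight G w v0 = 1 -> (0 < N)%N ->
  kernel_sum G v0 (chain_kernel G w) N (fun z _ =>
    (edge_event N z)%:R * (w x y / w (z 0%N) (z 1%N)) `^ s)
  <= edge_bound N + kernel_sum G v0 (chain_kernel G w) N (edge_gain N).
Proof.
move=> w_ge0 w_sym w1 N0.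
have pw0 z k : 0 <= path_weight (chain_kernel G w) z k.
  by apply: path_weight_ge0 => i u _; exact: (chain_step_ge0 fin w_ge0).
pose F m (gs : seq V) z : R := if reaches gs m then (reach_event (nth v0 gs) m N z)%:R *
  (w (nth v0 gs m) (nth v0 gs m.+1) / w (z 0%N) (z 1%N)) `^ s else 0.
have F0 m gs z : 0 <= F m gs z.
  by rewrite /F; case: ifP => // _; rewrite mulr_ge0 ?powR_ge0.
apply: (@le_trans _ _ (kernel_sum G v0 (chain_kernel G w) N (fun z _ =>
   \sum_(m < N) (if (n <= m)%N then \sum_(gs <- walks G v0 m.+1) F m gs z else 0)))).
  apply: (ler_kernel_sum fin) => [z _|z wz _]; first exact: pw0.
  have FF0 (m : nat) : 0 <= if (n <= m)%N then \sum_(gs <- walks G v0 m.+1) F m gs z else 0.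
    by case: ifP => // _; apply: sumr_ge0.
  case E : (edge_event N z); last by rewrite mul0r sumr_ge0.
  case/existsP: E => m /andP[nm /hasP[gs gsin /andP[rg re]]].
  rewrite mul1r (bigD1 m) //= nm ler_wpDr //; first by apply: sumr_ge0.
  rewrite (big_rem gs) //= ler_wpDr ?sumr_ge0 //.
  rewrite /F rg re mul1r; case/andP: rg => _.
  case/orP => /andP[/eqP -> /eqP ->] //; by rewrite (w_sym _ _ xy).
rewrite /kernel_sum.
under eq_bigr => l _ do rewrite mulr_sumr.
under [X in _ <= _ + X]eq_bigr => l _ do rewrite mulr_sumr.
rewrite exchange_big /= [X in _ <= _ + X]exchange_big /= -big_split /=.
apply: ler_sum => m _; case: ifP => nm; last first.
  by rewrite !big1 ?addr0 // => l _; rewrite mulr0.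
under eq_bigr => l _ do rewrite mulr_sumr.
under [X in _ <= _ + X]eq_bigr => l _ do rewrite mulr_sumr.
rewrite exchange_big /= [X in _ <= _ + X]exchange_big /= -big_split /=.
apply: ler_sum => gs _; rewrite /F; case rg : (reaches gs m); last first.
  rewrite [leLHS]big1 => [|l _]; last by rewrite mulr0.
  rewrite [X in _ + X]big1 => [|l _]; last by rewrite mulr0.
  by rewrite addr0 !mulr_ge0 ?exprn_ge0 // ltW // lam0.
case/andP: rg => /asboolP gd _.
have := reach_event_chain fin a_gt0 w_ge0 w_sym degK w1 s_gt0 s_lt gd N0 (lam0 m).
move/le_trans; apply; rewrite lerD2l /kernel_sum mulr_sumr le_eqVlt; apply/orP; left.
by apply/eqP/eq_bigr => l _; rewrite mulrCA.
Qed.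

(** The 2 comes from the tail of a geometric series of ratio at most 1/2. Of [K^2], one factor comes
    from the first edge and one from the excess of [K^(m+1)], the bound on the number of guides,
    over the [K^m] in the series. *)
Lemma edge_event_bound N : K%:R * reach_const * Num.sqrt a <= 2^-1 ->
  edge_bound N + kernel_sum G v0 (lrrw_step G a) N (edge_gain N)
  <= 2 * K%:R ^+ 2 * (K%:R * reach_const * Num.sqrt a) ^+ n.
Proof.
set q := K%:R * reach_const * Num.sqrt a => q1.
have KR : 1 <= K%:R :> R by rewrite ler1n.
have C7 : 7 <= reach_const by rewrite /reach_const lerDl ltW.
have CC : lrrw_const th th <= reach_const by rewrite /reach_const lerDr.
have q0 : 0 <= q by rewrite !mulr_ge0 //; lra.
have h0 := th0; have h2 := th2; have h1 : th <= 1 by lra.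
rewrite /kernel_sum.
under [X in _ + X]eq_bigr => l _ do rewrite mulr_sumr.
rewrite [X in _ + X]exchange_big /= -big_split /=.
apply: (@le_trans _ _ (\sum_(m < N) K%:R ^+ 2 * (if (n <= m)%N then q ^+ m else 0))).
  apply: ler_sum => m _; case: ifP => nm; last first.
    by rewrite mulr0 add0r big1 // => l _; rewrite mulr0.
  under [X in _ + X]eq_bigr => l _ do rewrite mulr_sumr.
  rewrite [X in _ + X]exchange_big /= -big_split /=.
  apply: (@le_trans _ _ (\sum_(gs <- walks G v0 m.+1)
      lam m * (K%:R * reach_const ^+ m))).
    apply: ler_sum => gs _.
    have x7 : 7 ^+ m <= reach_const ^+ m by apply: lerXn2r => //; rewrite nnegrE; lra.
    have xC : lrrw_const th th ^+ m <= reach_const ^+ m.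
      by apply: lerXn2r => //; rewrite nnegrE ltW //; lra.
    have p0 : 0 <= reach_const ^+ m by rewrite exprn_ge0 //; lra.
    have A1 : K%:R * 7 ^+ m <= K%:R * reach_const ^+ m by rewrite ler_wpM2l.
    have A2 : lrrw_const th th ^+ m <= K%:R * reach_const ^+ m.
      by apply: le_trans xC _; rewrite ler_peMl.
    have l0 := ltW (lam0 m).
    have B1 := ler_wpM2l l0 A1; have B2 := ler_wpM2l l0 A2.
    have B0 : 0 <= lam m * (K%:R * reach_const ^+ m) by rewrite !mulr_ge0.
    case rg : (reaches gs m); last first.
      rewrite big1 => [|l _]; last by rewrite mulr0.
      rewrite -mulrA addr0.
      by move: (lam m * (K%:R * 7 ^+ m)) (lam m * (K%:R * _)) B1 B0 => u1 u2; lra.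
    case/andP: rg => /asboolP gd _.
    have hL : kernel_sum G v0 (lrrw_step G a) N
        (urn_product (nth v0 gs) m (fun=> lrrw_value th th a)) <= (lrrw_const th th * a) ^+ m.
      rewrite (_ : urn_product _ _ _ = (fun z k => urn_product (nth v0 gs) m
        (fun=> lrrw_value th th a) z (exit_time predT z k))).
        exact: (lrrw_urn_product fin a_gt0 degK Ka h0 h1 (ltW h0) h2 gd).
      by apply/funext => z; apply/funext => k; rewrite exit_timeT.
    rewrite /kernel_sum in hL.
    have -> : \sum_(l <- walks G v0 N) path_weight (lrrw_step G a) (nth v0 l) N *
        (2^-1 * (lam m)^-1 *
         urn_product (nth v0 gs) m (fun=> lrrw_value th th a) (nth v0 l) N) =
      2^-1 * (lam m)^-1 * \sum_(l <- walks G v0 N) path_weight (lrrw_step G a) (nth v0 l) N *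
         urn_product (nth v0 gs) m (fun=> lrrw_value th th a) (nth v0 l) N.
      by rewrite mulr_sumr; apply: eq_bigr => l _; rewrite mulrCA.
    have li0 : 0 <= 2^-1 * (lam m)^-1 by rewrite mulr_ge0 // invr_ge0.
    have B3 := ler_wpM2l li0 hL.
    have e : 2^-1 * (lam m)^-1 * (lrrw_const th th * a) ^+ m =
        2^-1 * (lam m * lrrw_const th th ^+ m).
      have sa : a = Num.sqrt a ^+ 2 by rewrite sqr_sqrtr // ltW.
      rewrite {1}sa exprMn -exprM mulnC exprM -/(lam m) expr2.
      by field; rewrite gt_eqF.
    rewrite e in B3; rewrite -mulrA.
    move: (\sum_(l <- _) _) (lam m * (K%:R * 7 ^+ m)) (lam m * (K%:R * reach_const ^+ m))
      (lam m * _) B1 B2 B3 => S u1 u2 u3; lra.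
  rewrite big_const_seq count_predT iter_addr addr0 -[leLHS]mulr_natl.
  apply: (@le_trans _ _ ((K ^ m.+1)%:R * (lam m * (K%:R * reach_const ^+ m)))).
    apply: ler_wpM2r; last by rewrite ler_nat size_walks.
    by rewrite !mulr_ge0 ?exprn_ge0 // ?(ltW (lam0 m)) //; lra.
  rewrite natrX exprS le_eqVlt; apply/orP; left; apply/eqP.
  by rewrite /q !exprMn /lam; ring.
rewrite -mulr_sumr [2 * _]mulrC -[leRHS]mulrA ler_wpM2l ?exprn_ge0 //.
exact: geometric_tail.
Qed.

End EdgeEvent.

Section RatioMoment.
Variables (V : choiceType) (G : graph V) (R : realType) (v0 : V) (a : R).
Variables (d : measure_display) (T : measurableType d) (P : probability T R).
Variables (X : nat -> T -> V) (W : T -> V -> V -> R).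
Hypotheses (fin : forall v, finite_set [set w | adj G v w]) (a_gt0 : 0 < a).
Hypothesis has_nbr : forall v, exists u, adj G v u.
Hypothesis env : is_random_environment G P v0 a X W.
Variables (K : nat) (x y : V) (s : R).
Hypotheses (degK : forall v, (degree G v <= K)%N) (K0 : (0 < K)%N).
Hypotheses (xy : adj G x y) (s_gt0 : 0 < s) (s_lt : s < 4^-1).

Let env1 : {ae P, forall t, vertex_weight G (W t) v0 = 1}. Proof. by case: env. Qed.

(** At distance 0 the sum over guides would give [2 K^2], which may exceed the [2 K] required;
    looking at the first step alone gives [K]. *)
Lemma ratio_moment_root : v0 = x \/ v0 = y ->
  (\int[P]_t (edge_ratio W x y s t (trajectory X t))%:E <= K%:R%:E)%E.
Proof.
move=> vxy; have s0 := ltW s_gt0.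
have s1 : s <= 2^-1 by have h := s_lt; lra.
apply: (@le_trans _ _ (\int[P]_t ratio_sum G v0 X W x y s 1 predT t)%E).
  apply: ae_ge0_le_integralT.
  - by move=> t; rewrite lee_fin edge_ratio_ge0.
  - by move=> t; exact: ratio_sum_ge0.
  - exact: (measurable_ratio_sum fin env s xy).
  apply: filterS (is_walk_ae fin a_gt0 has_nbr env) => t wt.
  exact: (edge_ratio_le_sum _ fin).
have h := @integral_ratio_sum_le V G R v0 a d T P X W fin env x y s xy 1 predT
  (fun _ _ => 0) K%:R isT (ler0n _ _) (fun _ _ => lexx _).
have k0 (p : (nat -> V) -> nat -> V -> R) : kernel_sum G v0 p 1 (fun _ _ => 0) = 0.
  by apply: big1 => l _; rewrite mulr0.
move: h; rewrite k0 addr0; apply; apply: filterS env1 => t w1.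
rewrite k0 addr0 /kernel_sum big_walksS /= big_seq1.
have [u au wu] : exists2 u, adj G v0 u & W t x y = W t v0 u.
  case: vxy => ->; first by exists y.
  by exists x; [rewrite adj_sym | exact: (env_sym env)].
apply: le_trans (chain_first_edge fin (env_ge0 env t) s0 s1 degK w1 au).
apply: ler_sum => z _.
by rewrite /path_weight big_ord1 /= mul1r /edge_ratio /= wu.
Qed.

Hypotheses (Ka : K%:R * a <= 1) (a1 : a <= 1) (conn : connected_graph G).
Hypothesis a_exit : 48%:R * K%:R ^+ 2 * exit_const R * Num.sqrt a <= 1.
Hypothesis a_reach : K%:R * reach_const s * Num.sqrt a <= 2^-1.

Lemma ratio_moment n : (n <= gdist G v0 x)%N -> (n <= gdist G v0 y)%N ->
  (\int[P]_t (edge_ratio W x y s t (trajectory X t))%:E <=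
    (2 * K%:R ^+ 2 * (K%:R * reach_const s * Num.sqrt a) ^+ n)%:E)%E.
Proof.
move=> nx ny.
apply: (@integral_le_eventually _ _ _ _ _
  (fun N => ratio_sum G v0 X W x y s N.+1 (edge_event G v0 x y n N.+1))).
- by move=> t; rewrite lee_fin edge_ratio_ge0.
- by move=> N t; exact: ratio_sum_ge0.
- by move=> N; exact: (measurable_ratio_sum fin env s xy).
- move=> N; apply: (@le_trans _ _ (edge_bound G v0 a n K N.+1 +
    kernel_sum G v0 (lrrw_step G a) N.+1 (edge_gain G v0 a x y n s N.+1))%:E).
    apply: (integral_ratio_sum_le fin env) => //.
    - exact: edge_bound_ge0.
    - by move=> z k; exact: edge_gain_ge0.
    apply: filterS env1 => t w1.
    apply: (edge_event_chain fin) => //; first exact: (env_ge0 env).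
    by move=> v u; exact: (env_sym env).
  by rewrite lee_fin; apply: edge_event_bound.
apply: filterS2 (is_walk_ae fin a_gt0 has_nbr env)
  (all_edges_crossed_ae fin a_gt0 has_nbr env degK Ka a1 K0 a_exit conn) => t wt ct.
have [M hM] := edge_event_eventually fin xy nx ny wt ct.
exists M => N MN; apply: (edge_ratio_le_sum _ fin) => //.
  by move=> l l' ll; exact: edge_event_local.
by apply: hM; exact: leq_trans MN (leqnSn N).
Qed.

End RatioMoment.

Theorem theorem2 (R : realType) (K : nat) (s : R) (s_gt0 : 0 < s)
    (s_lt : s < 4%:R^-1) :
  exists a0 C : R, 0 < a0 /\
    forall (V : choiceType) (G : graph V) (v0 : V) (a : R)
      (d : measure_display) (T : measurableType d) (P : probability T R)
      (X : nat -> T -> V) (W : T -> V -> V -> R),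
      connected_graph G -> degrees_le G K ->
      0 < a -> a < a0 ->
      is_random_environment G P v0 a X W ->
      forall x y : V, adj G x y ->
        ('E_P[fun t => (W t x y `^ s)%R]
           <= 'E_P[fun t => ((W t x y / W t (X 0%N t) (X 1%N t)) `^ s)%R])%E /\
        ('E_P[fun t => ((W t x y / W t (X 0%N t) (X 1%N t)) `^ s)%R]
           <= (2 * K%:R * (C * Num.sqrt a) ^+ edge_dist G x y v0)%:E)%E.
Proof.
have E0 := exit_const_gt0 R.
have C0 : 0 < reach_const s.
  have : 0 < lrrw_const (2 * s) (2 * s) by apply: lrrw_const_gt0; lra.
  rewrite /reach_const; lra.
have K00 : 0 <= K%:R :> R by [].
set cE := 48%:R * K%:R ^+ 2 * exit_const R.
set cR := K%:R * reach_const s.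
have cE0 : 0 <= cE by rewrite !mulr_ge0 ?exprn_ge0 // ltW.
have cR0 : 0 <= cR by rewrite mulr_ge0 // ltW.
(* One inequality [sqrt a * D <= 1] yields the smallness conditions together: each term is at most
   1, and the factor 2 turns the last one into 1/2. *)
pose D : R := 1 + K%:R + cE + 2 * cR.
have D0 : 0 < D by rewrite /D; lra.
(* In the second constant one factor [K] is already part of the series in [ratio_moment]; the other
   absorbs, for distance at least 1, the excess of [2 K^2] over [2 K]. *)
exists (D^-1 ^+ 2), (K%:R ^+ 2 * reach_const s); split.
  by rewrite exprn_gt0 // invr_gt0.
move=> V G v0 a d T P X W conn deg a_gt0 a_lt env x y xy.
have fin v : finite_set [set w | adj G v w] by have [] := deg v.
have degK v : (degree G v <= K)%N by have [] := deg v.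
have has_nbr v : exists u, adj G v u.
  have [[|u p] [/= pth pl]] := conn v x; first by exists y; rewrite pl.
  by exists u; case/andP: pth.
have K0 : (0 < K)%N.
  apply: leq_trans (degK x); rewrite /degree cardfs_gt0; apply/fset0Pn; exists y.
  by rewrite mem_nbrs.
set r := Num.sqrt a.
have r0 : 0 < r by rewrite sqrtr_gt0.
have ar : a = r * r by rewrite -expr2 sqr_sqrtr // ltW.
have rD : r * D <= 1.
  rewrite -ler_pdivlMr // mul1r -(@ler_pXn2r _ 2) ?nnegrE //; first 1 last.
  - exact: ltW.
  - by rewrite invr_ge0 ltW.
  by rewrite sqr_sqrtr ltW.
have rK : 0 <= r * K%:R by rewrite mulr_ge0 // ltW.
have rE : 0 <= r * cE by rewrite mulr_ge0 // ltW.
have rR : 0 <= r * cR by rewrite mulr_ge0 // ltW.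
have rDE : r * D = r + r * K%:R + r * cE + 2 * (r * cR) by rewrite /D; ring.
have r1 : r <= 1 by lra.
have Ka : K%:R * a <= 1.
  by rewrite ar mulrA [K%:R * r]mulrC; apply: mulr_ile1 => //; lra.
have a1 : a <= 1 by rewrite ar; apply: mulr_ile1 => //; lra.
have a_exit : cE * r <= 1 by rewrite mulrC; lra.
have a_reach : cR * r <= 2^-1 by rewrite mulrC; lra.
rewrite !unlock; split; first exact: (env_le_ratio fin a_gt0 has_nbr env xy (ltW s_gt0)).
set n := edge_dist G x y v0.
have [n0|n0] := posnP n.
  rewrite n0 expr0 mulr1.
  apply: (@le_trans _ _ (K%:R%:E)); last by rewrite lee_fin; lra.
  apply: (ratio_moment_root fin a_gt0 has_nbr env degK xy s_gt0 s_lt).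
  move: n0; rewrite /n /edge_dist /minn.
  by case: ifP => _ /(gdist0 conn) ->; [left|right].
have nx : (n <= gdist G v0 x)%N by exact: geq_minl.
have ny : (n <= gdist G v0 y)%N by exact: geq_minr.
apply: le_trans (ratio_moment fin a_gt0 has_nbr env degK K0 xy s_gt0 s_lt Ka a1 conn
  a_exit a_reach nx ny) _.
rewrite lee_fin -/r -/cR.
have -> : K%:R ^+ 2 * reach_const s * r = K%:R * (cR * r) by rewrite /cR; ring.
rewrite [(K%:R * (cR * r)) ^+ n]exprMn.
have q0 : 0 <= (cR * r) ^+ n by rewrite exprn_ge0 // mulr_ge0 // ltW.
have kn : K%:R <= K%:R ^+ n :> R.
  by rewrite -[leLHS]expr1 ler_weXn2l // ler1n.
have -> : 2 * K%:R ^+ 2 * (cR * r) ^+ n = 2 * K%:R * (cR * r) ^+ n * K%:R by ring.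
have -> : 2 * K%:R * (K%:R ^+ n * (cR * r) ^+ n) = 2 * K%:R * (cR * r) ^+ n * K%:R ^+ n.
  by ring.
by rewrite ler_wpM2l // !mulr_ge0.
Qed.
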